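(* Let $l \in \{5,6,7\}$. Every graph $G \in \mathcal{P}_{4,l}$ (that is, every planar graph $G$ containing no cycle of length $4$ and no cycle of length $l$) has a matching $M$ such that $AT(G-M) \le 3$.
   Context: Graphs are finite and simple. For positive integers $k,l$, $\mathcal{P}_{k,l}$ denotes the family of planar graphs that contain no cycle of length $k$ and no cycle of length $l$ (as subgraphs, not necessarily induced). A matching $M$ is a set of pairwise vertex-disjoint edges of $G$ (possibly empty), and $G-M$ is the graph obtained from $G$ by deleting the edges in $M$ (keeping all vertices). Alon-Tarsi number: Associate to each vertex $v$ of $G$ a variable $x_v$, and fix an arbitrary linear ordering $<$ of $V(G)$. The graph polynomial is $P_G(\mathbf{x}) = \prod_{uv \in E(G),\, u<v} (x_v - x_u)$ (with integer coefficients). For a mapping $\eta : V(G) \to \{0,1,2,\ldots\}$ let $c_{P_G,\eta}$ be the coefficient of the monomial $\prod_{v\in V(G)} x_v^{\eta(v)}$ in the expansion of $P_G$. Then $$AT(G) = \min\{k : c_{P_G,\eta} \neq 0 \text{ for some } \eta \text{ with } \eta(v) < k \text{ for all } v \in V(G)\}.$$ *)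

(* Defs.v *)
From mathcomp Require Import all_boot all_order all_algebra.
From mathcomp Require mpoly.

Set Implicit Arguments.
Unset Strict Implicit.
Unset Printing Implicit Defensive.

Import Order.TTheory GRing.Theory Num.Theory.

(* A finite simple graph is a symmetric irreflexive relation [e : rel T] on a
   [finType] of vertices; an edge uv is represented by the set [set u; v]. *)

Section Graphs.
Local Open Scope nat_scope.
Variables (T : finType) (e : rel T).

Definition edges : {set {set T}} :=
  [set [set p.1; p.2] | p : T * T & e p.1 p.2].

Definition has_cycle (k : nat) : Prop :=
  2 < k /\ exists c : k.-tuple T, ucycle e c.

Definition is_matching (M : {set {set T}}) : Prop :=
  M \subset edges /\ trivIset M.

Definition del_edges (M : {set {set T}}) : rel T :=
  [rel u v | e u v && ([set u; v] \notin M)].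

End Graphs.

(* The notations of [mpoly] are incompatible with those of the analysis library:
   [mpoly] is imported locally, and the analysis library after this module. *)
Module AlonTarsi.
Import mpoly.
Section AlonTarsi.
Local Open Scope ring_scope.
Variables (T : finType) (e : rel T).

(* The linear order on the vertices is the enumeration order of T, and the
   variable x_v is 'X_(enum_rank v); another order could only change the sign
   of the polynomial. *)
Definition graph_poly : {mpoly int[#|T|]} :=
  \prod_(u : T) \prod_(v : T | e u v && (enum_rank u < enum_rank v)%N)
    ('X_(enum_rank v) - 'X_(enum_rank u)).

Definition vertex_monomial (eta : T -> nat) : 'X_{1..#|T|} :=
  [multinom eta (enum_val i) | i < #|T|].

Definition AT_spec (k : nat) : bool :=
  [exists eta : {ffun T -> 'I_k}, graph_poly@_(vertex_monomial (fun v => eta v)) != 0].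

Lemma graph_poly_neq0 : graph_poly != 0.
Proof.
apply/prodf_neq0 => u _; apply/prodf_neq0 => v /andP[_ uv].
apply/eqP => /(congr1 (mcoeff U_(enum_rank v))%MM) /eqP.
rewrite mcoeffB mcoeff0 !mcoeffX !eq_mnm1 eqxx.
by rewrite -[enum_rank u == _]val_eqE ltn_eqF ?subr0.
Qed.

Lemma AT_spec_ex : exists k, AT_spec k.
Proof.
have := graph_poly_neq0; rewrite -msupp_eq0.
case E: (msupp graph_poly) => [//|m s] _.
exists (\max_i m i).+1; apply/existsP.
exists [ffun v => inord (m (enum_rank v))].
rewrite -mcoeff_msupp (_ : vertex_monomial _ = m) ?E ?mem_head //.
apply/mnmP => i; rewrite mnmE ffunE enum_valK inordK // ltnS.
exact: leq_bigmax.
Qed.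

Definition AT : nat := ex_minn AT_spec_ex.

End AlonTarsi.
End AlonTarsi.

Definition AT (T : finType) (e : rel T) : nat := AlonTarsi.AT e.

From mathcomp Require Import classical_sets set_interval reals topology normedtype.
Import numFieldTopology.Exports.

Section Planarity.
Local Open Scope ring_scope.
Local Open Scope classical_set_scope.
Variables (R : realType) (T : finType) (e : rel T).

(* [p v] is the point representing the vertex v, and [g A], on [0, 1], is a
   parametrization of the simple arc representing the edge A. The interior of
   an arc contains no vertex and no point of any other arc. *)
Record plane_drawing (p : T -> R * R) (g : {set T} -> R -> R * R) : Prop := {
  drawing_vertex_inj : injective p;
  drawing_arc_continuous : forall A, A \in edges e ->
    {within `[0, 1], continuous (g A)};
  drawing_arc_inj : forall A, A \in edges e -> {in `[0, 1] &, injective (g A)};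
  drawing_arc_ends : forall A, A \in edges e ->
    [set g A 0; g A 1] = p @` [set` A];
  drawing_arc_vertex : forall A v (t : R), A \in edges e -> 0 < t < 1 ->
    g A t <> p v;
  drawing_arc_arc : forall A B (s t : R), A \in edges e -> B \in edges e ->
    A != B -> 0 < s < 1 -> 0 < t < 1 -> g A s <> g B t
}.

Definition planar : Prop := exists p g, plane_drawing p g.

Definition planar_without_cycles (k l : nat) : Prop :=
  [/\ planar, ~ has_cycle e k & ~ has_cycle e l].

End Planarity.

(* Main.v *)
(* The matching M can be chosen so that G - M is 2-degenerate: building G - M
   by adding vertices with at most two earlier neighbours, the monomial in which
   each vertex has its number of earlier neighbours as exponent has coefficient
   1 or -1 in the graph polynomial.

   Let S be a vertex set of minimal size inducing a subgraph without such a
   matching; all its degrees are at least 3. Call a set flexible if each of its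
   vertices r can be the one that is left out of the matching at the price of a
   third earlier neighbour of r. A vertex of degree 3 is flexible, and a flexible
   set stays flexible when a triangle is glued to it along one vertex, its other
   two vertices being new and of degree at most 4. By minimality there is no edge
   between disjoint flexible sets, and no edge from the new vertices of a glued
   triangle to the old set outside of the triangle. Take a family of disjoint
   flexible sets, obtained by gluing from all the vertices of degree 3, with the
   largest number of triangles, and call the vertices of these sets yellow.

   With charge 4d(v) - 12 at v, the two degree-4 vertices of a glued triangle pay
   6 for this triangle. The other vertices pay 6 for each other triangular face
   and 2 for each face of length 5. The cycle conditions enter only here: no two
   triangles share an edge, no face has length 4, and at most one edge of a
   5-cycle lies in a triangle, since one such triangle gives a 6-cycle and two
   give a 7-cycle or a 4-cycle. Hence the charges sum to at least 6 f3 + 2 f5, where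
   f3 and f5 are the numbers of faces of lengths 3 and 5, contradicting Euler's
   inequality |E| < |S| + |F|.

   Instead of the Jordan curve theorem, the faces come from a square grid: by
   compactness the graph of a drawing is a minor of a fine grid, whose cells are
   then merged across the grid edges not used by the minor. The boundaries of
   the merged regions generate the cycle space, and each edge is on at most two
   of them; by a dimension count this implies Euler's inequality. *)

Require Import Defs.
From mathcomp Require Import all_boot all_order all_algebra.
From mathcomp Require Import zify lra.
From mathcomp Require Import reals.
From mathcomp Require mpoly boolp classical_sets set_interval interval_inference.
From mathcomp Require topology normedtype.

Set Implicit Arguments.
Unset Strict Implicit.
Unset Printing Implicit Defensive.

(** * Degenerate orderings and the Alon-Tarsi number *)

(** A degeneracy ordering of a set relative to an initial part [B]. The bound [k] depends on the
    vertex so that a single one can be granted a third earlier neighbour. *)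
Inductive buildable (T : finType) (k : T -> nat) (h : rel T) (B : {set T}) :
    {set T} -> Prop :=
| buildable_refl : buildable k h B B
| buildable_add (A : {set T}) (v : T) : buildable k h B A -> v \notin A ->
    #|[set u in A | h u v]| <= k v -> buildable k h B (v |: A).

Section Buildable.
Variable T : finType.
Implicit Types (k : T -> nat) (h : rel T) (A B C D : {set T}).

Lemma buildable_sub k h B A : buildable k h B A -> B \subset A.
Proof. by elim=> // {}A v _ BA _ _; apply: subset_trans BA (subsetUr _ _). Qed.

Lemma buildable_trans k h C B A :
  buildable k h C B -> buildable k h B A -> buildable k h C A.
Proof. by move=> CB; elim=> // {}A v _ CA vA dv; apply: buildable_add. Qed.

(** The order of addition is kept, with [D] left out at every stage. The condition is asked for
    every [C] above [B], so that the actual stages need not be known. *)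
Lemma buildable_change k h k' h' B A D : buildable k h B A -> D \subset B ->
  (forall v C, v \in A -> v \notin B -> B \subset C ->
     #|[set u in C | h u v]| <= k v -> #|[set u in C :\: D | h' u v]| <= k' v) ->
  buildable k' h' (B :\: D) (A :\: D).
Proof.
move=> bA DB; elim: bA => [|{}A v bA IH vA dv] H; first exact: buildable_refl.
have BA := buildable_sub bA; have vB : v \notin B := contra (subsetP BA v) vA.
have vD : v \notin D by apply: contra vB => /(subsetP DB).
rewrite setDUl [[set v] :\: D](setDidPl _); last by rewrite disjoints1.
apply: buildable_add.
- by apply: IH => u C uA; apply: H; exact: setU1r.
- by rewrite inE (negPf vA) andbF.
- by apply: H => //; exact: setU11.
Qed.

End Buildable.

Module ATDegenerate.
Import mpoly GRing.Theory.
Local Open Scope ring_scope.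

(** * Leading coefficients in one variable *)

Section Leading.
Variables (n : nat).
Implicit Types (P Q : {mpoly int[n]}) (i j : 'I_n) (m : 'X_{1..n}).

Definition deg_le i (k : nat) P := forall m, P@_m != 0 -> (m i <= k)%N.

Lemma mcoeffMX_eq0 P i m : m i = 0%N -> (P * 'X_i)@_m = 0.
Proof.
move=> mi; apply/eqP/negPn/negP; rewrite -mcoeff_msupp (perm_mem (msuppMX _ _)).
case/mapP => a _ E; by move: mi; rewrite E mnmDE mnm1E eqxx.
Qed.

Lemma mcoeffMX_pred P i m : (0 < m i)%N ->
  (P * 'X_i)@_m = P@_(m - U_(i))%MM.
Proof.
move=> mi; rewrite -[in LHS](@submK n U_(i)%MM m) ?lep1mP -?lt0n //.
by rewrite addmC mcoeffMX.
Qed.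

Lemma deg_le_mulX j i k P : deg_le i k P ->
  deg_le i (if j == i then k.+1 else k) (P * 'X_j).
Proof.
move=> dP m; have [mj|mj] := posnP (m j).
  by rewrite mcoeffMX_eq0 ?eqxx.
rewrite mcoeffMX_pred // => /dP; rewrite mnmBE mnm1E.
by case: eqVneq => [<-|_]; rewrite ?subn0 // leq_subLR add1n.
Qed.

Arguments deg_le_mulX j [i k P].

Lemma deg_leB i k P Q : deg_le i k P -> deg_le i k Q -> deg_le i k (P - Q).
Proof.
move=> dP dQ m; rewrite mcoeffB; have [P0|/dP //] := eqVneq P@_m 0.
by rewrite P0 sub0r oppr_eq0 => /dQ.
Qed.

Lemma deg_leN i k P : deg_le i k P -> deg_le i k (- P).
Proof. by move=> dP m; rewrite mcoeffN oppr_eq0 => /dP. Qed.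

Lemma deg_leW i k l P : (k <= l)%N -> deg_le i k P -> deg_le i l P.
Proof. by move=> kl dP m /dP /leq_trans; apply. Qed.

Lemma deg_le_mul_diff i j k P : j != i -> deg_le i k P ->
  deg_le i k.+1 (P * ('X_i - 'X_j)).
Proof.
move=> ji dP; rewrite mulrBr; apply: deg_leB.
  by have := deg_le_mulX i dP; rewrite eqxx.
apply: (@deg_leW i k) => //.
by have := deg_le_mulX j dP; rewrite (negPf ji).
Qed.

Lemma mcoeff_mul_diff i j k P m : j != i -> deg_le i k P -> m i = k ->
  (P * ('X_i - 'X_j))@_(m + U_(i))%MM = P@_m.
Proof.
move=> ji dP mi; rewrite mulrBr mcoeffB addmC mcoeffMX.
suff -> : (P * 'X_j)@_(U_(i) + m)%MM = 0 by rewrite subr0.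
apply/eqP/negPn/negP; have := deg_le_mulX j dP.
rewrite (negPf ji) => /[apply]; rewrite mnmDE mnm1E eqxx mi; by rewrite ltnn.
Qed.

(** Each factor is ['X_i - 'X_j] up to sign, so the coefficient of the highest possible power of
    ['X_i] in the product is [P] up to sign. *)
Lemma leading_coef i (s : seq 'I_n) (b : 'I_n -> bool) P m :
    i \notin s -> deg_le i 0 P -> m i = 0%N -> P@_m != 0 ->
  let Q := P * \prod_(j <- s) (if b j then 'X_i - 'X_j else 'X_j - 'X_i) in
  deg_le i (size s) Q /\ Q@_(m + U_(i) *+ size s)%MM != 0.
Proof.
move=> si dP mi Pm /=; elim: s si => [|j s IH].
  by rewrite big_nil mulr1 mulm0n addm0.
rewrite inE negb_or eq_sym => /andP[ij /IH[dQ cQ]].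
rewrite big_cons /= mulrCA mulrC.
set Q := P * _ in dQ cQ *.
have mE : (m + U_(i) *+ (size s).+1 = m + U_(i) *+ size s + U_(i))%MM.
  by apply/mnmP => u; rewrite !(mnmDE, mulmnE) mulnS addnAC addnA.
have mk : (m + U_(i) *+ size s)%MM i = size s.
  by rewrite mnmDE mulmnE mnm1E eqxx mi mul1n.
have mcE := mcoeff_mul_diff ij dQ mk; have dE := deg_le_mul_diff ij dQ.
rewrite mE; case: (b j); first by rewrite mcE.
rewrite -opprB mulrN; split; first exact: deg_leN.
by rewrite mcoeffN oppr_eq0 mcE.
Qed.

End Leading.
Arguments deg_le_mulX {n} j [i k P].

(** * The graph polynomial along a degenerate ordering *)

Section Main.
Variables (T : finType) (h : rel T).
Hypotheses (hsym : ssrbool.symmetric h) (hirr : irreflexive h).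
Local Notation graph_poly := AlonTarsi.graph_poly.

(** The vertex type is not reduced, so that all these polynomials have the same variables. *)
Definition within (A : {set T}) : rel T := [rel u v | [&& h u v, u \in A & v \in A]].

Lemma eq_graph_poly (f g : rel T) : f =2 g -> graph_poly f = graph_poly g.
Proof.
by move=> fg; apply: eq_bigr => u _; apply: eq_bigl => v; rewrite fg.
Qed.

Lemma graph_poly_add (A : {set T}) v : v \notin A ->
  graph_poly (within (v |: A)) = graph_poly (within A) *
   \prod_(j <- [seq enum_rank u | u <- enum [set u in A | h u v]])
     (if (j < enum_rank v)%N then 'X_(enum_rank v) - 'X_j else 'X_j - 'X_(enum_rank v)).
Proof.
move=> vA; rewrite /AlonTarsi.graph_poly !pair_big_dep /=.
(* Pairs with [v] as an end yield the product over the earlier neighbours; the other pairs yield the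
   polynomial of [A]. *)
rewrite (bigID (fun p : T * T => (p.1 == v) || (p.2 == v))) /= mulrC.
congr (_ * _).
  apply: eq_bigl => -[u w] /=; rewrite /within /= !in_setU1.
  have [->|] /= := eqVneq u v; first by rewrite (negPf vA) !andbF.
  by have [->|] /= := eqVneq w v; rewrite ?(negPf vA) ?andbF ?andbT.
rewrite big_map big_enum /=.
rewrite (reindex_onto (fun u => if (enum_rank u < enum_rank v)%N then (u, v) else (v, u))
   (fun p : T * T => if p.1 == v then p.2 else p.1)); last first.
  move=> [u w] /= /andP[/andP[/and3P[huw uA wA] uw]].
  have [uv|uv] /= := eqVneq u v.
    by rewrite uv in uw *; rewrite ltnNge (ltnW uw).
  by move/eqP=> wv; rewrite -wv uw.
apply: congr_big => // u; last by move=> _; rewrite /=; case: ifP.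
rewrite /within /= in_set; have [->|uv] := eqVneq u v.
  by rewrite ltnn /= hirr /= (negPf vA).
case: ltnP => [uv'|vu'] /=; rewrite !in_setU1 !eqxx (negPf uv) /= ?eqxx ?orbT /= !andbT.
  by rewrite uv' andbT andbC.
rewrite ltn_neqAle vu' andbT hsym.
case: (u \in A) (h u v) => [] [] //=; rewrite ?andbT ?andbF //.
apply/eqP => /ord_inj /enum_rank_inj vu.
by rewrite vu eqxx in uv.
Qed.

(** The exponent of a vertex is its number of earlier neighbours. The induction also carries that
    variables of vertices outside [A] occur neither in the polynomial nor in [m], as [leading_coef]
    requires at the next vertex. *)
Lemma buildable_coef (A : {set T}) : buildable (fun=> 2%N) h set0 A ->
  exists m : 'X_{1..#|T|}, [/\ forall i, (m i <= 2)%N,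
     forall i, enum_val i \notin A -> deg_le i 0 (graph_poly (within A)),
     forall i, enum_val i \notin A -> m i = 0%N &
     (graph_poly (within A))@_m != 0].
Proof.
elim=> [|{}A v _ [m [m2 dA mA cA]] vA dv].
  have -> : graph_poly (within set0) = 1.
    by apply: big1 => u _; apply: big1 => w; rewrite /within /= !inE /= andbF.
  exists 0%MM; split=> [i|i _ m|i _|]; rewrite ?mnm0E ?mcoeff1 ?eqxx //.
  by have [->|] := eqVneq m 0%MM; rewrite ?mnm0E ?eqxx.
set s := [seq enum_rank u | u <- enum [set u in A | h u v]].
have vi : enum_val (enum_rank v) = v by rewrite enum_rankK.
have szs : size s = #|[set u in A | h u v]| by rewrite size_map -cardE.
have vs : enum_rank v \notin s.
  apply/mapP => -[u]; rewrite mem_enum inE => /andP[uA _] /enum_rank_inj vu.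
  by rewrite vu uA in vA.
have [] := @leading_coef _ (enum_rank v) s (fun j => j < enum_rank v)%N
   (graph_poly (within A)) m vs.
- by apply: dA; rewrite vi.
- by apply: mA; rewrite vi.
- by [].
move=> dQ cQ; exists (m + U_(enum_rank v) *+ size s)%MM.
have notin_v i : enum_val i \notin v |: A -> (i != enum_rank v) && (enum_val i \notin A).
  rewrite !inE negb_or => /andP[iv ->]; rewrite andbT.
  by apply: contraNneq iv => ->; rewrite vi.
split.
- move=> i; rewrite mnmDE mulmnE mnm1E.
  case: eqVneq => [<-|_]; last by rewrite mul0n addn0.
  by rewrite mA ?vi // mul1n szs.
- move=> i /[dup] /notin_v/andP[iv iA] ivA; rewrite graph_poly_add // -/s.
  have is_ : i \notin s.
    apply/mapP => -[u]; rewrite mem_enum inE => /andP[uA _] iu.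
    by rewrite iu enum_rankK uA in iA.
  elim: (s) is_ => [|j t IH]; first by rewrite big_nil mulr1 => _; exact: dA.
  rewrite inE negb_or => /andP[ij /IH dt]; rewrite big_cons mulrCA mulrC.
  have dX k := deg_le_mulX k dt.
  have := dX (enum_rank v); have := dX j.
  rewrite ![_ == i]eq_sym (negPf ij) (negPf iv) => d1 d2.
  by case: ifP => _; rewrite mulrBr; apply: deg_leB.
- move=> i /notin_v/andP[iv iA]; rewrite mnmDE mulmnE mnm1E eq_sym (negPf iv).
  by rewrite mul0n addn0 mA.
- by rewrite graph_poly_add.
Qed.

Lemma AT_le3 : buildable (fun=> 2%N) h set0 setT -> (AT h <= 3)%N.
Proof.
move=> /buildable_coef[m [m2 _ _ cm]]; rewrite /AT /AlonTarsi.AT.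
case: ex_minnP => k _; apply; apply/existsP.
exists [ffun v => inord (m (enum_rank v))].
rewrite (_ : AlonTarsi.vertex_monomial _ = m).
  rewrite (@eq_graph_poly _ (within setT)) //.
  by move=> u w; rewrite /within /= !inE !andbT.
apply/mnmP => i; rewrite mnmE ffunE enum_valK inordK // ltnS.
exact: m2.
Qed.

End Main.
End ATDegenerate.

(** * Reducible configurations *)

Section Reducible.
Variables (T : finType) (e : rel T).
Hypotheses (esym : symmetric e) (eirr : irreflexive e).
Implicit Types (m : T -> T) (S X Y : {set T}).

(* A matching is encoded as an involution [m]; its fixed points are unmatched. *)
Definition unmatched m : rel T := [rel u v | e u v && (u != m v)].

Definition matching_on m X :=
  [/\ involutive m, forall v, m v = v \/ e v (m v) & forall v, v \notin X -> m v = v].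

Definition decomposable S := exists m,
  matching_on m S /\ buildable (fun=> 2) (unmatched m) set0 S.

Definition reducible S := exists X m, [/\ X != set0, X \subset S, matching_on m X &
  buildable (fun=> 2) (unmatched m) (S :\: X) S].

Lemma matching_on_stable m X v : matching_on m X -> v \in X -> m v \in X.
Proof.
case=> mK _ mX; apply: contraLR => nX; have := mX _ nX.
by rewrite mK => ->.
Qed.

Lemma matching_onW m X Y : X \subset Y -> matching_on m X -> matching_on m Y.
Proof.
move=> XY [mK me mX]; split=> // v vY; apply: mX.
by apply: contra vY => /(subsetP XY).
Qed.

Lemma matching_on_union m1 m2 X Y : [disjoint X & Y] ->
  matching_on m1 X -> matching_on m2 Y ->
  matching_on (fun v => if v \in X then m1 v else m2 v) (X :|: Y).
Proof.
move=> dXY M1 M2; have [m1K e1 f1] := M1; have [m2K e2 f2] := M2.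
split=> [v|v|v]; last first.
- by rewrite inE negb_or => /andP[/negPf-> /f2].
- by case: ifP.
have [vX|/negPf vX] := boolP (v \in X); first by rewrite (matching_on_stable M1) ?m1K.
have [vY|/f2 E] := boolP (v \in Y); last by rewrite E vX.
by rewrite (disjointFl dXY (matching_on_stable M2 vY)).
Qed.

(** The order of [S :\: X] is followed by that of [X], with the union of both matchings. Since
    [unmatched m u v] evaluates [m] only at the added vertex [v], neither half is disturbed by the
    matching of the other. *)
Lemma decomposable_reduce S X m : X \subset S -> matching_on m X ->
  buildable (fun=> 2) (unmatched m) (S :\: X) S ->
  decomposable (S :\: X) -> decomposable S.
Proof.
move=> XS mX bX [m0 [mS b0]].
pose m' v := if v \in X then m v else m0 v.
exists m'; split.
  have := @matching_on_union m m0 X (S :\: X).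
  rewrite setDE setUIr setUCr setIT (setUidPr XS) -setDE; apply=> //.
  by rewrite disjoints_subset; apply/subsetP => u; rewrite !inE => ->.
have := @buildable_change _ _ _ (fun=> 2) (unmatched m') _ _ set0 b0 (sub0set _).
have := @buildable_change _ _ _ (fun=> 2) (unmatched m') _ _ set0 bX (sub0set _).
rewrite !setD0 => b1 b2; apply: buildable_trans (b2 _) (b1 _) => v C.
  move=> vS _ _; rewrite setD0 /unmatched /= /m'.
  by move: vS; rewrite inE => /andP[/negPf->].
move=> vS; rewrite inE vS andbT negbK => vX _.
by rewrite setD0 /unmatched /= /m' vX.
Qed.

Definition pair_up (a b : T) m v := if v == a then b else if v == b then a else m v.

Lemma matching_on_pair_up a b m X : e a b -> a \notin X -> b \notin X ->
  matching_on m X -> matching_on (pair_up a b m) (b |: (a |: X)).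
Proof.
move=> ab aX bX [mK me mX].
have anb : (a == b) = false by apply: contraTF ab => /eqP ->; rewrite eirr.
have ma := mX _ aX; have mb := mX _ bX.
split=> v; rewrite /pair_up.
- case: (eqVneq v a) => [->|va]; first by rewrite [b == a]eq_sym anb eqxx.
  case: (eqVneq v b) => [->|vb]; first by rewrite eqxx.
  by rewrite !(inv_eq mK) ma mb (negPf va) (negPf vb).
- case: (eqVneq v a) => [->|va]; first by right.
  by case: (eqVneq v b) => [->|vb]; first by rewrite esym; right.
- by rewrite !inE !negb_or => /and3P[/negPf-> /negPf->]; exact: mX.
Qed.

Section Ambient.
Variable S : {set T}.
Let deg v := #|[set u in S | e u v]|.

Definition almost_reducible X r := exists m,
  matching_on m (X :\ r) /\
  buildable (fun v => 2 + (v == r)) (unmatched m) (S :\: X) S.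

Definition flexible X := X \subset S /\ forall r, r \in X -> almost_reducible X r.

(** [F] collects neighbours of [v] that do not count: those not yet added, and the partner of
    [v]. *)
Lemma card_unmatched m (C F : {set T}) v : C \subset S ->
  F \subset [set u in S | e u v] -> (forall u, u \in F -> u \in C -> u = m v) ->
  #|[set u in C | unmatched m u v]| <= deg v - #|F|.
Proof.
move=> CS FN FC; rewrite leq_subRL ?subset_leq_card //.
have dF : [disjoint F & [set u in C | unmatched m u v]].
  rewrite disjoints_subset; apply/subsetP => u uF; rewrite !inE.
  by apply/negP => /and3P[uC _]; rewrite (FC u uF uC) eqxx.
move: (leq_card_setU F [set u in C | unmatched m u v]) => [_].
rewrite dF => /eqP <-; apply/subset_leq_card; rewrite subUset FN.
by apply/subsetP => u; rewrite !inE => /and3P[/(subsetP CS)-> ->].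
Qed.

Lemma flexible1 x : x \in S -> deg x <= 3 -> flexible [set x].
Proof.
move=> xS dx; split=> [|r]; first by rewrite sub1set.
rewrite inE => /eqP ->; exists id; split.
  by split=> // v; left.
rewrite -[X in buildable _ _ _ X](setD1K xS); apply: buildable_add.
- exact: buildable_refl.
- by rewrite !inE eqxx.
- rewrite eqxx; apply: leq_trans dx; apply: subset_leq_card; apply/subsetP => u.
  by rewrite !inE /= => /and3P[/andP[_ ->]]; rewrite esym.
Qed.

(** The order is [a], then [b], then [X]. *)
Lemma buildable_add2 k h X a b : X \subset S -> a \in S -> b \in S ->
  a \notin X -> b \notin X -> a != b ->
  #|[set u in S :\: (b |: (a |: X)) | h u a]| <= k a ->
  #|[set u in S :\: (b |: X) | h u b]| <= k b ->
  buildable k h (S :\: X) S -> buildable k h (S :\: (b |: (a |: X))) S.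
Proof.
move=> XS aS bS aX bX ab ca cb; apply: buildable_trans.
have E1 : S :\: X = b |: (S :\: (b |: X)).
  by apply/setP => u; rewrite !inE; case: eqVneq => // ->; rewrite bX bS.
have E2 : S :\: (b |: X) = a |: (S :\: (b |: (a |: X))).
  apply/setP => u; rewrite !inE; case: (eqVneq u a) => //= ->.
  by rewrite negb_or ab aX aS.
rewrite E1; apply: buildable_add; rewrite ?inE ?eqxx //.
rewrite E2; apply: buildable_add; rewrite ?inE ?eqxx ?orbT //.
exact: buildable_refl.
Qed.

(** Being outside [X], [b] precedes all of [X]. Matching it to the root [p] removes one of the three
    earlier neighbours of [p], which then needs no exception. *)
Lemma flexible_pair_build m k X p b : X \subset S -> p \in X -> b \in S ->
  e p b -> b \notin X ->
  buildable (fun v => 2 + (v == p)) (unmatched m) (S :\: X) S ->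
  m p = p -> (forall v, 2 <= k v) ->
  buildable k (unmatched (pair_up p b m)) (S :\: X) S.
Proof.
move=> XS pX bS pb bX bl mp k2.
have := @buildable_change _ _ _ k (unmatched (pair_up p b m)) _ _ set0 bl (sub0set _).
rewrite !setD0; apply=> v C vS vC sC; rewrite setD0 => cv.
have vX : v \in X by move: vC; rewrite inE vS andbT negbK.
apply: leq_trans (k2 v).
have [vp|vp] := eqVneq v p; last first.
  move: cv; rewrite (negPf vp) addn0; apply: leq_trans; apply: subset_leq_card.
  apply/subsetP => u; rewrite !inE /unmatched /= /pair_up (negPf vp).
  by case: (eqVneq v b) => // vb; rewrite -vb vX in bX.
rewrite vp eqxx in cv *; rewrite -ltnS -[X in _ < X]addn1.
apply: leq_trans cv; apply: proper_card; apply/properP; split.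
  apply/subsetP => u; rewrite !inE /unmatched /= /pair_up eqxx mp => /and3P[-> eup _].
  by rewrite eup; apply: contraTneq eup => ->; rewrite eirr.
exists b; rewrite !inE /unmatched /= ?/pair_up ?eqxx ?andbF //.
rewrite esym pb mp (subsetP sC) ?inE ?bX //=.
by apply: contraNneq bX => ->.
Qed.

Lemma card_unmatched_le m (C : {set T}) v c n : (deg v <= n) -> C \subset S ->
  forall F : {set T}, F \subset [set u in S | e u v] ->
  (forall u, u \in F -> u \in C -> u = m v) -> n <= c + #|F| ->
  #|[set u in C | unmatched m u v]| <= c.
Proof.
move=> dn CS F FN FC nc; apply: leq_trans (card_unmatched CS FN FC) _.
by rewrite leq_subLR addnC (leq_trans dn).
Qed.

Lemma sub_pair (P : pred T) a b : P a -> P b -> [set a; b] \subset [set u | P u].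
Proof. by move=> Pa Pb; apply/subsetP => u; rewrite !inE => /orP[]/eqP->. Qed.

Section AddTriangle.
Variables (X : {set T}) (p w q : T).
Hypotheses (fX : flexible X) (pX : p \in X) (wS : w \in S) (qS : q \in S).
Hypotheses (wX : w \notin X) (qX : q \notin X) (pw : e p w) (pq : e p q) (wq : e w q).
Hypotheses (dw : deg w <= 4) (dq : deg q <= 4).

Let XS : X \subset S. Proof. by case: fX. Qed.
Let pS : p \in S. Proof. exact: (subsetP XS). Qed.
Let wnq : w != q. Proof. by apply: contraTneq wq => ->; rewrite eirr. Qed.
Let pnw : p != w. Proof. by apply: contraNneq wX => <-. Qed.
Let pnq : p != q. Proof. by apply: contraNneq qX => <-. Qed.

(** To free [w], match [p] with [q] and add [q], then [w], then [X]. The later neighbours [p] and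
    [w] leave at most two for [q]. For [w], the later neighbours [F] decide: [p] alone requires the
    bound 3, a second neighbour in [X] allows the bound 2. *)
Lemma add_end_build k : (forall v, 2 <= k v) ->
  (exists F : {set T}, [/\ F \subset [set u in S | e u w], F \subset X & 4 <= k w + #|F|]) ->
  exists m, matching_on m ((q |: (w |: X)) :\ w) /\
    buildable k (unmatched m) (S :\: (q |: (w |: X))) S.
Proof.
move=> k2 [F [FN FX kF]]; have [m [mX bm]] := fX.2 p pX.
have [mK em fm] := mX; have mp : m p = p by apply: fm; rewrite !inE eqxx.
have mw : m w = w by apply: fm; rewrite !inE negb_and wX orbT.
exists (pair_up p q m); split.
  apply: matching_onW (matching_on_pair_up pq _ _ mX); rewrite ?inE ?eqxx //.
    apply/subsetP => u; rewrite !inE => /or3P[/eqP->|/eqP->|/andP[up uX]].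
    - by rewrite eq_sym wnq eqxx.
    - by rewrite pnw pX !orbT.
    - by rewrite uX !orbT andbT; apply: contraNneq wX => <-.
  by rewrite (negPf qX) andbF.
rewrite setUCA; apply: buildable_add2 => //; first by rewrite eq_sym.
- apply: (@card_unmatched_le _ _ _ _ 4 _ _ [set p; w]) => //.
  + exact: subsetDl.
  + by apply: sub_pair; rewrite ?pS ?wS.
  + by move=> u; rewrite !inE => /orP[]/eqP->; rewrite ?pX ?eqxx ?orbT.
  + by rewrite cards2 pnw (leq_add (k2 q)).
- apply: (@card_unmatched_le _ _ _ _ 4 _ _ F) => //; first exact: subsetDl.
  by move=> u /(subsetP FX) uX; rewrite !inE uX orbT.
- exact: flexible_pair_build.
Qed.

(** The second edge into [X] gives [w] a second later neighbour, so not even [w] needs an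
    exception. *)
Lemma lasso_reducible w' : w' \in X -> w' != p -> e w w' -> reducible S.
Proof.
move=> w'X w'p ww'; have [] := @add_end_build (fun=> 2).
- by [].
- exists [set p; w']; split; last by rewrite cards2 eq_sym w'p.
    by apply: sub_pair; rewrite ?pS ?(subsetP XS) // esym.
  by apply/subsetP => u; rewrite !inE => /orP[]/eqP->.
move=> m [mX bm]; exists (q |: (w |: X)), m; split=> //.
- by apply/set0Pn; exists q; rewrite !inE eqxx.
- by rewrite !subUset !sub1set qS wS.
- by apply: matching_onW mX; apply: subD1set.
Qed.

Lemma almost_reducible_end : almost_reducible (q |: (w |: X)) w.
Proof.
apply: add_end_build => [v|]; first exact: leq_addr.
exists [set p]; rewrite cards1 eqxx; split=> //; last by rewrite sub1set.
by rewrite sub1set inE pS.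
Qed.

(** Match [w] with [q] and add both before [X]. For each of them [p] comes later and the partner
    does not count, so at most two of the four neighbours remain. *)
Lemma almost_reducible_inner r : r \in X -> almost_reducible (q |: (w |: X)) r.
Proof.
move=> rX; have [m [mX bm]] := fX.2 r rX.
have [mK em fm] := mX.
have rw : r != w by apply: contraNneq wX => <-.
have rq : r != q by apply: contraNneq qX => <-.
have b' : buildable (fun v => 2 + (v == r)) (unmatched (pair_up w q m)) (S :\: X) S.
  have := @buildable_change _ _ _ (fun v => 2 + (v == r))
    (unmatched (pair_up w q m)) _ _ set0 bm (sub0set _).
  rewrite !setD0; apply=> v C vS vC sC; rewrite setD0.
  have vX : v \in X by move: vC; rewrite inE vS andbT negbK.
  rewrite /unmatched /pair_up /=.
  case: (eqVneq v w) => [vw|_]; first by move: wX; rewrite -vw vX.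
  by case: (eqVneq v q) => // vq; move: qX; rewrite -vq vX.
exists (pair_up w q m); split.
  apply: matching_onW (matching_on_pair_up wq _ _ mX).
    apply/subsetP => u; rewrite !inE => /or3P[/eqP->|/eqP->|/andP[-> ->]].
    - by rewrite eq_sym rq eqxx.
    - by rewrite eq_sym rw eqxx orbT.
    - by rewrite !orbT.
  - by rewrite !inE (negPf wX) andbF.
  - by rewrite !inE (negPf qX) andbF.
apply: buildable_add2 => //.
- apply: (@card_unmatched_le _ _ _ _ 4 _ _ [set p; q]) => //.
  + exact: subsetDl.
  + by apply: sub_pair; rewrite ?pS ?qS //= esym.
  + by move=> u; rewrite !inE => /orP[]/eqP->; rewrite ?pX ?eqxx ?orbT.
  + by rewrite cards2 pnq addnAC; exact: (leq_addr _ 4).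
- apply: (@card_unmatched_le _ _ _ _ 4 _ _ [set p; w]) => //.
  + exact: subsetDl.
  + by apply: sub_pair; rewrite ?pS ?wS.
  + move=> u; rewrite !inE => /orP[]/eqP->; rewrite ?pX ?eqxx ?orbT //.
    by rewrite /pair_up [q == w]eq_sym (negPf wnq) eqxx.
  + by rewrite cards2 pnw addnAC; exact: (leq_addr _ 4).
Qed.

End AddTriangle.

Lemma flexible_add X p w q : flexible X -> p \in X -> w \in S -> q \in S ->
  w \notin X -> q \notin X -> e p w -> e p q -> e w q -> deg w <= 4 -> deg q <= 4 ->
  flexible (q |: (w |: X)).
Proof.
move=> fX pX wS qS wX qX pw pq wq dw dq; split.
  by rewrite !subUset !sub1set qS wS; case: fX.
move=> r; rewrite !inE => /or3P[/eqP->|/eqP->|rX].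
- by rewrite setUCA; apply: (@almost_reducible_end X p q w); rewrite // esym.
- exact: (@almost_reducible_end X p w q).
- exact: (@almost_reducible_inner X p w q).
Qed.

(** Match [r] with [s] and add [Y] before [X]. Then [s] is relieved of [r], which comes later, and
    [r] of [s], its partner; no exception remains. *)
Lemma conflict_reducible X Y r s : flexible X -> flexible Y -> [disjoint X & Y] ->
  r \in X -> s \in Y -> e r s -> reducible S.
Proof.
move=> fX fY dXY rX sY rs.
have [m1 [M1 b1]] := fX.2 r rX; have [m2 [M2 b2]] := fY.2 s sY.
have XS := fX.1; have YS := fY.1.
have rY : r \notin Y by rewrite (disjointFr dXY).
have sX : s \notin X by rewrite (disjointFl dXY).
have rns : r != s by apply: contraNneq rY => ->.
pose m0 v := if v \in X :\ r then m1 v else m2 v.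
have M0 : matching_on m0 ((X :\ r) :|: (Y :\ s)).
  apply: matching_on_union M1 M2.
  by apply: disjointWl (subD1set _ _) (disjointWr (subD1set _ _) dXY).
have M : matching_on (pair_up r s m0) (X :|: Y).
  apply: matching_onW (matching_on_pair_up rs _ _ M0).
  - apply/subsetP => u; rewrite !inE.
    by case/or4P => [/eqP->|/eqP->|/andP[_ ->]|/andP[_ ->]]; rewrite ?rX ?sY ?orbT.
  - by rewrite !inE eqxx (negPf rY) !andbF.
  - by rewrite !inE eqxx (negPf sX) !andbF.
have m1r : m1 r = r by case: M1 => _ _; apply; rewrite !inE eqxx.
have m2s : m2 s = s by case: M2 => _ _; apply; rewrite !inE eqxx.
have strict (A B : {set T}) u n : A \subset B -> u \in B -> u \notin A ->
    #|B| <= n.+1 -> #|A| <= n.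
  move=> AB uB uA Bn; rewrite -ltnS; apply: leq_trans Bn; apply: proper_card.
  by apply/properP; split=> //; exists u.
exists (X :|: Y), (pair_up r s m0); split=> //.
- by apply/set0Pn; exists r; rewrite inE rX.
- by rewrite subUset XS YS.
have := @buildable_change _ _ _ (fun=> 2) (unmatched (pair_up r s m0)) _ _ set0 b1 (sub0set _).
have XSY : X \subset S :\: Y by rewrite subsetD XS.
have := @buildable_change _ _ _ (fun=> 2) (unmatched (pair_up r s m0)) _ _ X b2 XSY.
rewrite setDDl [Y :|: X]setUC !setD0 => B2 B1; apply: buildable_trans (B2 _) (B1 _).
- move=> v C vS vC sC; have vY : v \in Y by move: vC; rewrite inE vS andbT negbK.
  have vX : v \notin X by rewrite (disjointFl dXY).
  have [->|vs] := eqVneq v s.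
    rewrite addn1; apply: (strict _ _ r); rewrite ?inE ?rX //=.
      apply/subsetP => u; rewrite !inE /unmatched /= => /and3P[/andP[_ ->] eus _].
      by rewrite eus m2s; apply: contraTneq eus => ->; rewrite eirr.
    by rewrite /unmatched /= rs m2s rns !andbT; apply: (subsetP sC); rewrite inE rY (subsetP XS).
  rewrite addn0; apply: leq_trans; apply: subset_leq_card; apply/subsetP => u.
  rewrite !inE /unmatched /= /pair_up (negPf vs) /m0 !inE (negPf vX) andbF.
  case: (eqVneq v r) => [vr|_]; first by rewrite -vr vY in rY.
  by case/and3P => /andP[_ ->] -> ->.
- move=> v C vS vC sC; have vX : v \in X by move: vC; rewrite inE vS andbT negbK.
  rewrite setD0; have [->|vr] := eqVneq v r.
    rewrite addn1; apply: (strict _ _ s); rewrite ?inE /=.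
    + apply/subsetP => u; rewrite !inE /unmatched /= => /and3P[-> eur _].
      by rewrite eur m1r; apply: contraTneq eur => ->; rewrite eirr.
    + rewrite /unmatched /= esym rs m1r eq_sym rns !andbT; apply: (subsetP sC).
      by rewrite inE sX (subsetP YS).
    + by rewrite /unmatched /= /pair_up eqxx eqxx !andbF.
  rewrite addn0; apply: leq_trans; apply: subset_leq_card; apply/subsetP => u.
  rewrite !inE /unmatched /= /pair_up (negPf vr) /m0 !inE vr vX /=.
  by case: (eqVneq v s) => [vs|_ //]; rewrite -vs vX in sX.
Qed.

End Ambient.
End Reducible.

Lemma cards3_split (T : finType) (t : {set T}) p : #|t| = 3 -> p \in t ->
  exists w q, [/\ t = q |: (w |: [set p]), w != q, p != w & p != q].
Proof.
move=> t3 pt; have /eqP/cards2P[w [q [wq E]]] : #|t :\ p| = 2.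
  by move: t3; rewrite (cardsD1 p) pt => -[].
have wt : w \in t :\ p by rewrite E !inE eqxx.
have qt : q \in t :\ p by rewrite E !inE eqxx orbT.
move: wt qt; rewrite !inE => /andP[wp _] /andP[qp _].
exists w, q; split=> //; last 2 first; [by rewrite eq_sym..|].
rewrite -(setD1K pt) E; apply/setP => u; rewrite !inE.
by case: (u == p); case: (u == w); case: (u == q).
Qed.

(** * Maximal families of flexible sets *)

Section Yellow.
Variables (T : finType) (e : rel T) (S : {set T}) (F3 : {set {set T}}).
Hypotheses (esym : symmetric e) (eirr : irreflexive e).
Let deg v := #|[set u in S | e u v]|.
Hypotheses (F3card : forall t, t \in F3 -> #|t| = 3)
  (F3sub : forall t, t \in F3 -> t \subset S)
  (F3adj : forall t u v, t \in F3 -> u \in t -> v \in t -> u != v -> e u v)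
  (F3share : forall t t' u v, t \in F3 -> t' \in F3 -> u != v ->
     u \in t -> v \in t -> u \in t' -> v \in t' -> t = t').
Hypothesis irred : ~ reducible e S.

Implicit Types (rho : T -> option T) (TT : {set {set T}}).

Let class rho c := [set v | rho v == Some c].

(* [rho v] names the flexible set of the yellow vertex [v]; [TT] consists of the
   glued triangles, each of which contributes two vertices of degree 4. *)
Definition yellow_at rho TT :=
  [/\ forall c, flexible e S (class rho c),
      forall v, v \in S -> deg v = 3 -> rho v != None,
      forall v, rho v != None -> deg v <= 4,
      forall u v, rho u != None -> rho v != None -> e u v ->
        exists2 t, t \in TT & (u \in t) && (v \in t) &
      [/\ TT \subset F3, forall t v, t \in TT -> v \in t -> rho v != None &
        #|[set v | rho v != None]| = #|[set v in S | deg v == 3]| + 2 * #|TT|]].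

(** What maximality provides: a triangle violating this could still be glued. *)
Definition yellow_max rho TT := forall t p, t \in F3 -> t \notin TT ->
  p \in t -> rho p != None -> (forall v, v \in t -> rho v != None -> v = p) /\
  (exists2 u, u \in t & 4 < deg u).

Lemma class_disjoint rho c d : c != d -> [disjoint class rho c & class rho d].
Proof.
move=> cd; rewrite disjoints_subset; apply/subsetP => u; rewrite !inE => /eqP ->.
by apply: contraNneq cd => -[->].
Qed.

(** Two adjacent vertices of degree 3 would be flexible singletons in conflict, against
    irreducibility. So these singletons can be the initial classes. *)
Lemma yellow_init : exists rho, yellow_at rho set0.
Proof.
pose rho v := if (v \in S) && (deg v == 3) then Some v else None.
have rhoE v : (rho v != None) = (v \in S) && (deg v == 3) by rewrite /rho; case: ifP.
have cE c : (c \in S) && (deg c == 3) -> class rho c = [set c].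
  move=> Sc; apply/setP => u; rewrite !inE /rho; case: ifP => [_|uS].
    by rewrite -(inj_eq (@Some_inj _)).
  by symmetry; apply: contraFF uS => /eqP ->.
have flex c : flexible e S (class rho c).
  have [Sc|nSc] := boolP ((c \in S) && (deg c == 3)).
    by rewrite cE //; case/andP: Sc => cS /eqP dc; apply: flexible1; rewrite // -/(deg c) dc.
  have -> : class rho c = set0; last by split=> [|r]; rewrite ?sub0set ?inE.
  apply/setP => u; rewrite !inE /rho; case: ifP => // uS.
  by apply: contraNF nSc => /eqP[<-].
exists rho; split=> //.
- by move=> v vS dv; rewrite rhoE vS dv.
- by move=> v; rewrite rhoE => /andP[_ /eqP ->].
- move=> u v; rewrite !rhoE => Su Sv uv; case: irred.
  apply: (conflict_reducible esym eirr (flex u) (flex v) _ _ _ uv); rewrite ?cE ?inE //.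
  rewrite disjoints1 inE; by apply: contraTneq uv => ->; rewrite eirr.
- split; rewrite ?sub0set //; first by move=> t v; rewrite inE.
  by rewrite cards0 muln0 addn0; apply: eq_card => v; rewrite !inE rhoE.
Qed.

(** The triangle joins the class of [p]. An edge from a new vertex to a yellow vertex outside [t]
    would be a lasso if it ends in that class, and a conflict of two flexible sets otherwise. *)
Lemma yellow_step rho TT t p w q : yellow_at rho TT -> t \in F3 ->
  t = q |: (w |: [set p]) -> w != q -> p != w -> p != q -> rho p != None ->
  rho w = None -> rho q = None -> deg w <= 4 -> deg q <= 4 ->
  exists rho', yellow_at rho' (t |: TT).
Proof.
move=> [fl r3 r4 radj [TTF TTr rcard]] tF tE wq pw pq rp rw rq dw dq.
have [pt wt qt] : [/\ p \in t, w \in t & q \in t] by rewrite tE !inE !eqxx !orbT.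
have [epw epq ewq] : [/\ e p w, e p q & e w q].
  by split; apply: (F3adj tF) => //.
have wS : w \in S by apply: (subsetP (F3sub tF)).
have qS : q \in S by apply: (subsetP (F3sub tF)).
have tTT : t \notin TT by apply/negP => /TTr/(_ wt); rewrite rw.
case E: (rho p) rp => [c|] // _.
have pc : p \in class rho c by rewrite inE E.
have wc : w \notin class rho c by rewrite inE rw.
have qc : q \notin class rho c by rewrite inE rq.
pose rho' v := if (v == w) || (v == q) then Some c else rho v.
have rho'E v : (rho' v != None) = [|| v == w, v == q | rho v != None].
  by rewrite /rho'; case: (v == w); case: (v == q).
have cE d : class rho' d = if d == c then q |: (w |: class rho c) else class rho d.
  apply/setP => u; rewrite (fun_if (fun A : {set T} => u \in A)) !inE /rho'.
  rewrite orbCA orbA; case: ifP => uwq; case: (eqVneq d c) => [->|dc] //=.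
    by rewrite eqxx.
  have -> : rho u = None by case/orP: uwq => /eqP ->.
  by apply: contraNF dc => /eqP[->].
have fl' d : flexible e S (class rho' d).
  by rewrite cE; case: eqP => _ //; apply: (flexible_add esym eirr (fl c) pc).
have new_edge u v : (u == w) || (u == q) -> rho' v != None -> e u v ->
    (u \in t) && (v \in t).
  move=> uwq rv uv; have ut : u \in t by case/orP: uwq => /eqP ->.
  rewrite ut /=; apply/negPn/negP => vt.
  have [vw vq vp] : [/\ v != w, v != q & v != p].
    by split; apply: contraNneq vt => ->.
  move: rv; rewrite rho'E (negPf vw) (negPf vq) /=.
  case Ev: (rho v) => [d|] // _; apply: irred.
  have vd : v \in class rho d by rewrite inE Ev.
  have [dc|dc] := eqVneq d c.
    rewrite dc in vd; case/orP: uwq => /eqP uE; rewrite uE in uv.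
      exact: (@lasso_reducible _ _ esym eirr _ _ p w q (fl c) pc wS qS wc qc _ _ _ _ _ v).
    by apply: (@lasso_reducible _ _ esym eirr _ _ p q w (fl c) pc qS wS qc wc _ _ _ _ _ v);
      rewrite // esym.
  have := class_disjoint rho' (c := c) (d := d); rewrite eq_sym => /(_ dc) dis.
  apply: (conflict_reducible esym eirr (fl' c) (fl' d) dis _ _ uv).
    by rewrite inE /rho' uwq.
  by rewrite inE /rho' (negPf vw) (negPf vq) Ev.
exists rho'; split=> //.
- by move=> v vS dv; rewrite rho'E r3 ?orbT.
- by move=> v; rewrite rho'E => /or3P[/eqP ->|/eqP ->|/r4].
- move=> u v ru rv uv.
  have [uwq|nu] := boolP ((u == w) || (u == q)).
    by exists t; [rewrite setU11|apply: new_edge].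
  have [vwq|nv] := boolP ((v == w) || (v == q)).
    by exists t; [rewrite setU11|rewrite andbC; apply: new_edge; rewrite // esym].
  move: ru rv; rewrite !rho'E !orbA (negPf nu) (negPf nv) /= => ru rv.
  by have [t' t'T uv'] := radj u v ru rv uv; exists t' => //; rewrite setU1r.
- split.
  + by rewrite subUset sub1set tF.
  + move=> t' v; rewrite rho'E inE => /orP[|tT /(TTr _ _ tT) ->]; last by rewrite !orbT.
    rewrite inE => /eqP ->; rewrite tE !inE => /or3P[]/eqP-> ; rewrite ?eqxx ?orbT //.
    by rewrite E !orbT.
  + rewrite cardsU1 tTT mulnDr addnCA -rcard.
    have -> : [set v | rho' v != None] = q |: (w |: [set v | rho v != None]).
      by apply/setP => v; rewrite !inE rho'E orbCA.
    by rewrite !cardsU1 !inE rw rq /= eq_sym (negPf wq).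
Qed.

(** Gluing is repeated as long as some triangle is [bad]; each step enlarges [TT] inside [F3]. *)
Lemma yellow_exists : exists rho TT, yellow_at rho TT /\ yellow_max rho TT.
Proof.
have [rho0 y0] := yellow_init.
move: rho0 (set0) y0 => rho TT.
have [n] := ubnP (#|F3| - #|TT|); elim: n rho TT => // n IH rho TT ltn y.
have [fl r3 r4 radj [TTF TTr rcard]] := y.
pose bad t := [&& t \in F3, t \notin TT, [forall u in t, deg u <= 4] &
                [exists p in t, rho p != None]].
(* Two yellow vertices of [t] are adjacent, hence share a triangle of [TT]; as triangles share no
   edge, it would be [t] itself. *)
have nonyellow t p v : t \in F3 -> t \notin TT -> p \in t -> rho p != None ->
    v \in t -> rho v != None -> v = p.
  move=> tF tT pt rp vt rv; apply/eqP/negPn/negP => vp.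
  have [t' t'T /andP[vt' pt']] := radj v p rv rp (F3adj tF vt pt vp).
  by rewrite (F3share tF (subsetP TTF _ t'T) vp) ?t'T in tT.
have [/existsP[t /and4P[tF tT /forall_inP d4 /exists_inP[p pt rp]]]|nbad] :=
    boolP [exists t, bad t]; last first.
  exists rho, TT; split=> // t p tF tT pt rp; split; first by move=> v; apply: nonyellow rp.
  have [/exists_inP //|/exists_inPn d4] := boolP [exists u in t, 4 < deg u].
  case/existsP: nbad; exists t.
  rewrite /bad tF tT /=; apply/andP; split; last by apply/exists_inP; exists p.
  by apply/forall_inP => u /d4; rewrite -leqNgt.
have [w [q [tE wq pw pq]]] := cards3_split (F3card tF) pt.
have [wt qt] : w \in t /\ q \in t by rewrite tE !inE !eqxx !orbT.
have none v : v \in t -> p != v -> rho v = None.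
  move=> vt pv; case E: (rho v) => [c|] //; move: pv.
  by rewrite (nonyellow t p v tF tT pt rp vt) ?E ?eqxx.
have [rho' y'] := yellow_step y tF tE wq pw pq rp (none w wt pw) (none q qt pq)
   (d4 w wt) (d4 q qt).
apply: (IH _ _ _ y'); move: ltn.
have : #|t |: TT| <= #|F3| by apply: subset_leq_card; rewrite subUset sub1set tF.
by rewrite cardsU1 tT; lia.
Qed.

End Yellow.

(** * Discharging *)

Lemma set2_inj (T : finType) (v u w : T) : [set v; u] = [set v; w] -> u = w.
Proof.
move=> E; have : u \in [set v; w] by rewrite -E !inE eqxx orbT.
rewrite !inE => /orP[/eqP uv|/eqP //].
by have : w \in [set v; u] by [rewrite E !inE eqxx orbT]; rewrite uv !inE orbb => /eqP.
Qed.

Definition cycle5_edges (T : finType) (a b c d x : T) : {set {set T}} :=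
  [set A in [:: [set a; b]; [set b; c]; [set c; d]; [set d; x]; [set x; a]]].

Lemma cycle5_edges_rot (T : finType) (a b c d x : T) :
  cycle5_edges a b c d x = cycle5_edges b c d x a.
Proof.
apply/setP => A; rewrite !inE.
by case: (_ == [set a; b]); rewrite ?orbT ?orbF.
Qed.

Lemma set2_eq (T : finType) (a b c d : T) :
  ([set a; b] == [set c; d]) = (a == c) && (b == d) || (a == d) && (b == c).
Proof.
apply/eqP/orP => [E|[]/andP[/eqP-> /eqP->] //]; last by rewrite setUC.
have ha : a \in [set c; d] by rewrite -E !inE eqxx.
have hb : b \in [set c; d] by rewrite -E !inE eqxx orbT.
have hc : c \in [set a; b] by rewrite E !inE eqxx.
have hd : d \in [set a; b] by rewrite E !inE eqxx orbT.
move: ha hb hc hd; rewrite !inE ![c == _]eq_sym ![d == _]eq_sym.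
by case: (a == c); case: (a == d); case: (b == c); case: (b == d) => //=; auto.
Qed.

Lemma cycle5_nbrs (T : finType) (a b c d x : T) : uniq [:: a; b; c; d; x] ->
  [set u | [set a; u] \in cycle5_edges a b c d x] = [set b; x].
Proof.
move=> U; apply/setP => u; rewrite !inE !set2_eq.
move: U; rewrite /= !inE !negb_or -!andbA => /and5P[ab ac ad ax].
rewrite eqxx (negPf ab) (negPf ac) (negPf ad) (negPf ax) /= !orbF.
by case/and5P=> _ bd bx; rewrite ?orbF.
Qed.

(** Here [a] and [b] are the payments of the two white vertices, [c] counts the 5-faces across the
    edge between them, and [d] those that the triangle pays. *)
Lemma yellow_triangle_arith a b c d : (a == 4) || (b == 4) -> 2 + (0 < c) <= a ->
  2 + (0 < c) <= b -> c <= 1 -> d <= c -> 6 + d <= b + a.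
Proof. by case: c => [|[|]] //=; lia. Qed.

(** Payments [a], [b], [c] and numbers [x], [y], [z] of 5-faces across the edges. One occupied edge
    makes two vertices pay 3, and two occupied edges make all three do so, which covers [d]. *)
Lemma white_triangle_arith a b c x y z d : x <= 1 -> y <= 1 -> z <= 1 ->
  2 + (0 < x) <= a -> 2 + (0 < x) <= b -> 2 + (0 < y) <= a -> 2 + (0 < y) <= c ->
  2 + (0 < z) <= b -> 2 + (0 < z) <= c -> d <= y + z + x -> 6 + d <= b + (a + c).
Proof. by case: x => [|[|]] //; case: y => [|[|]] //; case: z => [|[|]] //=; lia. Qed.

Lemma double_count (I J : finType) (A : pred I) (B : pred J) (r : I -> J -> bool) :
  \sum_(i | A i) #|[set j | B j && r i j]| = \sum_(j | B j) #|[set i | A i && r i j]|.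
Proof.
under eq_bigr do rewrite -sum1dep_card.
under [RHS]eq_bigr do rewrite -sum1dep_card.
rewrite (exchange_big_dep B) /=; last by move=> ? ? _ /andP[].
by apply: eq_bigr => j Bj; apply: eq_bigl => i; rewrite Bj.
Qed.

Section Discharge.
Variables (T : finType) (e : rel T) (S : {set T}).
Variables (F3 : {set {set T}}) (F5 : {set {set {set T}}}).
Hypotheses (esym : symmetric e) (eirr : irreflexive e).
Let deg v := #|[set u in S | e u v]|.
Hypotheses (F3card : forall t, t \in F3 -> #|t| = 3)
  (F3sub : forall t, t \in F3 -> t \subset S)
  (F3adj : forall t u v, t \in F3 -> u \in t -> v \in t -> u != v -> e u v)
  (F3share : forall t t' u v, t \in F3 -> t' \in F3 -> u != v ->
     u \in t -> v \in t -> u \in t' -> v \in t' -> t = t').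

Definition tri u v := [exists t in F3, (u \in t) && (v \in t)].

Hypotheses
  (F5cycle : forall f, f \in F5 -> exists a b c d x,
     [/\ uniq [:: a; b; c; d; x], f = cycle5_edges a b c d x,
         [:: a; b; c; d; x] \subset S & cycle e [:: a; b; c; d; x]])
  (edge_faces : forall u v, e u v ->
     #|[set f in F5 | [set u; v] \in f]| + tri u v <= 2)
  (F5tri : forall f u v u' v', f \in F5 -> [set u; v] \in f -> [set u'; v'] \in f ->
     tri u v -> tri u' v' -> [set u; v] = [set u'; v'])
  (deg3 : forall v, v \in S -> 3 <= deg v)
  (irred : ~ reducible e S).

Let N (f : {set {set T}}) v := [set u | [set v; u] \in f].

Lemma tri_sym u v : tri u v = tri v u.
Proof. by apply: eq_existsb => t; congr (_ && _); rewrite andbC. Qed.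

Lemma F5_at f v u : f \in F5 -> u \in N f v -> exists b c d x,
  [/\ uniq [:: v; b; c; d; x], f = cycle5_edges v b c d x,
      [:: v; b; c; d; x] \subset S & cycle e [:: v; b; c; d; x]].
Proof.
move=> fF; rewrite inE; have [a [b [c [d [x [U -> sub cyc]]]]]] := F5cycle fF.
move=> vf; have {vf} : v \in [:: a; b; c; d; x].
  move: vf; rewrite !inE !set2_eq.
  by case: (v == a); case: (v == b); case: (v == c); case: (v == d); case: (v == x).
have rotE n : let s := rot n [:: a; b; c; d; x] in
  [/\ uniq s, s \subset S & cycle e s].
  by rewrite /= rot_uniq rot_cycle; split=> //; apply/subsetP => w; rewrite mem_rot;
    move/subsetP: sub; apply.
rewrite !inE => /or4P[||/eqP->|/orP[]] => [/eqP->|/eqP->||/eqP->|/eqP->].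
- by exists b, c, d, x.
- by have [] := rotE 1; rewrite cycle5_edges_rot; exists c, d, x, a.
- by have [] := rotE 2; rewrite 2!cycle5_edges_rot; exists d, x, a, b.
- by have [] := rotE 3; rewrite 3!cycle5_edges_rot; exists x, a, b, c.
- by have [] := rotE 4; rewrite 4!cycle5_edges_rot; exists a, b, c, d.
Qed.

Lemma card_N f v u : f \in F5 -> u \in N f v -> #|N f v| = 2 /\ {in N f v, forall w, e v w}.
Proof.
move=> fF /(F5_at fF)[b [c [d [x [U -> _ cyc]]]]].
rewrite /N (cycle5_nbrs U); move: cyc U; rewrite /= !inE !negb_or -!andbA.
move=> /and5P[vb _ _ _ /andP[xv _]] /and5P[_ _ _ _ /and4P[_ _ bx _]].
by split; [rewrite cards2 bx|move=> w; rewrite !inE => /orP[]/eqP->; rewrite // esym].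
Qed.

Section Vertex.
Variable v : T.

Let tris := [set t in F3 | v \in t].
Let nontri := [set u in S | e u v && ~~ tri u v].
(* The 5-faces at [v] that receive charge from [v] directly, and those that only
   receive it through triangles. *)
Definition Bfaces := [set f in F5 | (N f v != set0) && [forall u in N f v, ~~ tri u v]].
Definition Afaces := [set f in F5 | [exists u in N f v, tri u v]].

(** No two triangles share an edge, so those at [v] cut its triangular neighbours into disjoint
    pairs. *)
Lemma deg_split : deg v = 2 * #|tris| + #|nontri|.
Proof.
rewrite /deg -(cardsID [set u | tri u v]); congr (_ + _); last first.
  by apply: eq_card => u; rewrite !inE; case: (tri u v); rewrite ?andbT ?andbF.
have -> : [set u in S | e u v] :&: [set u | tri u v] = cover [set t :\ v | t in tris].
  apply/setP => u; rewrite !inE; apply/idP/bigcupP.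
    case/andP => /andP[uS uv] /exists_inP[t tF /andP[ut vt]].
    exists (t :\ v); first by apply/imsetP; exists t; rewrite ?inE ?tF.
    by rewrite !inE ut andbT; apply: contraTneq uv => ->; rewrite eirr.
  case=> _ /imsetP[t + ->]; rewrite !inE => /andP[tF vt] /andP[uv ut].
  rewrite (subsetP (F3sub tF)) // (F3adj tF ut vt uv) /=.
  by apply/exists_inP; exists t; rewrite ?ut.
have inj : {in tris &, injective (fun t => t :\ v)}.
  by move=> t t'; rewrite !inE => /andP[_ vt] /andP[_ vt'] E; rewrite -(setD1K vt) E setD1K.
rewrite -(card_in_imset inj) mulnC -[RHS]/(_ * 2);
  apply: card_uniform_partition (_ : partition _ _).
  move=> _ /imsetP[t + ->]; rewrite inE => /andP[tF vt].
  by have := F3card tF; rewrite (cardsD1 v) vt => -[].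
apply/and3P; split=> //.
  apply/trivIsetP => _ _ /imsetP[t + ->] /imsetP[t' + ->].
  rewrite !inE => /andP[tF vt] /andP[tF' vt'] neq.
  rewrite disjoints_subset; apply/subsetP => u; rewrite !inE => /andP[uv ut].
  rewrite uv /=; apply: contra neq => ut'.
  by rewrite (F3share tF tF' uv ut vt ut' vt').
apply/imsetP => -[t + E]; rewrite inE => /andP[tF vt].
by have := F3card tF; rewrite (cardsD1 v) vt -E cards0.
Qed.

(** Incidences between 5-faces and non-triangular edges at [v] are counted in two ways. Such an edge
    is on at most two 5-faces. A face of [Bfaces] uses two of these edges, one of [Afaces] at least
    one, because only one edge of a 5-face lies in a triangle. *)
Lemma faces_nontri : 2 * #|Bfaces| + #|Afaces| <= 2 * #|nontri|.
Proof.
pose I (u : T) f := (u \in N f v).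
have cnt : \sum_(f in F5) #|[set u in nontri | I u f]| <= 2 * #|nontri|.
  rewrite (double_count (mem F5) (mem nontri) (fun f u => I u f)) /=.
  rewrite mulnC -sum_nat_const; apply: leq_sum => u; rewrite inE => /and3P[_ uv _].
  have vu : e v u by rewrite esym.
  apply: leq_trans (leq_trans (leq_addr _ _) (edge_faces vu)).
  by apply: subset_leq_card; apply/subsetP => f; rewrite !inE /I inE.
apply: leq_trans cnt; rewrite (bigID (fun f => f \in Afaces)) /= [X in _ <= X]addnC.
have NS f u : f \in F5 -> u \in N f v -> u \in S.
  move=> fF uN; have [b [c [d [x [U fE sub _]]]]] := F5_at fF uN.
  move: uN; rewrite fE /N (cycle5_nbrs U) !inE => /orP[]/eqP->; apply: (subsetP sub);
  by rewrite !inE eqxx ?orbT.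
apply: leq_add.
- rewrite mulnC -sum_nat_const.
  rewrite [X in X <= _](_ : _ =
    \sum_(f | ((f \in F5) && (f \notin Afaces)) && (N f v != set0)) 2); last first.
    apply: eq_bigl => f; rewrite !inE; case fF: (f \in F5) => //=.
    rewrite andbC; congr (_ && _); apply/forall_inP/exists_inPn => H u uN; exact: H.
  rewrite big_mkcondr /=; apply: leq_sum => f /andP[fF fA].
  case: ifP => // /set0Pn[u uN].
  have [<- eN] := card_N fF uN; apply: subset_leq_card; apply/subsetP => w wN.
  rewrite !inE (NS f w fF wN) esym eN //= /I wN andbT.
  by apply: contra fA => tw; rewrite !inE fF; apply/exists_inP; exists w.
- rewrite -sum1_card.
  rewrite [X in X <= _](_ : _ = \sum_(f in F5 | f \in Afaces) 1); last first.
    by apply: eq_bigl => f; rewrite !inE andbA andbb.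
  apply: leq_sum => f /andP[fF]; rewrite inE fF => /exists_inP[u uN tu].
  have [N2 eN] := card_N fF uN.
  have /set0Pn[w] : N f v :\ u != set0 by rewrite -card_gt0; move: N2; rewrite (cardsD1 u) uN; lia.
  rewrite inE => /andP[wu wN]; apply/card_gt0P; exists w.
  rewrite !inE (NS f w fF wN) esym eN //= /I wN andbT.
  have inN y : y \in N f v -> [set v; y] \in f by rewrite inE.
  apply: contra wu => tw.
  rewrite tri_sym in tw; rewrite tri_sym in tu.
  by have := F5tri fF (inN _ wN) (inN _ uN) tw tu => /set2_inj ->; rewrite ?set11 ?eqxx.
Qed.

Lemma Bfaces_nontri : 0 < #|Bfaces| -> 2 <= #|nontri|.
Proof.
case/card_gt0P => f; rewrite inE => /and3P[fF /set0Pn[u uN] /forall_inP nt].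
have [<- eN] := card_N fF uN; apply: subset_leq_card; apply/subsetP => w wN.
rewrite !inE nt // esym eN // !andbT.
have [b [c [d [x [U fE sub _]]]]] := F5_at fF uN.
move: wN; rewrite fE /N (cycle5_nbrs U) !inE => /orP[]/eqP->; apply: (subsetP sub);
by rewrite !inE eqxx ?orbT.
Qed.

End Vertex.

(** * Payments and balances *)

Section Payments.
Variables (rho : T -> option T) (TT : {set {set T}}).
Hypotheses (Y : yellow_at e S F3 rho TT) (Ymax : yellow_max e S F3 rho TT).

Let white v := (v \in S) && (rho v == None).

(* The charge sent by a vertex to a triangle. A vertex of degree 4 has a surplus
   of 4 only: it gives 3 to a triangle that has to pass 1 to a 5-face behind one of
   its edges at [v], and 2 otherwise. *)
Definition pay (t : {set T}) v : nat :=
  if 4 < deg v then 4 else if [exists f in F5, exists u in t, u \in N f v] then 3 else 2.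

(** The 5-faces that receive 1 from the triangle. *)
Definition paid (t : {set T}) := [set f in F5 | [exists u in t, exists v in t,
  [&& u != v, white u, white v & v \in N f u]]].

Lemma white_deg v : white v -> 4 <= deg v.
Proof.
have [_ Y3 _ _ _] := Y; case/andP=> vS /eqP rv.
rewrite ltn_neqAle deg3 // andbT; apply/eqP => d3.
by have := Y3 v vS (Logic.eq_sym d3); rewrite rv.
Qed.

Lemma vertex_balance v : white v ->
  \sum_(t in F3 | v \in t) pay t v + #|Bfaces v| + 12 <= 4 * deg v.
Proof.
move=> /[dup] wv /andP[vS _]; have d4 := white_deg wv.
have dE := deg_split v; have fE := faces_nontri v; have bE := @Bfaces_nontri v.
set tris := [set t in F3 | v \in t] in dE.
have pE c : (forall t, t \in F3 -> v \in t -> pay t v <= c) ->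
    \sum_(t in F3 | v \in t) pay t v <= c * #|tris|.
  move=> pc; rewrite mulnC -sum_nat_const.
  rewrite [X in _ <= X](eq_bigl (fun t => (t \in F3) && (v \in t))); last by move=> t; rewrite inE.
  by apply: leq_sum => t /andP[]; apply: pc.
(* Let t, n and B count the triangles, non-triangular edges and [Bfaces] at [v]; the degree is 2t +
   n, and B <= n. For degree at least 5 it remains that B + 12 <= 4t + 4n, where a positive B forces
   n >= 2. *)
have [d5|d5] := ltnP 4 (deg v).
  have : \sum_(t in F3 | v \in t) pay t v <= 4 * #|tris|.
    by apply: pE => t _ _; rewrite /pay d5.
  move: bE; case: (posnP #|Bfaces v|) => [->|_ /(_ isT)]; lia.
(* From here the degree is 4 and the surplus 4. Without [Afaces] every triangle gets 2, and 2t + B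
   <= 2t + n = 4. *)
have [A0|A0] := posnP #|Afaces v|.
  have : \sum_(t in F3 | v \in t) pay t v <= 2 * #|tris|.
    apply: pE => t tF vt; rewrite /pay ltnNge d5 /=.
    case: exists_inP => // -[f fF /exists_inP[u ut uN]].
    move/eqP: A0; rewrite cards_eq0 => /eqP/setP/(_ f); rewrite !inE fF /=.
    case/exists_inP; exists u => //.
    by apply/exists_inP; exists t; rewrite ?vt ?ut.
  lia.
(* A face in [Afaces] makes B < n, so n > 0 and t <= 1; hence 3t + B <= t + 3 <= 4. *)
have : \sum_(t in F3 | v \in t) pay t v <= 3 * #|tris|.
  by apply: pE => t tF vt; rewrite /pay ltnNge d5 /=; case: ifP.
lia.
Qed.

Definition across u v := [set f in F5 | v \in N f u].

Lemma acrossC u v : across u v = across v u.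
Proof. by apply/setP => f; rewrite !inE setUC. Qed.

Lemma paid_le t u v w : t = w |: (v |: [set u]) ->
  #|paid t| <= (white u && white v) * #|across u v| +
     (white u && white w) * #|across u w| + (white v && white w) * #|across v w|.
Proof.
move=> tE; have sub : paid t \subset
   [set f in across u v | white u && white v] :|:
   [set f in across u w | white u && white w] :|:
   [set f in across v w | white v && white w].
  apply/subsetP => f; rewrite inE => /andP[fF /exists_inP[a at_ /exists_inP[b bt]]].
  case/and4P=> ab wa wb bN; have fab : f \in across a b by rewrite inE fF.
  have fba := fab; rewrite acrossC in fba.
  have inS (A : {set {set {set T}}}) c : (f \in [set f in A | c]) = (f \in A) && c.
    by rewrite in_set.
  rewrite !in_setU !inS.
  move: at_ bt; rewrite tE !in_setU1 !in_set1.
  move=> /or3P[]/eqP aE /or3P[]/eqP bE; rewrite aE bE in ab wa wb fab fba;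
  first [by rewrite eqxx in ab | by rewrite ?fab ?fba ?wa ?wb ?orbT].
apply: leq_trans (subset_leq_card sub) _.
have setE (A : {set {set {set T}}}) b : #|[set f in A | b]| <= b * #|A|.
  case: b; rewrite ?mul1n; first by apply: subset_leq_card; apply/subsetP => f;
    rewrite inE => /andP[].
  by rewrite (_ : [set f in A | false] = set0) ?cards0 //; apply/setP => f; rewrite !inE andbF.
apply: leq_trans (leq_card_setU _ _) _; apply: leq_add (setE _ _).
by apply: leq_trans (leq_card_setU _ _) _; apply: leq_add (setE _ _) (setE _ _).
Qed.

(** The triangle takes one of the two places at the edge. *)
Lemma across_le1 t u v : t \in F3 -> u \in t -> v \in t -> u != v -> #|across u v| <= 1.
Proof.
move=> tF ut vt uv; have := edge_faces (F3adj tF ut vt uv).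
have -> : tri u v by apply/exists_inP; exists t; rewrite ?ut.
rewrite addn1 ltnS; apply: leq_trans; apply: subset_leq_card.
by apply/subsetP => f; rewrite !inE.
Qed.

Lemma pay_across (t : {set T}) u v : white u -> v \in t ->
  2 + (0 < #|across u v|) <= pay t u.
Proof.
move=> wu vt; rewrite /pay; case: ifP => // _; first by case: (0 < _).
case: posnP => [_|/card_gt0P[f]]; first by case: ifP.
rewrite inE => /andP[fF fN]; rewrite ifT //.
by apply/exists_inP; exists f => //; apply/exists_inP; exists v.
Qed.

(** If a vertex is yellow, maximality makes the other two white and one of these of degree at least
    5, so that it pays 4. Otherwise all three vertices pay. *)
Lemma triangle_balance t : t \in F3 -> t \notin TT ->
  6 + #|paid t| <= \sum_(v in t | white v) pay t v.
Proof.
move=> tF tT; have [_ _ Y4 _ _] := Y.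
have tS v : v \in t -> v \in S by apply: (subsetP (F3sub tF)).
have sumE p w q : t = q |: (w |: [set p]) -> w != q -> p != w -> p != q ->
    \sum_(v in t | white v) pay t v =
    white q * pay t q + (white w * pay t w + white p * pay t p).
  move=> tE wq pw pq;
  have qn : q \notin w |: [set p] by rewrite !inE negb_or ![q == _]eq_sym wq pq.
  have wn : w \notin [set p] by rewrite inE eq_sym.
  rewrite big_mkcondr /= tE (big_setU1 _ qn) (big_setU1 _ wn) /=.
  rewrite big_set1; case: (white q); case: (white w); case: (white p);
  by rewrite ?mul1n ?mul0n.
have [/exists_inP[p pt rp]|] := boolP [exists p in t, rho p != None].
  have [w [q [tE wq pw pq]]] := cards3_split (F3card tF) pt.
  have [wt qt] : w \in t /\ q \in t by rewrite tE !inE !eqxx !orbT.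
  have [only [u ut du]] := Ymax tF tT pt rp.
  have whiteE v : v \in t -> p != v -> white v.
    move=> vt pv; rewrite /white tS //=; case E: (rho v) => [c|] //.
    by move: pv; rewrite (only v) ?E ?eqxx.
  have up : u != p by apply: contraTneq du => ->; rewrite -leqNgt; apply: Y4.
  have ww := whiteE w wt pw; have wqq := whiteE q qt pq.
  have wp : white p = false by rewrite /white (negPf rp) andbF.
  rewrite (sumE p w q) // wp ww wqq !mul1n mul0n addn0.
  have le_paid := paid_le tE; rewrite wp ww wqq /= mul1n !mul0n add0n in le_paid.
  apply: yellow_triangle_arith (across_le1 tF wt qt wq) le_paid.
  - move: ut; rewrite tE !inE (negPf up) orbF => /orP[]/eqP E; rewrite /pay -E du //.
    by rewrite orbT.
  - exact: pay_across ww qt.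
  - by rewrite acrossC; apply: pay_across wqq wt.
move/exists_inPn => none.
have whiteE v : v \in t -> white v.
  by move=> vt; rewrite /white tS //=; move: (none v vt); rewrite negbK.
have [p pt] : exists p, p \in t by apply/card_gt0P; rewrite F3card.
have [w [q [tE wq pw pq]]] := cards3_split (F3card tF) pt.
have [wt qt] : w \in t /\ q \in t by rewrite tE !inE !eqxx !orbT.
have [ww wqq wp] : [/\ white w, white q & white p] by split; apply: whiteE.
rewrite (sumE p w q) // wp ww wqq !mul1n.
have le_paid := paid_le tE; rewrite wp ww wqq /= !mul1n in le_paid.
apply: (white_triangle_arith (across_le1 tF wt qt wq) (across_le1 tF pt wt pw)
  (across_le1 tF pt qt pq) _ _ _ _ _ _ le_paid).
- exact: pay_across ww qt.
- by rewrite acrossC; apply: pay_across wqq wt.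
- by rewrite acrossC; apply: pay_across ww pt.
- exact: pay_across wp wt.
- by rewrite acrossC; apply: pay_across wqq pt.
- exact: pay_across wp qt.
Qed.

Lemma nonwhite_tri u v : u \in S -> v \in S -> e u v -> ~~ tri u v -> white u || white v.
Proof.
have [_ _ _ Yadj [TTF _ _]] := Y; move=> uS vS uv; apply: contraNT.
rewrite negb_or /white uS vS /= => /andP[ru rv].
have [t tT utv] := Yadj u v ru rv uv.
by apply/exists_inP; exists t => //; apply: (subsetP TTF).
Qed.

Lemma face_balance_at f a b c d x : f \in F5 -> uniq [:: a; b; c; d; x] ->
  f = cycle5_edges a b c d x -> [:: a; b; c; d; x] \subset S ->
  cycle e [:: a; b; c; d; x] -> ~~ tri b c -> ~~ tri c d -> ~~ tri d x -> ~~ tri x a ->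
  2 <= #|[set v | white v && (f \in Bfaces v)]| + #|[set t in F3 | f \in paid t]|.
Proof.
move=> fF U fE /subsetP sub cyc nbc ncd ndx nxa.
have [aS bS cS dS xS] : [/\ a \in S, b \in S, c \in S, d \in S & x \in S].
  by split; apply: sub; rewrite !inE eqxx ?orbT.
have [eab ebc ecd edx exa] : [/\ e a b, e b c, e c d, e d x & e x a].
  by move: cyc => /= /and5P[-> -> -> -> /andP[->]].
have rotU n : uniq (rot n [:: a; b; c; d; x]) by rewrite rot_uniq.
have BmemP u v w : N f v = [set u; w] -> ~~ tri u v -> ~~ tri v w -> f \in Bfaces v.
  move=> NE nuv nvw; rewrite inE fF NE /=; apply/andP; split.
    by apply/set0Pn; exists u; rewrite !inE eqxx.
  by apply/forall_inP => y; rewrite !inE => /orP[]/eqP-> //; rewrite tri_sym.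
have Bc : f \in Bfaces c.
  apply: (@BmemP b _ d) => //; rewrite fE 2!cycle5_edges_rot /N (cycle5_nbrs (rotU 2)).
  by rewrite setUC.
have Bd : f \in Bfaces d.
  apply: (@BmemP c _ x) => //; rewrite fE 3!cycle5_edges_rot /N (cycle5_nbrs (rotU 3)).
  by rewrite setUC.
have Bx : f \in Bfaces x.
  apply: (@BmemP d _ a) => //; rewrite fE 4!cycle5_edges_rot /N (cycle5_nbrs (rotU 4)).
  by rewrite setUC.
have two u v : u != v -> white u -> white v -> f \in Bfaces u -> f \in Bfaces v ->
    2 <= #|[set v | white v && (f \in Bfaces v)]| + #|[set t in F3 | f \in paid t]|.
  move=> uv wu wv Bu Bv; apply: leq_trans (leq_addr _ _).
  rewrite -[2]/(true.+1) -uv -cards2; apply: subset_leq_card; apply/subsetP => y.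
  by rewrite in_set2 in_set => /orP[]/eqP->; rewrite ?wu ?wv.
have [cd cx dx ad ax] : [/\ c != d, c != x, d != x, a != d & a != x].
  move: U; rewrite /= !inE !negb_or -!andbA.
  by move=> /and5P[_ _ -> -> /and5P[_ _ _ -> /and3P[-> -> _]]].
have wcd := nonwhite_tri cS dS ecd ncd; have wdx := nonwhite_tri dS xS edx ndx.
have wbc := nonwhite_tri bS cS ebc nbc; have wxa := nonwhite_tri xS aS exa nxa.
(* The vertices [c], [d], [x] meet no triangular edge of the cycle and pay directly when white. If
   fewer than two of them are white, only [d] is, and then [a] and [b] are white: the missing unit
   comes from [a], or from the triangle on [ab] if there is one. *)
have [wd|nwd] := boolP (white d); last first.
  by apply: (two c x); rewrite // ?(negPf nwd) ?orbF // in wcd wdx *.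
have [wc|nwc] := boolP (white c); first by apply: (two c d).
have [wx|nwx] := boolP (white x); first by apply: (two d x).
rewrite (negPf nwc) orbF in wbc; rewrite (negPf nwx) /= in wxa.
have Na : N f a = [set b; x] by rewrite fE /N (cycle5_nbrs U).
have [/exists_inP[t tF /andP[at_ bt]]|nab] := boolP (tri a b); last first.
  apply: (two a d) => //; apply: (@BmemP x _ b) => //.
  by rewrite Na setUC.
rewrite -[2]/(1 + 1); apply: leq_add; apply/card_gt0P.
  by exists d; rewrite in_set wd.
exists t; rewrite !in_set tF fF; apply/exists_inP; exists a => //.
apply/exists_inP; exists b => //; rewrite wxa wbc Na !inE eqxx !andbT /=.
by apply: contraTneq eab => ->; rewrite eirr.
Qed.

(** By [F5tri], no other edge of the cycle is in a triangle. *)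
Lemma face_balance_tri f a b c d x : f \in F5 -> uniq [:: a; b; c; d; x] ->
  f = cycle5_edges a b c d x -> [:: a; b; c; d; x] \subset S ->
  cycle e [:: a; b; c; d; x] -> tri a b ->
  2 <= #|[set v | white v && (f \in Bfaces v)]| + #|[set t in F3 | f \in paid t]|.
Proof.
move=> fF U fE sub cyc tab; apply: (face_balance_at fF U fE sub cyc).
all: have fab : [set a; b] \in f by rewrite fE !inE eqxx.
all: apply/negP => t2; move: U.
all: rewrite /= !inE !negb_or -!andbA => /and5P[ab ac ad ax /and5P[bc bd bx cd /and3P[cx dx _]]].
all: have := (fun m => F5tri fF fab m tab t2).
all: rewrite fE !inE !eqxx ?orbT => /(_ isT) /eqP; rewrite set2_eq.
all: by rewrite ?(negPf ab) ?(negPf ac) ?(negPf ad) ?(negPf ax) ?(negPf bc) ?(negPf bd) ?(negPf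
  bx) ?andbF.
Qed.

Lemma face_balance f : f \in F5 ->
  2 <= #|[set v | white v && (f \in Bfaces v)]| + #|[set t in F3 | f \in paid t]|.
Proof.
move=> fF; have [a [b [c [d [x [U fE sub cyc]]]]]] := F5cycle fF.
have rotP n : let s := rot n [:: a; b; c; d; x] in [/\ uniq s, s \subset S & cycle e s].
  rewrite /= rot_uniq rot_cycle; split=> //; apply/subsetP => w.
  by rewrite mem_rot; move/subsetP: sub; apply.
have [tbc|nbc] := boolP (tri b c).
  have [U' sub' cyc'] := rotP 1; apply: (face_balance_tri fF U' _ sub' cyc' tbc).
  by rewrite fE cycle5_edges_rot.
have [tcd|ncd] := boolP (tri c d).
  have [U' sub' cyc'] := rotP 2; apply: (face_balance_tri fF U' _ sub' cyc' tcd).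
  by rewrite fE 2!cycle5_edges_rot.
have [tdx|ndx] := boolP (tri d x).
  have [U' sub' cyc'] := rotP 3; apply: (face_balance_tri fF U' _ sub' cyc' tdx).
  by rewrite fE 3!cycle5_edges_rot.
have [txa|nxa] := boolP (tri x a).
  have [U' sub' cyc'] := rotP 4; apply: (face_balance_tri fF U' _ sub' cyc' txa).
  by rewrite fE 4!cycle5_edges_rot.
exact: (face_balance_at fF U fE sub cyc).
Qed.

(** A yellow vertex has charge 0 or 4, as its degree is 3 or 4, and there are two of degree 4 per
    glued triangle. This yields 8 per triangle, of which 6 will be spent. *)
Lemma yellow_balance :
  8 * #|TT| + 12 * #|[set v | rho v != None]| <= 4 * \sum_(v | rho v != None) deg v.
Proof.
have [fl Y3 Y4 Yadj [TTF TTr Ycard]] := Y.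
have YS v : rho v != None -> v \in S.
  by case E: (rho v) => [c|] // _; apply: (subsetP (fl c).1); rewrite inE E.
set n3 := #|[set v in S | deg v == 3]| in Ycard.
have n3E : n3 = \sum_(v | rho v != None) (deg v == 3).
  rewrite /n3 -sum1dep_card big_mkcond [RHS]big_mkcond; apply: eq_bigr => v _.
  case: (boolP (v \in S)) => vS /=; last by case: ifP => // /YS; rewrite (negPf vS).
  case: eqP => [d3|_]; last by case: ifP.
  by rewrite Y3.
have : \sum_(v | rho v != None) 16 <= \sum_(v | rho v != None) (4 * deg v + 4 * (deg v == 3)).
  apply: leq_sum => v rv; have := Y4 v rv; have := deg3 (YS v rv).
  by rewrite -/(deg v); case: (deg v) => [|[|[|[|[|n]]]]].
rewrite big_split /= -!big_distrr /= -n3E -sum1dep_card sum1dep_card.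
rewrite sum_nat_const -/n3.
have -> : #|(fun v => rho v != None)| = #|[set v | rho v != None]|.
  by apply: eq_card => v; rewrite inE.
rewrite Ycard; move: #|TT| (n3) (\sum_(_ | _) _) => p q r; clear; lia.
Qed.

(** A glued triangle has only yellow vertices, so it passes nothing on and costs exactly 6. *)
Lemma triangles_balance : \sum_(t in F3) (6 + #|paid t|) <=
  6 * #|TT| + \sum_(v | white v) \sum_(t in F3 | v \in t) pay t v.
Proof.
have [_ _ _ _ [TTF TTr _]] := Y.
rewrite (exchange_big_dep (mem F3)) /=; last by move=> v t _ /andP[].
rewrite (bigID (mem TT)) /=; apply: leq_add.
  rewrite mulnC -sum_nat_const [X in X <= _](_ : _ = \sum_(t in TT) 6) //.
  apply: eq_big => t; first by rewrite andb_idl // => /(subsetP TTF).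
  case/andP => _ tT; suff -> : paid t = set0 by rewrite cards0.
  apply/setP => f; rewrite [RHS]inE inE; apply/negP => /andP[_ /exists_inP[u ut /exists_inP[v _]]].
  by case/and4P => _ /andP[_ /eqP ru]; have := TTr t u tT ut; rewrite ru.
rewrite [X in _ <= X](bigID (mem TT)) /=; apply: leq_trans (leq_addl _ _).
apply: leq_sum => t /andP[tF tT].
apply: leq_trans (triangle_balance tF tT) _.
rewrite [X in _ <= X](eq_bigl (fun v => (v \in t) && white v)) // => v.
by rewrite tF andbC.
Qed.

Lemma faces_balance :
  2 * #|F5| <= \sum_(v | white v) #|Bfaces v| + \sum_(t in F3) #|paid t|.
Proof.
rewrite mulnC -sum_nat_const.
have faces : \sum_(f in F5) 2 <= \sum_(f in F5)
    (#|[set v | white v && (f \in Bfaces v)]| + #|[set t in F3 | f \in paid t]|).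
  by apply: leq_sum => f; apply: face_balance.
apply: leq_trans faces _; rewrite big_split /=; apply: leq_add.
  rewrite (double_count (mem F5) white (fun f v => f \in Bfaces v)).
  by apply: leq_sum => v _; apply: subset_leq_card; apply/subsetP => f; rewrite in_set => /andP[].
rewrite (double_count (mem F5) (mem F3) (fun f t => f \in paid t)).
by apply: leq_sum => t _; apply: subset_leq_card; apply/subsetP => f; rewrite in_set => /andP[].
Qed.

Lemma discharge_at : 6 * #|F3| + 2 * #|F5| + 12 * #|S| <= 4 * \sum_(v in S) deg v.
Proof.
have [fl _ _ _ _] := Y.
have YS v : rho v != None -> v \in S.
  by case E: (rho v) => [c|] // _; apply: (subsetP (fl c).1); rewrite inE E.
have whites : \sum_(v | white v) (\sum_(t in F3 | v \in t) pay t v + #|Bfaces v| + 12)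
    <= 4 * \sum_(v | white v) deg v.
  by rewrite big_distrr /=; apply: leq_sum => v; apply: vertex_balance.
rewrite !big_split /= in whites.
have yellows := yellow_balance; have triangles := triangles_balance.
have faces := faces_balance.
rewrite big_split /= sum_nat_const in triangles.
have -> : \sum_(v in S) deg v = \sum_(v | rho v != None) deg v + \sum_(v | white v) deg v.
  rewrite (bigID (fun v => rho v != None)) /=; congr (_ + _).
    by apply: eq_bigl => v; rewrite andb_idl // => /YS.
  by apply: eq_bigl => v; rewrite negbK.
have cS : #|S| = #|[set v | rho v != None]| + #|white|.
  rewrite -(cardsID [set v | rho v != None]); congr (_ + _).
    by apply: eq_card => v; rewrite !inE andb_idl // => /YS.
  by apply: eq_card => v; rewrite !inE negbK andbC.
rewrite cS; rewrite sum_nat_const in whites.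
move: whites yellows triangles faces.
move: #|F3| #|F5| #|white| #|[set v | rho v != None]| #|TT| (\sum_(_ in _) #|paid _|).
move: (\sum_(_ | _) #|Bfaces _|) (\sum_(_ | _) \sum_(_ in _ | _) _).
move: (\sum_(_ | _ != _) deg _) (\sum_(_ | white _) deg _).
clear; lia.
Qed.

End Payments.

Lemma discharge : 6 * #|F3| + 2 * #|F5| + 12 * #|S| <= 4 * \sum_(v in S) deg v.
Proof.
have [rho [TT [Y Ymax]]] := yellow_exists esym eirr F3card F3sub F3adj F3share irred.
exact: discharge_at Y Ymax.
Qed.

End Discharge.

(** * Face systems and Euler's inequality *)

Definition nbrs (T : finType) (f : {set {set T}}) (v : T) := [set u | [set v; u] \in f].

(** Membership in the cycle space over the field with two elements. *)
Definition even_edges (T : finType) (f : {set {set T}}) := forall v, ~~ odd #|nbrs f v|.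

Definition symdiff (T : finType) (A B : {set T}) := (A :\: B) :|: (B :\: A).

Lemma in_symdiff (T : finType) (A B : {set T}) x :
  (x \in symdiff A B) = (x \in A) (+) (x \in B).
Proof. by rewrite !inE; case: (x \in A); case: (x \in B). Qed.

Lemma odd_symdiff (T : finType) (A B : {set T}) :
  odd #|symdiff A B| = odd #|A| (+) odd #|B|.
Proof.
rewrite /symdiff cardsU -(cardsID B A) -(cardsID A B).
have -> : (A :\: B) :&: (B :\: A) = set0.
  by apply/setP => x; rewrite !inE; case: (x \in A); rewrite ?andbF.
rewrite cards0 subn0 !oddD [B :&: A]setIC.
by case: (odd #|A :&: B|); case: (odd #|A :\: B|); case: (odd #|B :\: A|).
Qed.

Lemma symdiffK (T : finType) (B : {set T}) : involutive (fun A => symdiff A B).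
Proof. by move=> A; apply/setP => x; rewrite !in_symdiff addbK. Qed.

Section Edges.
Variables (T : finType) (e : rel T) (E : {set {set T}}).
Hypotheses (esym : symmetric e) (eirr : irreflexive e).
Hypothesis memE : forall u v, ([set u; v] \in E) = e u v.
Hypothesis pairE : forall A, A \in E -> exists u v, A = [set u; v].

Implicit Types (z f : {set {set T}}).

Lemma card_nbrs z v : z \subset E -> #|nbrs z v| = #|[set A | (A \in z) && (v \in A)]|.
Proof.
move=> zE; have inj : {in nbrs z v &, injective (fun u => [set v; u])}.
  by move=> u w _ _ /set2_inj.
rewrite -(card_in_imset inj); apply: eq_card => A.
rewrite inE; apply/imsetP/andP => [[u + ->]|[zA vA]].
  by rewrite inE !inE eqxx.
have [a [b AE]] := pairE (subsetP zE _ zA); move: vA; rewrite AE !inE => /orP[]/eqP vE.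
  by exists b; rewrite ?inE vE // -AE.
by exists a; rewrite ?inE vE setUC // -AE.
Qed.

Lemma sum_nbrs z : z \subset E -> \sum_v #|nbrs z v| = 2 * #|z|.
Proof.
move=> zE; under eq_bigr do rewrite card_nbrs //.
rewrite (double_count xpredT (mem z) (fun v A => v \in A)) /= mulnC -sum_nat_const.
apply: eq_bigr => A zA.
have [a [b AE]] := pairE (subsetP zE _ zA).
have -> : [set v in A] = A by apply/setP => v; rewrite inE.
by move: (subsetP zE _ zA); rewrite AE memE cards2; case: eqVneq => // ->; rewrite eirr.
Qed.

Lemma nbrs_symdiff z z' v : nbrs (symdiff z z') v = symdiff (nbrs z v) (nbrs z' v).
Proof.
apply/setP => u; have N f : (u \in nbrs f v) = ([set v; u] \in f) by rewrite in_set.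
by rewrite in_symdiff !N in_symdiff.
Qed.

(* A 2-basis in the sense of MacLane, except that it only has to generate the
   cycle space. *)
Definition face_system (F0 : {set {set {set T}}}) :=
  [/\ forall f, f \in F0 -> [/\ f \subset E, f != set0 & even_edges f],
      forall A, A \in E -> #|[set f in F0 | A \in f]| <= 2 &
      forall z, z \subset E -> even_edges z -> exists2 Q : {set {set {set T}}},
        Q \subset F0 & z = [set A in E | odd #|[set f in Q | A \in f]|]].

Lemma euler (S : {set T}) F0 x0 : x0 \in S -> (forall A, A \in E -> A \subset S) ->
  face_system F0 -> #|E| < #|S| + #|F0|.
Proof.
move=> x0S ES [_ _ span].
(* [Z] is the cycle space. It has at most 2 ^ #|F0| elements by [span], and at
   least 2 ^ (#|E| - #|S| + 1), as the degree parities of a subset of [E] sum to 0. *)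
pose Z := [set z in powerset E | [forall v, ~~ odd #|nbrs z v|]].
have Z_le : #|Z| <= 2 ^ #|F0|.
  rewrite -card_powerset.
  pose phi (Q : {set {set {set T}}}) := [set A in E | odd #|[set f in Q | A \in f]|].
  apply: leq_trans (leq_imset_card phi _); apply: subset_leq_card.
  apply/subsetP => z; rewrite !inE => /andP[zE /forallP ev].
  have [Q QF ->] := span z zE ev; apply/imsetP; exists Q => //.
  by rewrite inE.
pose d (z : {set {set T}}) := [set v in S :\ x0 | odd #|nbrs z v|].
(* Adding a fixed member [z0] embeds a nonempty fibre of [d] into [Z]. The parity at [x0], which [d]
   ignores, follows from the handshake identity. *)
have fiber y : #|[set z in powerset E | d z == y]| <= #|Z|.
  have [->|] := eqVneq [set z in powerset E | d z == y] set0; first by rewrite cards0.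
  case/set0Pn=> z0; rewrite !inE => /andP[z0E /eqP dz0].
  rewrite -(card_imset _ (inv_inj (symdiffK z0))); apply: subset_leq_card.
  apply/subsetP => _ /imsetP[z + ->]; rewrite !inE => /andP[zE /eqP dz].
  set w := symdiff z z0.
  have wE : w \subset E.
    by apply/subsetP => A; rewrite in_symdiff => Aw;
      case: (boolP (A \in z)) Aw => [/(subsetP zE)//|_ /(subsetP z0E)].
  have w0 v : v != x0 -> ~~ odd #|nbrs w v|.
    move=> vx; have [vS|vS] := boolP (v \in S).
      rewrite nbrs_symdiff odd_symdiff.
      have := dz; rewrite -dz0 => /setP/(_ v).
      by rewrite !inE vx vS /= => ->; rewrite addbb.
    suff -> : nbrs w v = set0 by rewrite cards0.
    apply/setP => u; rewrite in_set in_set0; apply: contraNF vS => wA.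
    by apply: (subsetP (ES _ (subsetP wE _ wA))); rewrite !inE eqxx.
  rewrite wE /=; apply/forallP => v; have [->|/w0 //] := eqVneq v x0.
  have := congr1 odd (sum_nbrs wE); rewrite (bigD1 x0) //= oddD oddM /=.
  rewrite (_ : odd (\sum_(_ | _) _) = false) ?addbF => [->//|].
  apply/negbTE; elim/big_ind: _ => [//|a b|u /w0 //].
  by rewrite oddD => /negPf-> /negPf->.
have : #|powerset E| <= 2 ^ (#|S|.-1 + #|F0|).
  rewrite -sum1_card (partition_big d (fun y => y \in powerset (S :\ x0))) /=; last first.
    by move=> z _; rewrite inE; apply/subsetP => v; rewrite inE => /andP[].
  rewrite expnD (_ : 2 ^ #|S|.-1 = #|powerset (S :\ x0)|); last first.
    by rewrite card_powerset (cardsD1 x0 S) x0S.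
  rewrite -sum_nat_const; apply: leq_sum => y _.
  apply: leq_trans Z_le; apply: leq_trans (fiber y).
  by rewrite -sum1dep_card; apply/eq_leq/eq_bigl => z; rewrite !inE.
rewrite card_powerset leq_exp2l // (cardsD1 x0 S) x0S /=; lia.
Qed.

(** * Even edge sets with at most five edges *)

Section SmallFaces.
Hypothesis noC4 : forall a b c d, uniq [:: a; b; c; d] -> ~~ cycle e [:: a; b; c; d].

Lemma even_next f a b : even_edges f -> b \in nbrs f a -> exists2 c, c \in nbrs f a & c != b.
Proof.
move=> ev ba; have := ev a; rewrite (cardsD1 b) ba add1n /= negbK => od.
have /card_gt0P[c] : 0 < #|nbrs f a :\ b| by case: #|_| od.
by rewrite inE => /andP[cb ca]; exists c; rewrite // -in_set1.
Qed.

Lemma nbrsC f a b : (b \in nbrs f a) = (a \in nbrs f b).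
Proof. by rewrite !inE setUC. Qed.

Lemma nbrs_edge f a b : f \subset E -> b \in nbrs f a -> e a b.
Proof. by move=> fE; rewrite inE => /(subsetP fE); rewrite memE. Qed.

Lemma edge_neq a b : e a b -> a != b.
Proof. by apply: contraTneq => ->; rewrite eirr. Qed.

(** Even degrees leave no dead ends, so a path can be continued without turning back. The end [d]
    may coincide with [a]. *)
Lemma even_path f : f \subset E -> f != set0 -> even_edges f -> exists a b c d,
  [/\ b \in nbrs f a, c \in nbrs f b, d \in nbrs f c & [/\ a != b, b != c, c != d,
    a != c & b != d]].
Proof.
move=> fE /set0Pn[A fA] ev; have [a [b AE]] := pairE (subsetP fE _ fA).
have ba : b \in nbrs f a by rewrite inE -AE.
have [c cb ca] := even_next ev (etrans (nbrsC _ _ _) ba : a \in nbrs f b).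
have [d dc db] := even_next ev (etrans (nbrsC _ _ _) cb : b \in nbrs f c).
exists a, b, c, d; split=> //; split; try exact: edge_neq (nbrs_edge fE _).
- by rewrite eq_sym.
- by rewrite eq_sym.
Qed.

Lemma card_ge3 f : f \subset E -> f != set0 -> even_edges f -> 2 < #|f|.
Proof.
move=> fE f0 ev; have [a [b [c [d [ba cb dc [ab bc cd ac bd]]]]]] := even_path fE f0 ev.
rewrite !inE in ba cb dc.
have sub : [set [set a; b]; [set b; c]; [set c; d]] \subset f.
  by rewrite !subUset !sub1set ba cb dc.
apply: leq_trans (subset_leq_card sub).
rewrite setUC cardsU1 cards2 !inE !set2_eq.
by rewrite ?[d == b]eq_sym ?[c == a]eq_sym ?[c == b]eq_sym ?(negPf ab) ?(negPf bc) ?(negPf ac)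
  ?(negPf bd) ?(negPf cd) ?andbF ?eqxx.
Qed.

Definition triangle_edges (a b c : T) := [set [set a; b]; [set b; c]; [set c; a]].

Lemma card3_triangle f : f \subset E -> even_edges f -> #|f| = 3 ->
  exists a b c, [/\ uniq [:: a; b; c], e a b, e b c, e c a & f = triangle_edges a b c].
Proof.
move=> fE ev f3; have f0 : f != set0 by rewrite -card_gt0 f3.
have [a [b [c [d [ba cb dc [ab bc cd ac bd]]]]]] := even_path fE f0 ev.
have [eab ebc ecd] := And3 (nbrs_edge fE ba) (nbrs_edge fE cb) (nbrs_edge fE dc).
(* The three path edges exhaust [f], so the second edge at [a] is [cd], and [a = d]. *)
have [y ya yb] := even_next ev ba.
rewrite !inE in ba cb dc ya.
have fE' : f = [set [set a; b]; [set b; c]; [set c; d]].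
  symmetry; apply/eqP; rewrite eqEcard !subUset !sub1set ba cb dc /= f3.
  rewrite setUC cardsU1 cards2 !inE !set2_eq.
  by rewrite ?[d == b]eq_sym ?[c == a]eq_sym ?[c == b]eq_sym ?(negPf ab) ?(negPf bc) ?(negPf
    ac) ?(negPf bd) ?(negPf cd) ?andbF ?eqxx.
have ad : a = d.
  move: ya; rewrite fE' !inE !set2_eq (negPf ab) (negPf ac) (negPf yb) eqxx ?andbF /=.
  by rewrite ?orbF ?andbF /= => /andP[/eqP].
exists a, b, c; split=> //; rewrite ?ad // /= ?inE ?negb_or -?ad ?ab ?ac ?bc //.
by rewrite fE' /triangle_edges ad.
Qed.

Lemma even_triangle a b c : uniq [:: a; b; c] -> even_edges (triangle_edges a b c).
Proof.
rewrite /= !inE negb_or => /and3P[/andP[ab ac] bc _] v.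
have nE : nbrs (triangle_edges a b c) v = if v == a then [set b; c] else
   if v == b then [set a; c] else if v == c then [set a; b] else set0.
  apply/setP => u; rewrite !inE !set2_eq.
  have [ba ca cb] : [/\ b != a, c != a & c != b] by split; rewrite eq_sym.
  case: (eqVneq v a) => [vE|va]; [|case: (eqVneq v b) => [vE|vb]; [|case: (eqVneq v c) => [vE|vc]]];
  rewrite !inE ?vE ?eqxx ?(negPf ab) ?(negPf ac) ?(negPf bc) ?(negPf ba) ?(negPf ca) ?(negPf cb) /=;
  by case: (u == a); case: (u == b); case: (u == c).
by rewrite nE; do 3! [case: ifP => _; first by rewrite cards2 ?ab ?ac ?bc]; rewrite cards0.
Qed.

(** Removing the triangle leaves a nonempty even set, which again has at least three edges. *)
Lemma triangle_sub a b c f : f \subset E -> even_edges f -> uniq [:: a; b; c] ->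
  [set a; b] \in f -> [set b; c] \in f -> [set c; a] \in f -> 3 < #|f| -> 5 < #|f|.
Proof.
move=> fE ev U ab bc ca f3; pose t := triangle_edges a b c.
have tf : t \subset f by rewrite !subUset !sub1set ab bc ca.
have t3 : #|t| <= 3.
  apply: leq_trans (leq_card_setU _ _) _; rewrite cards1 addn1 ltnS.
  by rewrite cards2; case: (_ != _).
have t3' : 3 <= #|t|.
  apply: card_ge3 (even_triangle U); first exact: subset_trans tf fE.
  by apply/set0Pn; exists [set a; b]; rewrite !inE eqxx.
have sdE : symdiff f t = f :\: t.
  by apply/setP => A; rewrite in_symdiff in_setD;
    case: (boolP (A \in t)) => [/(subsetP tf)->|_]; rewrite ?addbF.
have cf : #|f| = #|t| + #|f :\: t| by rewrite -(cardsID t f) (setIidPr tf).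
have : 2 < #|f :\: t|.
  apply: card_ge3; first exact: subset_trans (subsetDl _ _) fE.
    by rewrite -card_gt0; lia.
  by move=> v; rewrite -sdE nbrs_symdiff odd_symdiff (negPf (ev v)) (negPf (even_triangle U v)).
lia.
Qed.

(** Follow a path a, b, c, d, x without turning back. A repeated vertex would close a triangle,
    excluded by [triangle_sub], or a 4-cycle. Its edges and the second edge at [a] are five distinct
    edges, hence all of [f], and the second edge at [x] has to close the cycle. *)
Lemma card45_cycle f : f \subset E -> even_edges f -> 3 < #|f| <= 5 ->
  exists a b c d x, [/\ uniq [:: a; b; c; d; x], cycle e [:: a; b; c; d; x],
    f = cycle5_edges a b c d x & #|f| = 5].
Proof.
move=> fE ev /andP[f3 f5]; have f0 : f != set0 by rewrite -card_gt0; lia.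
have [a [b [c [d [ba cb dc [ab bc cd ac bd]]]]]] := even_path fE f0 ev.
have notri p q r : uniq [:: p; q; r] -> q \in nbrs f p -> r \in nbrs f q -> p \in nbrs f r -> False.
  move=> U; rewrite !inE => h1 h2 h3.
  by have := triangle_sub fE ev U h1 h2 h3 f3; rewrite ltnNge f5.
have ad : a != d.
  apply/eqP => ad; rewrite -{}ad in dc; apply: (notri a b c) => //.
  by rewrite /= !inE negb_or ab ac bc.
have [x xd xc] := even_next ev (etrans (nbrsC _ _ _) dc : c \in nbrs f d).
have [eab ebc ecd edx] := And4 (nbrs_edge fE ba) (nbrs_edge fE cb) (nbrs_edge fE dc) (nbrs_edge
  fE xd).
have dx := edge_neq edx.
have bx : b != x.
  apply/eqP => bx; rewrite -{}bx in xd; apply: (notri b c d) => //.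
  by rewrite /= !inE negb_or bc bd cd.
have ax : a != x.
  apply/eqP => ax; have := @noC4 a b c d; rewrite /= !inE !negb_or ab ac ad bc bd cd /=.
  by rewrite eab ebc ecd ax edx => /(_ isT).
have [y ya yb] := even_next ev ba.
have [w wx wd] := even_next ev (etrans (nbrsC _ _ _) xd : d \in nbrs f x).
pose s := [:: [set a; b]; [set b; c]; [set c; d]; [set d; x]; [set a; y]].
have cx : c != x by rewrite eq_sym.
have neq := (negPf ab, negPf ac, negPf ad, negPf ax, negPf bc, negPf bd, negPf bx,
  negPf cd, negPf cx, negPf dx).
have sneq (u v : T) : u != v -> (v == u) = false by rewrite eq_sym => /negPf.
have neqs := (sneq _ _ ab, sneq _ _ ac, sneq _ _ ad, sneq _ _ ax, sneq _ _ bc, sneq _ _ bd,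
  sneq _ _ bx, sneq _ _ cd, sneq _ _ cx, sneq _ _ dx).
have ss : uniq s.
  by rewrite /= !inE !set2_eq (sneq _ _ yb) !(neq, neqs, eqxx, andbF).
have sf : {subset s <= f}.
  by move=> A; rewrite !inE in ba cb dc xd ya *;
    move=> /or4P[||/eqP->|/orP[]] => [/eqP->|/eqP->||/eqP->|/eqP->].
have fs : f =i s.
  have [] := uniq_min_size ss (s2 := enum f).
  - by move=> A /sf; rewrite mem_enum.
  - by rewrite -cardE.
  by move=> _ Es A; rewrite Es mem_enum.
have f5' : #|f| = 5 by rewrite (eq_card fs) (card_uniqP ss).
have xy : x = y.
  move: wx; rewrite inE fs !inE !set2_eq !(neq, neqs, negPf wd, eqxx, andbF) /= ?orbF.
  by case/andP => /eqP.
exists a, b, c, d, x; split=> //.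
- by rewrite /= !inE !neq.
- by rewrite /= eab ebc ecd edx (nbrs_edge fE (_ : a \in nbrs f x)) // nbrsC xy.
- apply/setP => A; rewrite fs !inE xy; do 4 congr (_ || _).
  by rewrite setUC.
Qed.

End SmallFaces.
End Edges.

Lemma cycle5_rotate (T : finType) (e : rel T) (a b c d x : T) (A : {set T}) :
  uniq [:: a; b; c; d; x] -> cycle e [:: a; b; c; d; x] ->
  A \in cycle5_edges a b c d x -> exists a' b' c' d' x',
    [/\ uniq [:: a'; b'; c'; d'; x'], cycle e [:: a'; b'; c'; d'; x'],
        cycle5_edges a b c d x = cycle5_edges a' b' c' d' x' & A = [set a'; b']].
Proof.
move=> U cyc; have rotP n : let s := rot n [:: a; b; c; d; x] in uniq s /\ cycle e s.
  by rewrite /= rot_uniq rot_cycle.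
rewrite !inE => /or4P[||/eqP->|/orP[]] => [/eqP->|/eqP->||/eqP->|/eqP->].
- by exists a, b, c, d, x.
- by have [] := rotP 1; exists b, c, d, x, a; rewrite cycle5_edges_rot.
- by have [] := rotP 2; exists c, d, x, a, b; rewrite 2!cycle5_edges_rot.
- by have [] := rotP 3; exists d, x, a, b, c; rewrite 3!cycle5_edges_rot.
- by have [] := rotP 4; exists x, a, b, c, d; rewrite 4!cycle5_edges_rot.
Qed.

Lemma uniq_insert (T : eqType) (s1 s2 : seq T) y :
  uniq (s1 ++ y :: s2) = (y \notin s1 ++ s2) && uniq (s1 ++ s2).
Proof. by rewrite -cons_uniq; apply: perm_uniq; rewrite -cat1s perm_catCA. Qed.

(** * Short faces under the cycle conditions *)

Section Faces.
Variables (T : finType) (e : rel T) (S : {set T}) (E : {set {set T}}).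
Variable F0 : {set {set {set T}}}.
Hypotheses (esym : symmetric e) (eirr : irreflexive e).
Hypothesis memE : forall u v, ([set u; v] \in E) = e u v.
Hypothesis pairE : forall A, A \in E -> exists u v, A = [set u; v].
Hypothesis eS : forall u v, e u v -> u \in S.
Hypothesis FS : face_system E F0.
Definition no_cycle k := forall s : seq T, size s = k -> uniq s -> ~~ cycle e s.
Hypothesis noC4 : no_cycle 4.
Variable l : nat.
Hypotheses (hl : l \in [:: 5; 6; 7]) (noCl : no_cycle l).

Let noC4' a b c d : uniq [:: a; b; c; d] -> ~~ cycle e [:: a; b; c; d].
Proof. exact: noC4. Qed.

Definition F3 := [set cover f | f : {set {set T}} in [set f in F0 | #|f| == 3]].
Definition F5 := [set f in F0 | #|f| == 5].

Let F0P f : f \in F0 -> [/\ f \subset E, f != set0 & even_edges f].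
Proof. by case: FS => + _ _; apply. Qed.

Lemma triangle_face f : f \in F0 -> #|f| = 3 ->
  [/\ #|cover f| = 3 & forall u v, u \in cover f -> v \in cover f -> u != v -> [set u; v] \in f].
Proof.
move=> fF f3; have [fE _ ev] := F0P fF.
have [a [b [c [U ab bc ca ->]]]] := card3_triangle eirr memE pairE fE ev f3.
have cE : cover (triangle_edges a b c) = [set a; b; c].
  apply/setP => u; apply/bigcupP/idP => [[A]|].
    by rewrite !inE => /orP[/orP[]|]/eqP-> /[!inE] /orP[]/eqP->; rewrite eqxx ?orbT.
  rewrite !inE => /orP[/orP[]|]/eqP->; [exists [set a; b]|exists [set a; b]|exists [set b; c]];
  by rewrite !inE eqxx ?orbT.
move: U; rewrite cE /= !inE negb_or => /and3P[/andP[nab nac] nbc _]; split.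
  by rewrite setUC cardsU1 cards2 !inE negb_or ![c == _]eq_sym nab nac nbc.
move=> u v; rewrite !inE => /orP[/orP[]|]/eqP-> /orP[/orP[]|]/eqP->; rewrite ?eqxx // => _;
by rewrite !set2_eq !eqxx ?andbT ?orbT.
Qed.

Lemma F3P t : t \in F3 -> exists2 f, f \in F0 /\ #|f| = 3 & t = cover f.
Proof. by case/imsetP => f; rewrite inE => /andP[fF /eqP f3] ->; exists f. Qed.

Lemma F3_card t : t \in F3 -> #|t| = 3.
Proof. by case/F3P => f [fF f3] ->; case: (triangle_face fF f3). Qed.

Lemma F3_adj t u v : t \in F3 -> u \in t -> v \in t -> u != v -> e u v.
Proof.
case/F3P => f [fF f3] -> ut vt uv; rewrite -memE.
by have [fE _ _] := F0P fF; apply: (subsetP fE); apply: (triangle_face fF f3).2.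
Qed.

Lemma third (t : {set T}) u v : #|t| = 3 -> u \in t -> v \in t -> u != v ->
  exists w, [/\ w \in t, w != u, w != v & t = [set u; v; w]].
Proof.
move=> t3 ut vt uv; have [w [q [tE wq uw uq]]] := cards3_split t3 ut.
have sw : q |: (w |: [set u]) = [set u; w; q].
  by apply/setP => y; rewrite !inE; case: (y == u); case: (y == w); case: (y == q).
move: (vt); rewrite tE !inE => /or3P[]/eqP vE; rewrite vE in uv *.
- exists w; rewrite !inE !eqxx ?orbT wq eq_sym uw; split=> //.
  by rewrite sw; apply/setP => y; rewrite !inE; case: (y == u); case: (y == w); case: (y == q).
- by exists q; rewrite !inE !eqxx ?orbT ![q == _]eq_sym wq uq sw.
- by rewrite eqxx in uv.
Qed.

Lemma F3_sub t : t \in F3 -> t \subset S.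
Proof.
move=> tF; apply/subsetP => u ut; have t3 := F3_card tF.
have [w [q [tE wq uw uq]]] := cards3_split t3 ut.
by apply: (eS (F3_adj tF ut (_ : w \in t) uw)); rewrite tE !inE eqxx orbT.
Qed.

(** Otherwise the two triangles without their common edge form a 4-cycle. *)
Lemma F3_share t t' u v : t \in F3 -> t' \in F3 -> u != v ->
  u \in t -> v \in t -> u \in t' -> v \in t' -> t = t'.
Proof.
move=> tF tF' uv ut vt ut' vt'.
have [w [wt wu wv tE]] := third (F3_card tF) ut vt uv.
have [y [yt yu yv tE']] := third (F3_card tF') ut' vt' uv.
have [wy|wy] := eqVneq w y; first by rewrite tE tE' wy.
have := @noC4' u w v y; rewrite /= !inE !negb_or eq_sym wu uv eq_sym yu wv wy eq_sym yv /=.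
rewrite eq_sym in wu; rewrite (F3_adj tF ut wt wu) (F3_adj tF wt vt wv).
rewrite eq_sym in yv; rewrite (F3_adj tF' vt' yt yv) (F3_adj tF' yt ut' yu).
by move/(_ isT).
Qed.

Lemma card_F3 : #|F3| = #|[set f in F0 | #|f| == 3]|.
Proof.
apply: card_in_imset.
suff sub f g : f \in F0 -> #|f| = 3 -> g \in F0 -> #|g| = 3 -> cover f = cover g -> f \subset g.
  move=> f g; rewrite !inE => /andP[fF /eqP f3] /andP[gF /eqP g3] fg.
  by apply/eqP; rewrite eqEsubset !sub.
move=> fF f3 gF g3 fg; apply/subsetP => A Af; have [fE _ _] := F0P fF.
have AE := subsetP fE _ Af; have [u [v Auv]] := pairE AE.
have uv : u != v by move: AE; rewrite Auv memE; apply: contraTneq => ->; rewrite eirr.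
have sub : A \subset cover g by rewrite -fg; apply: bigcup_sup Af.
rewrite Auv; apply: (triangle_face gF g3).2 => //; apply: (subsetP sub);
by rewrite Auv !inE eqxx ?orbT.
Qed.

Lemma F5_cycle f : f \in F5 -> exists a b c d x,
  [/\ uniq [:: a; b; c; d; x], f = cycle5_edges a b c d x,
      [:: a; b; c; d; x] \subset S & cycle e [:: a; b; c; d; x]].
Proof.
rewrite inE => /andP[fF /eqP f5]; have [fE _ ev] := F0P fF.
have [|a [b [c [d [x [U cyc fE' _]]]]]] := card45_cycle eirr memE pairE noC4' fE ev.
  by rewrite f5.
exists a, b, c, d, x; split=> //; apply/subsetP => w.
move: cyc => /= /and5P[ab bc cd dx /andP[xa _]].
by rewrite !inE => /or4P[||/eqP->|/orP[]] => [/eqP->|/eqP->||/eqP->|/eqP->]; apply: eS; eauto.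
Qed.

(** The triangular face at an edge is itself one of the at most two members of [F0] containing
    it. *)
Lemma edge_faces u v : e u v -> #|[set f in F5 | [set u; v] \in f]| + tri F3 u v <= 2.
Proof.
rewrite -memE => uvE; have [_ le2 _] := FS.
apply: leq_trans (le2 _ uvE).
case: (boolP (tri F3 u v)) => [/exists_inP[t tF /andP[ut vt]]|_]; last first.
  rewrite addn0; apply: subset_leq_card; apply/subsetP => f.
  by rewrite !inE => /andP[/andP[-> _] ->].
have [g [gF g3] tE] := F3P tF.
have uv : u != v by move: uvE; rewrite memE; apply: contraTneq => ->; rewrite eirr.
have uvg : [set u; v] \in g by apply: (triangle_face gF g3).2; rewrite -?tE.
have gN : g \notin [set f in F5 | [set u; v] \in f] by rewrite !inE g3 andbF.
rewrite addnC -[X in X <= _]/((true : nat) + _).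
have := cardsU1 g [set f in F5 | [set u; v] \in f]; rewrite gN => <-.
apply: subset_leq_card; apply/subsetP => f; rewrite !inE => /orP[/eqP->|/andP[/andP[-> _] ->//]].
by rewrite gF.
Qed.

(** An apex on the 5-cycle would give a chord at [a] or [b], and a chord of a 5-cycle closes a
    4-cycle. *)
Lemma apex_off a b c d x w : uniq [:: a; b; c; d; x] -> cycle e [:: a; b; c; d; x] ->
  e a w -> e b w -> w \notin [:: a; b; c; d; x].
Proof.
rewrite /= !inE !negb_or -!andbA => /and5P[ab ac ad ax /and5P[bc bd bx cd /and3P[cx dx _]]].
move=> /and5P[eab ebc ecd edx /andP[exa _]] aw bw.
apply/and5P; split; apply/eqP => wE; rewrite wE in aw bw.
- by rewrite eirr in aw.
- by rewrite eirr in bw.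
- by have := @noC4' a c d x; rewrite /= !inE !negb_or ac ad ax cd cx dx aw ecd edx exa => /(_ isT).
- by have := @noC4' a b c d; rewrite /= !inE !negb_or ac ad ab cd bc bd eab ebc ecd [e d a]esym
  aw => /(_ isT).
- by have := @noC4' b c d x; rewrite /= !inE !negb_or cd cx dx bc bd bx ebc ecd edx [e x b]esym
  bw => /(_ isT).
Qed.

Lemma tri_apex u v p q : [set u; v] = [set p; q] -> p != q -> tri F3 u v ->
  exists w, e p w /\ e q w.
Proof.
move=> uvE pq /exists_inP[t tF /andP[ut vt]].
have sub : [set p; q] \subset t by rewrite -uvE subUset !sub1set ut vt.
move: sub; rewrite subUset !sub1set => /andP[pt qt].
have [w [wt wp wq _]] := third (F3_card tF) pt qt pq.
by exists w; split; apply: (F3_adj tF) => //; rewrite eq_sym.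
Qed.

Lemma F5_tri f u v u' v' : f \in F5 -> [set u; v] \in f -> [set u'; v'] \in f ->
  tri F3 u v -> tri F3 u' v' -> [set u; v] = [set u'; v'].
Proof.
move=> fF uvf uvf' t1 t2; apply/eqP/negPn/negP => neq.
have [a0 [b0 [c0 [d0 [x0 [U0 fE _ cyc0]]]]]] := F5_cycle fF.
rewrite fE in uvf uvf'.
have [a [b [c [d [x [U cyc cE uvE]]]]]] := cycle5_rotate U0 cyc0 uvf.
rewrite {}cE in uvf'; move: (U) (cyc).
rewrite /= !inE !negb_or -!andbA => /and5P[ab ac ad ax /and5P[bc bd bx cd /and3P[cx dx _]]].
move=> /and5P[eab ebc ecd edx /andP[exa _]].
have [w [aw bw]] := tri_apex uvE ab t1.
have wa : e w a by rewrite esym.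
have wb : e w b by rewrite esym.
have := apex_off U cyc aw bw; rewrite !inE !negb_or => /and5P[wna wnb wnc wnd wnx].
have C6 : cycle e [:: a; w; b; c; d; x] by rewrite /= aw wb ebc ecd edx exa.
have U6 : uniq [:: a; w; b; c; d; x].
  by rewrite /= !inE !negb_or ab ac ad ax bc bd bx cd cx dx wnb wnc wnd wnx eq_sym wna.
(* For [l = 5] the cycle itself is excluded; for [l = 6], the detour through the apex [w] instead of
   the edge [ab]; for [l = 7], a second detour is added. *)
move: hl noCl; rewrite !inE => /or3P[]/eqP->.
- by move=> /(_ [:: a; b; c; d; x] (erefl _) U) /negP.
- by move=> /(_ [:: a; w; b; c; d; x] (erefl _) U6) /negP.
move=> no7.
have wU : w \notin [:: a; b; c; d; x] by exact: apex_off aw bw.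
have U7 s1 s2 y : s1 ++ s2 = [:: a; w; b; c; d; x] -> y \notin [:: a; b; c; d; x] ->
    w != y -> uniq (s1 ++ y :: s2).
  move=> sE yU wy; rewrite uniq_insert sE U6 andbT; move: yU.
  by rewrite !inE !negb_or eq_sym [y == w]eq_sym wy => /and5P[-> -> -> -> ->].
have C4 p q r : uniq [:: p; q; r] -> {subset [:: p; q; r] <= [:: a; b; c; d; x]} ->
    e p q -> e q r -> e r w -> e w p -> False.
  move=> Upqr sub pq qr rw wp; have := @noC4' w p q r.
  by rewrite cons_uniq Upqr (contra (@sub w) wU) /= pq qr rw wp => /(_ isT).
(* By [C4], [w] is adjacent to neither [c] nor [x]. Each edge of the cycle other than [ab] has one
   of these as an end, so the second apex differs from [w]. *)
have Cabc : e c w -> False.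
  move=> cw; apply: (@C4 a b c) => //; first by rewrite /= !inE negb_or ab ac bc.
  by move=> z; rewrite !inE => /or3P[]/eqP->; rewrite eqxx ?orbT.
have Cbax : e x w -> False.
  move=> xw; apply: (@C4 b a x) => //; rewrite // 1?esym //.
    by rewrite /= !inE negb_or eq_sym ab bx ax.
  by move=> z; rewrite !inE => /or3P[]/eqP->; rewrite eqxx ?orbT.
have rotP n : let s := rot n [:: a; b; c; d; x] in uniq s /\ cycle e s.
  by rewrite /= rot_uniq rot_cycle.
have offP n y : y \notin rot n [:: a; b; c; d; x] -> y \notin [:: a; b; c; d; x].
  by rewrite mem_rot.
move: uvf'; rewrite !inE -uvE eq_sym (negPf neq) /= => /or4P[]/eqP E'.
- have [y [by_ cy]] := tri_apex E' bc t2.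
  have yU : y \notin [:: a; b; c; d; x].
    by apply: (offP 1); apply: apex_off (rotP 1).1 (rotP 1).2 by_ cy.
  have wy : w != y by apply/eqP => wy; apply: Cabc; rewrite wy.
  have := no7 [:: a; w; b; y; c; d; x] (erefl _) (@U7 [:: a; w; b] [:: c; d; x] y (erefl _) yU wy).
  by rewrite /= aw wb by_ [e y c]esym cy ecd edx exa.
- have [y [cy dy]] := tri_apex E' cd t2.
  have yU : y \notin [:: a; b; c; d; x].
    by apply: (offP 2); apply: apex_off (rotP 2).1 (rotP 2).2 cy dy.
  have wy : w != y by apply/eqP => wy; apply: Cabc; rewrite wy.
  have := no7 [:: a; w; b; c; y; d; x] (erefl _) (@U7 [:: a; w; b; c] [:: d; x] y (erefl _) yU wy).
  by rewrite /= aw wb ebc cy [e y d]esym dy edx exa.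
- have [y [dy xy]] := tri_apex E' dx t2.
  have yU : y \notin [:: a; b; c; d; x].
    by apply: (offP 3); apply: apex_off (rotP 3).1 (rotP 3).2 dy xy.
  have wy : w != y by apply/eqP => wy; apply: Cbax; rewrite wy.
  have := no7 [:: a; w; b; c; d; y; x] (erefl _) (@U7 [:: a; w; b; c; d] [:: x] y (erefl _) yU wy).
  by rewrite /= aw wb ebc ecd dy [e y x]esym xy exa.
- have xa : x != a by rewrite eq_sym.
  have [y [xy ay]] := tri_apex E' xa t2.
  have yU : y \notin [:: a; b; c; d; x].
    by apply: (offP 4); apply: apex_off (rotP 4).1 (rotP 4).2 xy ay.
  have wy : w != y by apply/eqP => wy; apply: Cbax; rewrite wy.
  have := no7 [:: a; w; b; c; d; x; y] (erefl _) (@U7 [:: a; w; b; c; d; x] [::] y (erefl _) yU wy).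
  by rewrite /= aw wb ebc ecd edx xy [e y a]esym ay.
Qed.

Lemma edges_in_S A : A \in E -> A \subset S.
Proof.
move=> AE; have [u [v Auv]] := pairE AE; move: AE; rewrite Auv memE => uv.
by rewrite subUset !sub1set (eS uv) (eS (_ : e v u)) // esym.
Qed.

Lemma sum_degrees : \sum_(v in S) #|[set u in S | e u v]| = 2 * #|E|.
Proof.
rewrite -(sum_nbrs eirr memE pairE (subxx E)) [RHS](bigID (mem S)) /=.
rewrite [X in _ = _ + X]big1 => [|v vS].
  rewrite addn0; apply: eq_bigr => v vS; apply: eq_card => u.
  by rewrite !inE memE esym andb_idl // => uv; apply: (eS (_ : e u v)); rewrite esym.
apply/eqP; rewrite cards_eq0; apply/eqP/setP => u; rewrite !inE memE.
by apply: contraNF vS; apply: eS.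
Qed.

Lemma sum_faces : \sum_(f in F0) #|f| <= 2 * #|E|.
Proof.
have [_ le2 _] := FS.
have -> : \sum_(f in F0) #|f| = \sum_(f in F0) #|[set A | (A \in E) && (A \in f)]|.
  apply: eq_bigr => f fF; apply: eq_card => A; rewrite inE andb_idl //.
  by have [/subsetP fE _ _] := F0P fF; apply: fE.
rewrite (double_count (mem F0) (mem E) (fun f A => A \in f)) /= mulnC -sum_nat_const.
by apply: leq_sum => A; apply: le2.
Qed.

(** Faces have at least three edges and never four, so 6 <= |f| + 3[|f| = 3] + [|f| = 5] for each
    face [f]. *)
Lemma face_count : 6 * #|F0| <= 2 * #|E| + 3 * #|F3| + #|F5|.
Proof.
have sumE (P : pred {set {set T}}) : \sum_(f in F0) P f = #|[set f in F0 | P f]|.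
  by rewrite -sum1dep_card big_mkcondr.
have : \sum_(f in F0) 6 <= \sum_(f in F0) (#|f| + (#|f| == 3) + (#|f| == 3) + (#|f| == 3) +
  (#|f| == 5)).
  apply: leq_sum => f fF; have [fE f0 ev] := F0P fF.
  have f2 := card_ge3 eirr memE pairE fE f0 ev.
  have f4 : #|f| != 4.
    apply/eqP => f4; have [|a [b [c [d [x [_ _ _]]]]]] := card45_cycle eirr memE pairE noC4' fE ev.
      by rewrite f4.
    by rewrite f4.
  by case: #|f| f2 f4 => [|[|[|[|[|[|[|n]]]]]]].
rewrite sum_nat_const !big_split /= (sumE (fun f => #|f| == 3)) (sumE (fun f => #|f| == 5))
  card_F3 -/F5.
have := sum_faces; move: #|F0| #|F5| (\sum_(_ in _) _) #|E| #|[set _ in _ | _]|.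
by clear; lia.
Qed.

(** As the degrees sum to [2 * #|E|], the discharging bound and twice [face_count] give
    [12 * (#|F0| + #|S|) <= 12 * #|E|], against [euler]. *)
Lemma reducible_config : S != set0 -> (forall v, v \in S -> 3 <= #|[set u in S | e u v]|) ->
  ~ reducible e S -> False.
Proof.
case/set0Pn=> x0 x0S deg3 irred.
have := discharge esym eirr F3_card F3_sub F3_adj F3_share F5_cycle edge_faces F5_tri deg3 irred.
rewrite sum_degrees; have := euler eirr memE pairE x0S edges_in_S FS; have := face_count.
by move: #|F0| #|F3| #|F5| #|S| #|E|; clear; lia.
Qed.

End Faces.

(** * Faces of a grid minor *)

Module GridFaces.
Import boolp.

Definition pixel := (nat * nat)%type.
(* [(true, x)] is the vertical grid edge going up from [x], and [(false, x)] the
   horizontal one going to the right. *)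
Definition gedge := (bool * pixel)%type.

Definition end1 (g : gedge) : pixel := g.2.
Definition end2 (g : gedge) : pixel := if g.1 then (g.2.1, g.2.2.+1) else (g.2.1.+1, g.2.2).

(* The cell [(i, j)] is the unit square with lower left corner [(i, j)]. The
   predecessor is truncated at 0, hence the predicates [positive] and [proper_edge]. *)
Definition side1 (g : gedge) : pixel := if g.1 then (g.2.1.-1, g.2.2) else (g.2.1, g.2.2.-1).
Definition side2 (g : gedge) : pixel := g.2.

(** The degree of the grid point [x] in [z] modulo 2. *)
Definition boundary (z : gedge -> bool) (x : pixel) : bool :=
  z (false, (x.1.-1, x.2)) (+) z (false, x) (+) z (true, (x.1, x.2.-1)) (+) z (true, x).

(** The boundary, modulo 2, of a set of cells. *)
Definition sep (C : pixel -> bool) (g : gedge) := C (side1 g) (+) C (side2 g).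

Definition positive (x : pixel) := (0 < x.1) && (0 < x.2).

Definition proper_edge (g : gedge) := if g.1 then 0 < g.2.1 else 0 < g.2.2.

Lemma boundary_sep C x : positive x -> boundary (sep C) x = false.
Proof.
case: x => [[|i] [|j]] //= _; rewrite /boundary /sep /side1 /side2 /=.
by case: (C (i, j)); case: (C (i, j.+1)); case: (C (i.+1, j)); case: (C (i.+1, j.+1)).
Qed.

Lemma boundary_add z z' x :
  boundary (fun g => z g (+) z' g) x = boundary z x (+) boundary z' x.
Proof.
rewrite /boundary; move: (z _) (z _) (z _) (z _) (z' _) (z' _) (z' _) (z' _).
by do 8 case.
Qed.

Lemma boundary_single g x : positive x ->
  boundary (fun g' => g' == g) x = (x == end1 g) (+) (x == end2 g).
Proof.
case: g x => [[] [k l]] [[|i] [|j]] //= _; rewrite /boundary /end1 /end2 /= !xpair_eqE /= !eqSS.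
  by case: (i.+1 == k); case: (j == l); case: (j.+1 == l).
by case: (i.+1 == k); case: (i == k); case: (j.+1 == l).
Qed.

(* The parity of the number of edges of [z] crossed by an upward ray from [c]. *)
Definition fill N (z : gedge -> bool) (c : pixel) : bool :=
  \big[addb/false]_(c.2.+1 <= k < N) z (false, (c.1, k)).

(** The discrete substitute for the Jordan curve theorem: a finite even edge set bounds a set of
    cells. Across horizontal edges this is the definition of [fill]; across vertical ones it is
    proved downwards from the top, with the even degree at the upper end of the edge. *)
Lemma sep_fill N z : (forall x, positive x -> boundary z x = false) ->
  (forall b i j, z (b, (i, j)) -> [&& 0 < i, i < N, 0 < j & j + b < N]) ->
  forall g, proper_edge g -> sep (fill N z) g = z g.
Proof.
move=> bz sz [[] [i j]]; rewrite /proper_edge /= => ij0; rewrite /sep /side1 /side2 /=; last first.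
  case: j ij0 => // j _; rewrite /fill /=.
  have [jN|jN] := ltnP j.+1 N.
    by rewrite big_ltn // -addbA addbb addbF.
  rewrite !big_geq //=; last exact: leqW.
  by apply/esym/negP => /sz/and4P[_ _ _]; rewrite /= addn0 ltnNge jN.
case: i ij0 => // i _ /=; have [m] := ubnP (N - j).
elim: m j => // m IH j le_m.
have [jN|jN] := ltnP j.+1 N; last first.
  rewrite /fill !big_geq //=.
  by apply/esym/negP => /sz/and4P[_ _ _]; rewrite /= addn1 ltnNge jN.
rewrite /fill /= big_ltn // [X in _ (+) X]big_ltn //.
have lt_m' : N - j.+1 < m by lia.
have := IH j.+1 lt_m'; rewrite /fill /= => IH'; have := bz (i.+1, j.+1) isT;
  rewrite /boundary /= -IH'.
move: (z _) (z _) (z _) (\big[_/_]_(_ <= _ < _) _) (\big[_/_]_(_ <= _ < _) _).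
by do 5 case.
Qed.

Lemma big_addb_shift (F : nat -> bool) N : F 0 = false -> F N = false ->
  \big[addb/false]_(i < N) F i = \big[addb/false]_(i < N) F i.+1.
Proof.
case: N => [|N] F0 FN; first by rewrite !big_ord0.
by rewrite big_ord_recl [RHS]big_ord_recr /= F0 FN addbF.
Qed.

Definition crosses (X : pixel -> bool) (g : gedge) := X (end1 g) (+) X (end2 g).

(** In the sum of degrees over [X], an edge with both ends in [X] cancels. Left and lower edges are
    re-indexed by a shift, which loses nothing because [X] avoids the border. *)
Lemma sum_boundary N (X : pixel -> bool) z :
  (forall i j, X (i, j) -> [&& 0 < i, i < N, 0 < j & j < N]) ->
  \big[addb/false]_(i < N) \big[addb/false]_(j < N)
     (X (val i, val j) && boundary z (val i, val j)) =
  \big[addb/false]_(i < N) \big[addb/false]_(j < N)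
    (z (false, (val i, val j)) && crosses X (false, (val i, val j)) (+)
     z (true, (val i, val j)) && crosses X (true, (val i, val j))).
Proof.
move=> sX; have X0 i j : [|| i == 0, i == N, j == 0 | j == N] -> X (i, j) = false.
  by move=> b; apply/negP => /sX/and4P[i0 iN j0 jN]; move: b i0 iN j0 jN; case/or4P=> /eqP->;
    rewrite ?ltnn.
pose S F := \big[addb/false]_(i < N) \big[addb/false]_(j < N) F (val i) (val j).
have SD F G : S (fun i j => F i j (+) G i j) = S F (+) S G.
  by rewrite /S -big_split; apply: eq_bigr => i _; rewrite big_split.
have eqS F G : (forall i j, F i j = G i j) -> S F = S G.
  by move=> FG; apply: eq_bigr => i _; apply: eq_bigr => j _.
have shift1 F : (forall j, F 0 j = false) -> (forall j, F N j = false) ->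
    S F = S (fun i => F i.+1).
  move=> F0 FN; rewrite /S exchange_big [RHS]exchange_big; apply: eq_bigr => j _.
  exact: (@big_addb_shift (fun i => F i j)).
have shift2 F : (forall i, F i 0 = false) -> (forall i, F i N = false) ->
    S F = S (fun i j => F i j.+1).
  by move=> F0 FN; rewrite /S; apply: eq_bigr => i _; apply: big_addb_shift.
rewrite -[LHS]/(S (fun i j => X (i, j) && boundary z (i, j))).
rewrite -[RHS]/(S (fun i j => z (false, (i, j)) && crosses X (false, (i, j)) (+)
   z (true, (i, j)) && crosses X (true, (i, j)))).
transitivity (S (fun i j => X (i, j) && z (false, (i.-1, j))) (+)
  S (fun i j => X (i, j) && z (false, (i, j))) (+)
  S (fun i j => X (i, j) && z (true, (i, j.-1))) (+)
  S (fun i j => X (i, j) && z (true, (i, j)))).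
  rewrite -!SD; apply: eqS => i j; rewrite /boundary /=; case: (X (i, j)) => //=.
rewrite (shift1 (fun i j => X (i, j) && z (false, (i.-1, j)))); last 2 first.
- by move=> j; rewrite X0 ?eqxx ?orbT.
- by move=> j; rewrite X0 ?eqxx ?orbT.
rewrite (shift2 (fun i j => X (i, j) && z (true, (i, j.-1)))); last 2 first.
- by move=> j; rewrite X0 ?eqxx ?orbT.
- by move=> j; rewrite X0 ?eqxx ?orbT.
rewrite -!SD; apply: eqS => i j; rewrite /crosses /end1 /end2 /=.
by case: (X (i, j)); case: (X (i.+1, j)); case: (X (i, j.+1));
   case: (z (false, (i, j))); case: (z (true, (i, j))).
Qed.

Inductive linked (T : Type) (phi : pixel -> option T) (w : T) (x : pixel) : pixel -> Prop :=
| linked_refl : phi x = Some w -> linked phi w x x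
| linked_fwd g : linked phi w x (end1 g) -> phi (end2 g) = Some w -> linked phi w x (end2 g)
| linked_bwd g : linked phi w x (end2 g) -> phi (end1 g) = Some w -> linked phi w x (end1 g).

Lemma linked_end (T : Type) (phi : pixel -> option T) w x y :
  linked phi w x y -> phi y = Some w.
Proof. by case. Qed.

(** The fibres of [phi] are the branch sets of a minor model; a fibre may be empty. *)
Record grid_minor (T : finType) (e : rel T) (N : nat) (phi : pixel -> option T) : Prop := {
  minor_box : forall i j w, phi (i, j) = Some w -> [&& 0 < i, i < N, 0 < j & j < N];
  minor_linked : forall x y w, phi x = Some w -> phi y = Some w -> linked phi w x y;
  minor_edge : forall u v, e u v -> exists g,
    (phi (end1 g) = Some u /\ phi (end2 g) = Some v) \/
    (phi (end1 g) = Some v /\ phi (end2 g) = Some u) }.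

(** * Cycle space and faces of a grid minor *)

Section Minor.
Variables (T : finType) (e : rel T) (E : {set {set T}}) (N : nat) (phi : pixel -> option T).
Hypotheses (esym : symmetric e) (eirr : irreflexive e).
Hypothesis memE : forall u v, ([set u; v] \in E) = e u v.
Hypothesis pairE : forall A, A \in E -> exists u v, A = [set u; v].
Hypothesis M : grid_minor e N phi.

Lemma phi_positive x w : phi x = Some w -> positive x.
Proof. by case: x => i j /(minor_box M)/and4P[? _ ? _]; apply/andP. Qed.

Lemma link_chain w x y : linked phi w x y -> exists z : gedge -> bool,
  (forall g, z g -> phi (end1 g) = Some w /\ phi (end2 g) = Some w) /\
  (forall p, positive p -> boundary z p = (p == x) (+) (p == y)).
Proof.
elim=> [xw|g l [z [sz bz]] gw|g l [z [sz bz]] gw].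
- by exists (fun=> false); split=> // p _; rewrite addbb /boundary.
- exists (fun g' => z g' (+) (g' == g)); split.
    move=> g'; case: eqP => [->|_]; last by rewrite addbF => /sz.
    by move=> _; split=> //; exact: linked_end l.
  move=> p pp; rewrite boundary_add bz // boundary_single //.
  by case: (p == x); case: (p == end1 g); case: (p == end2 g).
- exists (fun g' => z g' (+) (g' == g)); split.
    move=> g'; case: eqP => [->|_]; last by rewrite addbF => /sz.
    by move=> _; split=> //; exact: linked_end l.
  move=> p pp; rewrite boundary_add bz // boundary_single //.
  by case: (p == x); case: (p == end1 g); case: (p == end2 g).
Qed.

Lemma edge_choice : exists h : {set T} -> gedge, forall A, A \in E ->
  exists u v, [/\ A = [set u; v], phi (end1 (h A)) = Some u & phi (end2 (h A)) = Some v].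
Proof.
apply: (@fin_all_exists _ _ (fun A g => A \in E -> exists u v,
  [/\ A = [set u; v], phi (end1 g) = Some u & phi (end2 g) = Some v])) => A.
have [AE|nAE] := boolP (A \in E); last by exists (true, (0, 0)).
have [u [v Auv]] := pairE AE; have [g gP] : exists g,
    (phi (end1 g) = Some u /\ phi (end2 g) = Some v) \/
    (phi (end1 g) = Some v /\ phi (end2 g) = Some u).
  by apply: (minor_edge M); rewrite -memE -Auv.
exists g => _; case: gP => -[p1 p2]; first by exists u, v.
by exists v, u; split; rewrite // setUC.
Qed.

Lemma root_choice : exists r : T -> pixel, forall w x, phi x = Some w -> phi (r w) = Some w.
Proof.
apply: (@fin_all_exists _ _ (fun w y => forall x, phi x = Some w -> phi y = Some w)) => w.
by have [[x xw]|no] := pselect (exists x, phi x = Some w); [exists x|exists (0, 0) => x xw;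
  case: no; exists x].
Qed.

Section Chosen.
Variables (h : {set T} -> gedge) (r : T -> pixel).
Hypothesis hP : forall A, A \in E ->
  exists u v, [/\ A = [set u; v], phi (end1 (h A)) = Some u & phi (end2 (h A)) = Some v].
Hypothesis rP : forall w x, phi x = Some w -> phi (r w) = Some w.

Definition interior g := exists w, phi (end1 g) = Some w /\ phi (end2 g) = Some w.
(** The grid edges across which cells are not merged. *)
Definition wall g := interior g \/ exists2 A, A \in E & g = h A.

Lemma h_not_interior A : A \in E -> ~ interior (h A).
Proof.
move=> AE [w [w1 w2]]; have [u [v [Auv]]] := hP AE; rewrite w1 w2 => -[uw] [vw].
by move: AE; rewrite Auv -uw -vw memE eirr.
Qed.

Lemma h_inj A B : A \in E -> B \in E -> h A = h B -> A = B.
Proof.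
move=> AE BE AB; have [u [v [Auv u1 v1]]] := hP AE; have [p [q [Bpq p1 q1]]] := hP BE.
by move: u1 v1; rewrite AB p1 q1 => -[pu] [qv]; rewrite Auv Bpq pu qv.
Qed.

(** The chain runs from the root of one end inside its branch set, through [h A], to the root of the
    other end. *)
Lemma edge_chain A : A \in E -> exists z : gedge -> bool,
  [/\ forall g, z g -> wall g, forall B, B \in E -> z (h B) = (A == B) &
   forall p, positive p -> boundary z p = odd #|[set w in A | p == r w]|].
Proof.
move=> AE; have [u [v [Auv u1 v1]]] := hP AE.
have [z1 [s1 b1]] := link_chain (minor_linked M (rP u1) u1).
have [z2 [s2 b2]] := link_chain (minor_linked M v1 (rP v1)).
have int1 g : z1 g -> interior g by move/s1 => ?; exists u.
have int2 g : z2 g -> interior g by move/s2 => ?; exists v.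
exists (fun g => z1 g (+) (g == h A) (+) z2 g); split.
- move=> g; case z1g: (z1 g); first by left; apply: int1.
  case z2g: (z2 g); first by left; apply: int2.
  by case: eqP => // -> _; right; exists A.
- move=> B BE; have nB := h_not_interior BE.
  case z1g: (z1 (h B)); first by case: nB; apply: int1.
  case z2g: (z2 (h B)); first by case: nB; apply: int2.
  rewrite addFb addbF; apply/eqP/eqP => [/(h_inj BE AE)|->] //.
- move=> p pp; rewrite !boundary_add b1 // b2 // boundary_single //.
  have uv : u != v by move: AE; rewrite Auv memE; apply: contraTneq => ->; rewrite eirr.
  have -> : [set w in A | p == r w] =
      symdiff (if p == r u then [set u] else set0) (if p == r v then [set v] else set0).
    apply/setP => w; rewrite in_symdiff Auv !inE.
    case: (eqVneq w u) => [->|wu] /=; first by case: ifP => _; case: ifP => _;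
      rewrite !inE ?eqxx ?(negPf uv).
    by case: (eqVneq w v) => [->|wv] /=; case: ifP => _; case: ifP => _;
      rewrite !inE ?eqxx ?(negPf wu) ?(negPf wv) // eq_sym (negPf uv).
  rewrite odd_symdiff; case: (p == r u); case: (p == r v); rewrite ?cards1 ?cards0 /=;
  by case: (p == end1 _); case: (p == end2 _).
Qed.

(** The chains of the edges in [z] are added. The boundary at a root is the parity of the degree of
    its vertex in [z]. *)
Lemma lift_even (z : {set {set T}}) : z \subset E -> even_edges z -> exists Z : gedge -> bool,
  [/\ forall g, Z g -> wall g, forall B, B \in E -> Z (h B) = (B \in z) &
   forall p, positive p -> boundary Z p = false].
Proof.
move=> zE ev.
have [Z_ ZP] : exists Z_ : {set T} -> gedge -> bool, forall A, A \in E ->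
  [/\ forall g, Z_ A g -> wall g, forall B, B \in E -> Z_ A (h B) = (A == B) &
   forall p, positive p -> boundary (Z_ A) p = odd #|[set w in A | p == r w]|].
  apply: (@fin_all_exists _ _ (fun A (Z : gedge -> bool) => A \in E -> [/\ forall g, Z g -> wall g,
    forall B, B \in E -> Z (h B) = (A == B) &
    forall p, positive p -> boundary Z p = odd #|[set w in A | p == r w]|])) => A.
  have [AE|nAE] := boolP (A \in E); last by exists (fun=> false).
  by have [Z ZP] := edge_chain AE; exists Z.
exists (fun g => \big[addb/false]_(A in z) Z_ A g); split.
- move=> g; apply: contraPP => nw; rewrite big1 // => A /(subsetP zE) AE.
  by have [sZ _ _] := ZP A AE; apply/negP => /sZ.
- move=> B BE; have [Bz|nBz] := boolP (B \in z).
    have [_ ZB _] := ZP B BE; rewrite (bigD1 B) //= ZB // eqxx big1 // => A /andP[/(subsetP zE)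
      AE AB].
    by have [_ ZA _] := ZP A AE; rewrite ZA // (negPf AB).
  rewrite big1 // => A Az; have [_ ZA _] := ZP A (subsetP zE _ Az); rewrite ZA //.
  by apply: contraNF nBz => /eqP <-.
- move=> p pp; have -> : boundary (fun g => \big[addb/false]_(A in z) Z_ A g) p =
      \big[addb/false]_(A in z) boundary (Z_ A) p by rewrite /boundary !big_split.
  transitivity (\big[addb/false]_(A in z) odd #|[set w in A | p == r w]|).
    by apply: eq_bigr => A /(subsetP zE) AE; have [_ _ ZA] := ZP A AE; rewrite ZA.
  rewrite -(big_morph odd oddD (erefl false : odd 0 = false)).
  have := double_count (mem z) xpredT (fun A w => (w \in A) && (p == r w)) => /= ->.
  apply/negbTE; elim/big_ind: _ => [//|a b|w _].
    by rewrite oddD => /negPf-> /negPf->.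
  case: (p == r w); last first.
    by rewrite (_ : [set _ | _] = set0) ?cards0 //; apply/setP => A; rewrite !inE !andbF.
  rewrite (_ : [set _ | _] = [set A | (A \in z) && (w \in A)]).
    by rewrite -(card_nbrs pairE) //; apply: ev.
  by apply/setP => A; rewrite !inE andbT.

Qed.

Definition closed_cells (C : pixel -> bool) :=
  forall g, proper_edge g -> ~ wall g -> sep C g = false.

Definition face (C : pixel -> bool) : {set {set T}} := [set A in E | sep C (h A)].

Inductive connected_cells (c : pixel) : pixel -> Prop :=
| connected_refl : connected_cells c c
| connected_step g d d' : connected_cells c d -> proper_edge g -> ~ wall g ->
    (d = side1 g /\ d' = side2 g) \/ (d = side2 g /\ d' = side1 g) -> connected_cells c d'.

Lemma connected_closed c d C : closed_cells C -> connected_cells c d -> C d = C c.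
Proof.
move=> clC; elim=> // g d1 d2 _ <- pg ng gE.
have := clC g pg ng; rewrite /sep; case: gE => -[-> ->];
by case: (C (side1 g)); case: (C (side2 g)).
Qed.

Definition component (c : pixel) : pixel -> bool := fun d => `[< connected_cells c d >].

Lemma component_refl c : component c c.
Proof. by apply/asboolP; apply: connected_refl. Qed.

Lemma component_closed c : closed_cells (component c).
Proof.
move=> g pg ng; rewrite /sep.
have -> : component c (side1 g) = component c (side2 g); last by rewrite addbb.
by apply/asboolP/asboolP => cd; apply: connected_step cd pg ng _; [left|right].
Qed.

Lemma component_eq c d : component c d -> component d =1 component c.
Proof.
move=> cd b; have /asboolP cd' := cd; apply/idP/idP => [/asboolP db|/asboolP cb].
  by rewrite (connected_closed (component_closed c) db).
rewrite (connected_closed (component_closed d) cb).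
by rewrite -(connected_closed (component_closed d) cd') component_refl.
Qed.

Definition faces : {set {set {set T}}} :=
  [set f | `[< exists c, f = face (component c) >] && (f != set0)].

Lemma h_proper A : A \in E -> proper_edge (h A).
Proof.
case/hP => u [v [_ /phi_positive/andP[p1 p2] _]]; rewrite /proper_edge.
by case: ifP.
Qed.

(** [sum_boundary] is applied to the branch set of [v]. All degrees in [sep C] are even, its edges
    are walls since [C] is closed, and the walls leaving the branch set are the [h A] with [v] in
    [A]. *)
Lemma face_even C : closed_cells C -> even_edges (face C).
Proof.
move=> clC v; have fE : face C \subset E by apply/subsetP => A; rewrite inE => /andP[].
rewrite (card_nbrs pairE) //.
pose X x := phi x == Some v.
(* The bound [N.+1] replaces [N] because [inord] below needs a nonempty range. *)
have sX i j : X (i, j) -> [&& 0 < i, i < N.+1, 0 < j & j < N.+1].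
  by move/eqP/(minor_box M)/and4P => [-> iN -> jN] /=; rewrite !ltnS (ltnW iN) (ltnW jN).
have := sum_boundary (sep C) sX; rewrite big1 => [|i _]; last first.
  rewrite big1 // => j _; case Xij: (X _) => //=; apply: boundary_sep.
  by have /and4P[i0 _ j0 _] := sX _ _ Xij; apply/andP.
under eq_bigr do rewrite big_split; rewrite big_split /=.
have count b : \big[addb/false]_(i < N.+1) \big[addb/false]_(j < N.+1)
    (sep C (b, (val i, val j)) && crosses X (b, (val i, val j))) =
    odd #|[set A | (A \in face C) && (v \in A) && ((h A).1 == b)]|.
  rewrite pair_big /=.
  pose F (p : 'I_N.+1 * 'I_N.+1) := let g := (b, (val p.1, val p.2)) in sep C g && crosses X g.
  transitivity (odd (\sum_p (F p : nat))).
    rewrite (big_morph odd oddD (erefl false : odd 0 = false)).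
    by apply: eq_bigr => p _; rewrite oddb.
  have -> : \sum_p (F p : nat) = #|[set p | F p]|.
    rewrite -sum1dep_card [RHS]big_mkcond.
    by apply: eq_bigr => p _; case: (F p).
  congr odd; pose k A : 'I_N.+1 * 'I_N.+1 := (inord (h A).2.1, inord (h A).2.2).
  have kE A : A \in E -> (val (k A).1, val (k A).2) = (h A).2.
    case/hP => u [w [_ + _]]; rewrite /k /end1; case: (h A).2 => i j.
    by move/(minor_box M)/and4P => [_ iN _ jN] /=; rewrite !inordK // ltnS ltnW.
  have k_inj : {in [set A | (A \in face C) && (v \in A) && ((h A).1 == b)] &, injective k}.
    move=> A B; rewrite !inE => /andP[/andP[/andP[AE _] _] /eqP Ab].
    move=> /andP[/andP[/andP[BE _] _] /eqP Bb] kAB; apply: h_inj => //.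
    rewrite [h A]surjective_pairing [h B]surjective_pairing Ab Bb.
    by rewrite -(kE A AE) -(kE B BE) kAB.
  rewrite -(card_in_imset k_inj); apply: eq_card => p.
  rewrite inE; apply/idP/imsetP => [/andP[sg cg]|[A + ->]].
    set g := (b, _) in sg cg; have wg : wall g.
      apply: contrapT => nw; move: sg; rewrite clC //.
      move: cg; rewrite /crosses /proper_edge; case: (boolP (X (end1 g))) => [|_].
        by move/eqP/phi_positive/andP => [? ?]; case: ifP.
      rewrite addFb => /eqP/phi_positive/andP; rewrite /end2 /g /=.
      by case: (b) => -[].
    case: wg => [[w [w1 w2]]|[A AE gA]].
      by move: cg; rewrite /crosses /X w1 w2 addbb.
    exists A; last first.
      move: (kE A AE); rewrite -gA => -[e1 e2].
      by rewrite [p]surjective_pairing; congr (_, _); apply: val_inj; rewrite /= ?e1 ?e2.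
    have [u [w [Auw u1 w1]]] := hP AE.
    rewrite !inE AE -gA sg eqxx andbT /=; move: cg; rewrite gA /crosses /X u1 w1 Auw !inE.
    rewrite ![Some _ == _](inj_eq (@Some_inj _)) ![_ == v]eq_sym.
    by case: (v == u); case: (v == w).
  rewrite inE => /andP[/andP[]]; rewrite inE => /andP[AE sA] vA /eqP Ab.
  have gE : (b, (val (k A).1, val (k A).2)) = h A.
    by rewrite kE // -Ab -surjective_pairing.
  rewrite /F /= gE sA /=; have [u [w [Auw u1 w1]]] := hP AE.
  have uw : u != w by move: AE; rewrite Auw memE; apply: contraTneq => ->; rewrite eirr.
  move: vA; rewrite /crosses /X u1 w1 Auw !inE ![Some _ == _](inj_eq (@Some_inj _)).
  by case/orP => /eqP ->; rewrite eqxx ?(negPf uw) // eq_sym (negPf uw).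
rewrite !count -oddD => ev.
suff -> : #|[set A | (A \in face C) && (v \in A)]| =
    #|[set A | (A \in face C) && (v \in A) && ((h A).1 == false)]| +
    #|[set A | (A \in face C) && (v \in A) && ((h A).1 == true)]| by rewrite -ev.
rewrite -(cardsID [set A | (h A).1]) addnC; congr (_ + _);
by apply: eq_card => A; rewrite !inE; case: ((h A).1); rewrite ?andbT ?andbF.
Qed.

(** A component whose face contains [A] includes exactly one side of [h A], so it is the component
    of that side. *)
Lemma faces_le2 A : A \in E -> #|[set f in faces | A \in f]| <= 2.
Proof.
move=> AE; apply: (@leq_trans #|[set face (component (side1 (h A)));
  face (component (side2 (h A)))]|).
  apply: subset_leq_card; apply/subsetP => f; rewrite !inE => /andP[/andP[/asboolP[c ->] _]].
  rewrite inE AE /= /sep => cA.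
  have [c1|c1] := boolP (component c (side1 (h A))).
    apply/orP; left; apply/eqP/setP => B; rewrite !inE; congr (_ && _).
    by rewrite /sep !(component_eq c1).
  rewrite (negPf c1) addFb in cA.
  apply/orP; right; apply/eqP/setP => B; rewrite !inE; congr (_ && _).
  by rewrite /sep !(component_eq cA).
by rewrite cards2; case: (_ != _).
Qed.

Definition in_span (z : {set {set T}}) := exists2 Q : {set {set {set T}}},
  Q \subset faces & z = [set A in E | odd #|[set f in Q | A \in f]|].

Lemma span_add z c : in_span z -> in_span (symdiff z (face (component c))).
Proof.
case=> Q QF ->; set f := face _.
have [f0|fn0] := eqVneq f set0.
  exists Q => //; rewrite f0; apply/setP => A; rewrite in_symdiff [A \in set0]inE addbF; by [].
exists (symdiff Q [set f]).
  apply/subsetP => g; rewrite in_symdiff; case: (boolP (g \in Q)) => [/(subsetP QF) //|_] /=.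
  by rewrite inE => /eqP ->; rewrite inE fn0 andbT; apply/asboolP; exists c.
apply/setP => A.
have inD (P : {set {set {set T}}}) :
    (A \in [set A in E | odd #|[set g in P | A \in g]|]) =
    (A \in E) && odd #|[set g in P | A \in g]| by rewrite in_set.
rewrite in_symdiff !inD.
have [AE|nAE] /= := boolP (A \in E); last first.
  by apply/negbTE; apply: contra nAE; rewrite inE => /andP[].
have -> : [set g in symdiff Q [set f] | A \in g] =
    symdiff [set g in Q | A \in g] (if A \in f then [set f] else set0).
  have inM (P : {set {set {set T}}}) g :
      (g \in [set g in P | A \in g]) = (g \in P) && (A \in g) by rewrite in_set.
  apply/setP => g; rewrite in_symdiff !inM in_symdiff in_set1.
  have [->|gf] := eqVneq g f; first by case: ifP => Af; rewrite ?inE ?eqxx ?Af ?andbT ?andbF.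
  by case: ifP => _; rewrite !inE ?(negPf gf) !addbF.
by rewrite odd_symdiff; case: ifP => _; rewrite ?cards1 ?cards0.
Qed.

(** Components of [C] are split off one at a time; confinement to the box makes this end. *)
Lemma closed_span C : closed_cells C ->
  (forall i j, C (i, j) -> (i < N) && (j < N)) -> in_span (face C).
Proof.
move=> clC sC; pose cells (D : pixel -> bool) := [set p : 'I_N * 'I_N | D (val p.1, val p.2)].
have [n] := ubnP #|cells C|; elim: n C clC sC => // n IH C clC sC lt_n.
have [C0|] := eqVneq (cells C) set0.
  exists set0; first exact: sub0set.
  have noC x : C x = false.
    apply/negP => Cx; case: x Cx => i j Cij; have /andP[iN jN] := sC _ _ Cij.
    move/setP/(_ (Ordinal iN, Ordinal jN)): C0; rewrite !inE /= Cij //.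
  apply/setP => A; rewrite !inE /sep !noC /= andbF.
  rewrite (_ : [set _ in _ | _] = set0) ?cards0 ?andbF //.
  by apply/setP => f; rewrite !inE.
case/set0Pn => p; rewrite inE => Cp; set c : pixel := (_, _) in Cp.
have sub x : component c x -> C x by move/asboolP/(connected_closed clC) ->.
pose C' x := C x (+) component c x.
have C'C x : C' x -> C x by rewrite /C'; case: (C x) (@sub x) => // H;
  case: (component c x) H => // ->.
have -> : face C = symdiff (face C') (face (component c)).
  apply/setP => A; rewrite in_symdiff !inE /sep /C'; case: (A \in E) => //=.
  by case: (C _); case: (C _); case: (component c _); case: (component c _).
apply: span_add; apply: IH.
- move=> g pg ng; rewrite /sep /C' addbACA.
  have := clC g pg ng; have := @component_closed c g pg ng.
  by rewrite /sep => -> ->.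
- by move=> i j /C'C /sC.
- rewrite -ltnS; apply: leq_trans lt_n; rewrite ltnS; apply: proper_card.
  apply/properP; split; first by apply/subsetP => q; rewrite !inE => /C'C.
  by exists p; rewrite !inE // /C' Cp component_refl.
Qed.

(** For generation, an even [z] lifts to an even set of walls, which bounds the cells of [fill].
    These form a closed set in the box, so [z] is a sum of faces of components. *)
Lemma faces_system : face_system E faces.
Proof.
split.
- move=> f; rewrite inE => /andP[/asboolP[c fE] f0]; split=> //.
    by rewrite fE; apply/subsetP => A; rewrite inE => /andP[].
  by rewrite fE; apply: face_even; apply: component_closed.
- exact: faces_le2.
- move=> z zE ev; have [Z [wZ hZ bZ]] := lift_even zE ev.
  have sZ b i j : Z (b, (i, j)) -> [&& 0 < i, i < N, 0 < j & j + b < N].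
    move/wZ => W; have [w [w' [p1 p2]]] : exists w w',
        phi (end1 (b, (i, j))) = Some w /\ phi (end2 (b, (i, j))) = Some w'.
      by case: W => [[w [p1 p2]]|[A /hP[u [v [_ p1 p2]]] gE]]; [exists w, w|exists u, v;
        rewrite gE].
    have /and4P[-> -> -> jN] := minor_box M p1.
    case: b p2 {W p1} => p2; last by rewrite addn0.
    by move/(minor_box M)/and4P: p2 => [_ _ _]; rewrite addn1.
  have sepC := sep_fill bZ sZ.
  have -> : z = face (fill N Z).
    apply/setP => A; rewrite inE; have [AE|nAE] := boolP (A \in E).
      by rewrite sepC ?hZ //; apply: h_proper.
    by apply/negbTE; apply: contra nAE => /(subsetP zE).
  apply: closed_span.
    by move=> g pg ng; rewrite sepC //; apply/negP => /wZ.
  move=> i j; rewrite /fill /= => C; apply/andP; split.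
    rewrite ltnNge; apply: contraTN C => Ni; rewrite big1 // => k _.
    by apply/negP => /sZ/and4P[_]; rewrite ltnNge Ni.
  rewrite ltnNge; apply: contraTN C => Nj; rewrite big_geq //.
  exact: leqW.
Qed.

End Chosen.

Lemma grid_minor_faces : exists F0, face_system E F0.
Proof.
have [h hP] := edge_choice; have [r rP] := root_choice.
by exists (faces h); apply: faces_system hP rP.
Qed.

End Minor.

End GridFaces.
Import GridFaces.

(** * Grid minors from walks in the grid *)

Definition adjacent (x y : pixel) :=
  (x.1 == y.1) && ((x.2.+1 == y.2) || (y.2.+1 == x.2)) ||
  (x.2 == y.2) && ((x.1.+1 == y.1) || (y.1.+1 == x.1)).

Lemma adjacent_gedge x y : adjacent x y -> exists g : gedge,
  (x = end1 g /\ y = end2 g) \/ (x = end2 g /\ y = end1 g).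
Proof.
case: x y => [i j] [k l] /=; rewrite /adjacent /=.
case/orP => /andP[/eqP <- /orP[]/eqP <-].
- by exists (true, (i, j)); left.
- by exists (true, (i, l)); right.
- by exists (false, (i, j)); left.
- by exists (false, (k, j)); right.
Qed.

Section Linked.
Variables (T : Type) (phi : pixel -> option T) (w : T).

Lemma linked_trans y x z : linked phi w x y -> linked phi w y z -> linked phi w x z.
Proof.
move=> xy; elim=> // g _ IH; first exact: linked_fwd.
exact: linked_bwd.
Qed.

Lemma linked_adjacent x y : adjacent x y -> phi x = Some w -> phi y = Some w ->
  linked phi w x y.
Proof.
move=> /adjacent_gedge[g [[-> ->]|[-> ->]]] xw yw.
  by apply: linked_fwd => //; apply: linked_refl.
by apply: linked_bwd => //; apply: linked_refl.
Qed.

Lemma linked_sym x y : linked phi w x y -> linked phi w y x.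
Proof.
elim=> [xw|g xy IH gw|g xy IH gw]; first exact: linked_refl.
  apply: linked_trans IH; apply: linked_bwd (linked_end xy).
  exact: linked_refl.
apply: linked_trans IH; apply: linked_fwd (linked_end xy).
exact: linked_refl.
Qed.

Lemma linked_path x s y : path adjacent x s -> phi x = Some w ->
  (forall z, z \in s -> phi z = Some w) -> y \in x :: s -> linked phi w x y.
Proof.
elim: s x => [|z s IH] x /=; first by move=> _ xw _; rewrite inE => /eqP ->; apply: linked_refl.
move=> /andP[xz zs] xw sw; rewrite inE => /orP[/eqP->|ys]; first exact: linked_refl.
have zw : phi z = Some w by apply: sw; rewrite inE eqxx.
apply: linked_trans (linked_adjacent xz xw zw) _.
by apply: IH => // t ts; apply: sw; rewrite inE ts orbT.
Qed.

End Linked.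

(** The square of radius [rho] about [c], written without truncated subtraction. *)
Definition near_pixel rho (c x : pixel) :=
  [&& x.1 <= c.1 + rho, c.1 <= x.1 + rho, x.2 <= c.2 + rho & c.2 <= x.2 + rho].

Lemma near_pixel_linked (T : Type) (phi : pixel -> option T) w rho c x :
  (forall y, near_pixel rho c y -> phi y = Some w) -> near_pixel rho c x ->
  linked phi w c x.
Proof.
move=> box; have [n] := ubnP ((x.1 - c.1) + (c.1 - x.1) + (x.2 - c.2) + (c.2 - x.2)).
elim: n x => // n IH x lt_n bx; case: x c box IH lt_n bx => [i j] [k l] box IH.
rewrite /near_pixel /= => lt_n bx.
have step y : adjacent y (i, j) -> near_pixel rho (k, l) y ->
   ((y.1 - k) + (k - y.1) + (y.2 - l) + (l - y.2) < n) -> linked phi w (k, l) (i, j).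
  move=> ya yb yn; apply: linked_trans (IH y yn yb) _.
  by apply: linked_adjacent; rewrite ?box.
have [ik|ki|ik] := ltngtP i k.
- by apply: (step (i.+1, j)); rewrite /adjacent /near_pixel /= ?eqxx ?orbT //; lia.
- case: i ki lt_n bx step => // i ki lt_n bx step.
  by apply: (step (i, j)); rewrite /adjacent /near_pixel /= ?eqxx ?orbT //; lia.
have [jl|lj|jl] := ltngtP j l.
- by apply: (step (i, j.+1)); rewrite /adjacent /near_pixel /= ?eqxx ?orbT //; lia.
- case: j lj lt_n bx step => // j lj lt_n bx step.
  by apply: (step (i, j)); rewrite /adjacent /near_pixel /= ?eqxx ?orbT //; lia.
by rewrite ik jl; apply: linked_refl; apply: box; rewrite /near_pixel /=; lia.
Qed.

(** Cut at the last visit to [P], then at the first visit to [Q] after it. *)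
Lemma path_between (P Q : pred pixel) x p : (forall y, P y -> ~~ Q y) ->
  path adjacent x p -> P x -> Q (last x p) -> exists x0 q y0,
    [/\ path adjacent x0 (rcons q y0), P x0, Q y0,
        {subset q <= p} & forall y, y \in q -> ~~ P y && ~~ Q y].
Proof.
move=> PQ; have [n] := ubnP (size p); elim: n x p => // n IH x p lt_n xp Px Ql.
have [/hasP[y yp Py]|noP] := boolP (has P p).
  case/splitPr: yp lt_n xp Ql => p1 p2; rewrite size_cat /= cat_path last_cat /=.
  move=> lt_n /andP[_ /andP[_ yp2]] Ql.
  have [|x0 [q [y0 [q1 q2 q3 q4 q5]]]] := IH y p2 _ yp2 Py Ql; first by lia.
  by exists x0, q, y0; split=> // z /q4 zp; rewrite mem_cat inE zp !orbT.
have hQ : has Q p.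
  case: p Ql {lt_n xp noP} => [Qx|z p Ql]; first by have := PQ x Px; rewrite Qx.
  by apply/hasP; exists (last z p) => //; apply: mem_last.
case: (split_find hQ) xp noP => y p1 p2 Qy noQ; rewrite cat_path => /andP[xp1 _].
rewrite has_cat has_rcons !negb_or => /andP[/andP[_ noP] _].
exists x, p1, y; split=> // [z zp|z zp]; first by rewrite mem_cat mem_rcons inE zp orbT.
by rewrite (hasPn noP) // (hasPn noQ).
Qed.

(** Sampling and rounding an arc may repeat a pixel. *)
Definition still_or_adjacent x y := (x == y) || adjacent x y.

Lemma adjacent_subpath x p : path still_or_adjacent x p -> exists p',
  [/\ path adjacent x p', last x p' = last x p & {subset p' <= p}].
Proof.
elim: p x => [|y p IH] x /=; first by exists [::].
case/andP => xy /IH[p' [p1 p2 p3]]; case/orP: xy => [/eqP xy|xy].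
  by exists p'; rewrite xy; split=> // z /p3 zp; rewrite inE zp orbT.
exists (y :: p'); split=> //=; first by rewrite xy.
by move=> z; rewrite !inE => /orP[->//|/p3 ->]; rewrite orbT.
Qed.

Section Walks.
Variables (T : finType) (e : rel T) (E : {set {set T}}) (N rho : nat) (c : T -> pixel).
Variable region : {set T} -> pixel -> Prop.
Hypotheses (esym : symmetric e) (eirr : irreflexive e).
Hypothesis memE : forall u v, ([set u; v] \in E) = e u v.
Hypotheses
  (walks : forall A, A \in E -> exists u v p, [/\ A = [set u; v],
     path still_or_adjacent (c u) p, last (c u) p = c v & forall x, x \in p -> region A x])
  (region_near : forall A w x, A \in E -> region A x -> near_pixel rho (c w) x -> w \in A)
  (region_meet : forall A B x, A \in E -> B \in E -> A != B -> region A x -> region B x ->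
     exists w, near_pixel rho (c w) x)
  (near_inj : forall u v x, near_pixel rho (c u) x -> near_pixel rho (c v) x -> u = v)
  (region_box : forall A x, A \in E -> region A x -> [&& 0 < x.1, x.1 < N, 0 < x.2 & x.2 < N])
  (near_box : forall w x, near_pixel rho (c w) x -> [&& 0 < x.1, x.1 < N, 0 < x.2 & x.2 < N]).

Lemma near_refl w : near_pixel rho (c w) (c w).
Proof. by rewrite /near_pixel !leq_addr. Qed.

(* An arc gives a walk from near [c u] to near [c v] that avoids all the other
   neighbourhoods; between them it is assigned entirely to [u]. *)
Definition corridor A (uq : option T * seq pixel) := exists u v x0 y0,
  [/\ uq.1 = Some u, A = [set u; v], path adjacent x0 (rcons uq.2 y0),
      near_pixel rho (c u) x0 /\ near_pixel rho (c v) y0 &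
      forall x, x \in uq.2 -> region A x /\ forall w, ~~ near_pixel rho (c w) x].

Lemma corridor_exists : exists D : {set T} -> option T * seq pixel,
  forall A, A \in E -> corridor A (D A).
Proof.
apply: (@fin_all_exists _ _ (fun A uq => A \in E -> corridor A uq)) => A.
have [AE|nAE] := boolP (A \in E); last by exists (None, [::]).
have [u [v [p [Auv pth lst reg]]]] := walks AE.
have [p' [pth' lst' sub]] := adjacent_subpath pth.
have uv : u != v by move: AE; rewrite Auv memE; apply: contraTneq => ->; rewrite eirr.
have [|||x0 [q [y0 [q1 q2 q3 q4 q5]]]] :=
    @path_between (near_pixel rho (c u)) (near_pixel rho (c v)) (c u) p' _ pth'.
- by move=> y yu; apply/negP => /(near_inj yu) E'; rewrite E' eqxx in uv.
- exact: near_refl.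
- by rewrite lst' lst near_refl.
exists (Some u, q) => _; exists u, v, x0, y0; split=> // x /[dup] xq /q4/sub/reg rx.
split=> // w; apply/negP => wx; have := region_near AE rx wx.
by rewrite Auv !inE => /orP[]/eqP wE; have := q5 x xq; rewrite -wE wx ?andbF.
Qed.

Section Corridors.
Variable D : {set T} -> option T * seq pixel.
Hypothesis DP : forall A, A \in E -> corridor A (D A).

Definition label (x : pixel) : option T :=
  if [pick w | near_pixel rho (c w) x] is Some w then Some w
  else if [pick A | (A \in E) && (x \in (D A).2)] is Some A then (D A).1 else None.

Lemma label_near w x : near_pixel rho (c w) x -> label x = Some w.
Proof.
move=> wx; rewrite /label; case: pickP => [w' w'x|/(_ w)]; last by rewrite wx.
by rewrite (near_inj wx w'x).
Qed.

(** Corridors of distinct edges are disjoint: their regions meet only in vertex neighbourhoods,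
    which corridors avoid. *)
Lemma label_corridor A x : A \in E -> x \in (D A).2 -> label x = (D A).1.
Proof.
move=> AE xA; have [u [v [x0 [y0 [_ _ _ _ reg]]]]] := DP AE.
have [rx off] := reg x xA; rewrite /label.
case: pickP => [w wx|_]; first by have := off w; rewrite wx.
case: pickP => [B /andP[BE xB]|/(_ A)]; last by rewrite AE xA.
have [-> //|BA] := eqVneq B A.
have [u' [v' [x0' [y0' [_ _ _ _ reg']]]]] := DP BE.
have [w wx] := region_meet BE AE BA (reg' x xB).1 rx.
by have := off w; rewrite wx.
Qed.

Lemma labelP x w : label x = Some w -> near_pixel rho (c w) x \/
  exists A, [/\ A \in E, x \in (D A).2 & (D A).1 = Some w].
Proof.
rewrite /label; case: pickP => [w' w'x [<-]|_]; first by left.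
by case: pickP => [A /andP[AE xA] Aw|]; first by right; exists A.
Qed.

Lemma corridor_label A : A \in E -> exists u v x0 y0, [/\ A = [set u; v],
  path adjacent x0 (rcons (D A).2 y0), label x0 = Some u, label y0 = Some v &
  (D A).1 = Some u /\ forall x, x \in (D A).2 -> label x = Some u].
Proof.
move=> AE; have [u [v [x0 [y0 [Du Auv pth [n1 n2] reg]]]]] := DP AE.
exists u, v, x0, y0; split=> //; try exact: label_near.
by split=> // x xA; rewrite (label_corridor AE xA).
Qed.

Lemma label_linked x w : label x = Some w -> linked label w (c w) x.
Proof.
have near y : near_pixel rho (c w) y -> linked label w (c w) y.
  by apply: near_pixel_linked => z; apply: label_near.
case/labelP => [/near //|[A [AE xA Aw]]].
have [u [v [x0 [y0 [Du Auv pth [n1 n2] reg]]]]] := DP AE.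
have uw : u = w by move: Du; rewrite Aw => -[].
rewrite uw in n1; apply: linked_trans (near _ n1) _.
move: pth; rewrite rcons_path => /andP[pth _].
apply: linked_path pth _ _ _; first exact: label_near.
  by move=> z zA; rewrite (label_corridor AE zA).
by rewrite inE xA orbT.
Qed.

(** An edge is realised at the end of its corridor, where the label changes. *)
Lemma walks_grid_minor : grid_minor e N label.
Proof.
split.
- move=> i j w /labelP[/near_box //|[A [AE xA _]]].
  have [u [v [x0 [y0 [_ _ _ _ reg]]]]] := DP AE.
  exact: region_box AE (reg _ xA).1.
- move=> x y w xw yw; apply: linked_trans (label_linked yw).
  by apply: linked_sym; apply: label_linked.
- move=> u v; rewrite -memE => AE.
  have [u' [v' [x0 [y0 [Auv pth lx ly [_ lq]]]]]] := corridor_label AE.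
  move: pth; rewrite rcons_path => /andP[_ /adjacent_gedge[g gE]].
  have ll : label (last x0 (D [set u; v]).2) = Some u'.
    by have := mem_last x0 (D [set u; v]).2; rewrite inE => /orP[/eqP->|/lq].
  have [[uE vE]|[uE vE]] : (u = u' /\ v = v') \/ (u = v' /\ v = u').
    by move/eqP: Auv; rewrite set2_eq => /orP[]/andP[/eqP-> /eqP->]; [left|right].
    by exists g; rewrite uE vE; case: gE => -[<- <-]; [left|right].
  by exists g; rewrite uE vE; case: gE => -[<- <-]; [right|left].
Qed.

End Corridors.

Lemma walks_minor : exists phi, grid_minor e N phi.
Proof. by have [D DP] := corridor_exists; exists (label D); apply: walks_grid_minor. Qed.

End Walks.

(** * From a drawing to a grid minor *)

Module Drawing.
Import boolp classical_sets set_interval reals interval_inference topology normedtype.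
Import Order.TTheory GRing.Theory Num.Theory.
Import numFieldTopology.Exports.
Local Open Scope ring_scope.
Local Open Scope classical_set_scope.

(** * Compactness and uniform continuity *)

Section Metric.
Variable R : realType.

Lemma near0_ex (P : R -> Prop) : (\forall d \near 0^'+, P d) -> exists2 d, 0 < d & P d.
Proof.
move=> nP; near (0 : R)^'+ => d.
exists d; [by near: d; exact: nbhs_right_gt | by near: d].
Unshelve. all: by end_near. Qed.

(** Half the radius of a ball about [x] avoiding [C] serves all points within the other half, and
    compactness makes this uniform. *)
Lemma compact_closed_separated (X : pseudoMetricType R) (K C : set X) :
  compact K -> closed C -> K `&` C = set0 ->
  exists2 d : R, 0 < d & forall x y, K x -> C y -> ~ ball x d y.
Proof.
move=> /compact_near_coveringP cK clC KC.
have [|d d0 Kd] := @near0_ex (fun d => K `<=` [set x | forall y, C y -> ~ ball x d y]).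
  apply: cK => x Kx.
  have : nbhs x (~` C).
    apply: open_nbhs_nbhs; split; first by rewrite openC.
    by move=> Cx; have : (K `&` C) x by []; rewrite KC.
  case/nbhs_ballP => r /= r0 xC; have r20 : 0 < r / 2 by rewrite divr_gt0.
  exists (ball x (r / 2), [set d | d < r / 2]) => /=.
    by split; [exact: nbhsx_ballx | exact: nbhs_right_lt].
  move=> [x' d] /= [xx' dr] y Cy x'y; apply: (xC y) => //.
  rewrite [r]splitr; apply: ball_triangle xx' _.
  exact: le_ball (ltW dr) _ x'y.
by exists d => // x y Kx; apply: Kd.
Qed.

(** The Heine-Cantor theorem, again with halved radii. *)
Lemma unif_continuous_segment (X : pseudoMetricType R) (f : R -> X) (r : R) :
  {within `[0, 1], continuous f} -> 0 < r ->
  exists2 d : R, 0 < d & forall s t, 0 <= s <= 1 -> 0 <= t <= 1 -> `|s - t| < d ->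
    ball (f s) r (f t).
Proof.
move=> /subspace_continuousP cf r0.
have /compact_near_coveringP c01 : compact (`[0, 1] : set R) by exact: segment_compact.
have r20 : 0 < r / 2 by rewrite divr_gt0.
have [|d d0 Kd] := @near0_ex (fun d => `[0, 1] `<=` [set s | 0 <= s <= 1 ->
    forall t, 0 <= t <= 1 -> `|s - t| < d -> ball (f s) r (f t)]).
  apply: c01 => x /= x01; have := cf x x01 _ (nbhsx_ballx (f x) _ r20).
  case/nbhs_ballP => q /= q0 qx; have q20 : 0 < q / 2 by rewrite divr_gt0.
  exists (ball x (q / 2), [set d | d < q / 2]) => /=.
    by split; [exact: nbhsx_ballx | exact: nbhs_right_lt].
  move=> [s d] /= [xs dq] s01 t t01 st.
  have fs : ball (f x) (r / 2) (f s).
    apply: qx; last by rewrite /= in_itv.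
    by apply: le_ball xs; lra.
  have ft : ball (f x) (r / 2) (f t).
    apply: qx; last by rewrite /= in_itv.
    rewrite [q]splitr; apply: ball_triangle xs _.
    exact: lt_trans st dq.
  by rewrite [r]splitr; apply: ball_triangle (ball_sym fs) ft.
exists d => // s t s01; apply: Kd => //=; by rewrite in_itv.
Qed.

Lemma ball_pairE (x y : R * R) (r : R) :
  ball x r y <-> `|x.1 - y.1| < r /\ `|x.2 - y.2| < r.
Proof. by []. Qed.

Lemma fin_min (I : finType) (P : I -> R -> Prop) :
  (forall i r r', P i r -> 0 < r' -> r' <= r -> P i r') ->
  (forall i, exists2 r, 0 < r & P i r) -> exists2 r, 0 < r & forall i, P i r.
Proof.
move=> mono ex; have [f fP] : exists f : I -> R, forall i, 0 < f i /\ P i (f i).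
  by apply: (@fin_all_exists _ _ (fun i r => 0 < r /\ P i r)) => i; have [r r0 Pr] := ex i;
    exists r.
have [m m0 mf] : exists2 m : R, 0 < m & forall i, i \in enum I -> m <= f i.
  elim: (enum I) => [|i s [m m0 ms]]; first by exists 1.
  exists (Num.min (f i) m); first by rewrite lt_min m0 (fP i).1.
  move=> j; rewrite inE => /orP[/eqP->|/ms mj]; first by rewrite ge_min lexx.
  by rewrite ge_min mj orbT.
exists m => // i; apply: mono (fP i).2 m0 _.
by apply: mf; rewrite mem_enum.
Qed.

Lemma compact_bounded_pair (K : set (R * R)) : compact K ->
  exists L : R, forall x, K x -> `|x.1| < L /\ `|x.2| < L.
Proof.
move=> /compact_near_coveringP cK.
have : \forall L \near +oo%R, K `<=` [set x | `|x.1| < L /\ `|x.2| < L].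
  apply: cK => x Kx.
  exists (ball x 1, [set L | `|x.1| + `|x.2| + 1 < L]) => /=.
    by split; [exact: nbhsx_ballx | apply: nbhs_pinfty_gt; exact: num_real].
  move=> [y L] /= [/ball_pairE[b1 b2] xL].
  have := ler_normB x.1 (x.1 - y.1); have := ler_normB x.2 (x.2 - y.2).
  rewrite !opprB !addrA ![x.1 + y.1 - x.1]addrAC ![x.2 + y.2 - x.2]addrAC !subrr !add0r.
  have := normr_ge0 x.1; have := normr_ge0 x.2; lra.
by case/filter_ex => L KL; exists L => x /KL.
Qed.

End Metric.

Lemma mem_edges (T : finType) (e : rel T) : symmetric e ->
  forall u v, ([set u; v]%SET \in edges e) = e u v.
Proof.
move=> esym u v; apply/imsetP/idP => [[[a b]]|uv]; last by exists (u, v); rewrite ?inE.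
rewrite inE /= => ab /eqP; rewrite set2_eq.
case/orP => /andP[/eqP-> /eqP->]; [exact: ab|by rewrite esym].
Qed.

Lemma edges_pair (T : finType) (e : rel T) A : A \in edges e -> exists u v, A = [set u; v]%SET.
Proof. by case/imsetP => -[a b] _ ->; exists a, b. Qed.

Section Drawing.
Variables (R : realType) (T : finType) (e : rel T) (p : T -> R * R) (g : {set T} -> R -> R * R).
Hypotheses (esym : symmetric e) (eirr : irreflexive e) (dr : plane_drawing e p g).
Local Notation E := (edges e).

Let I01 (t : R) := 0 <= t <= 1.

Lemma arc_end A t : A \in E -> t = 0 \/ t = 1 -> exists2 u, u \in A & g A t = p u.
Proof.
move=> AE t01; have := drawing_arc_ends dr AE => /seteqP[sub _].
have [|u uA <-] := sub (g A t); first by case: t01 => ->; [left|right].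
by exists u.
Qed.

Lemma arc_ends A : A \in E -> exists u v, [/\ A = [set u; v]%SET, g A 0 = p u & g A 1 = p v].
Proof.
move=> AE; have [u uA gu] := arc_end AE (or_introl (erefl 0)).
have [v vA gv] := arc_end AE (or_intror (erefl 1)).
exists u, v; split=> //.
have uv : u != v.
  apply/eqP => uv; suff /eqP : (0 : R) = 1 by rewrite eq_sym oner_eq0.
  by apply: (drawing_arc_inj dr AE); rewrite ?gu ?gv ?uv //; apply/mem_set;
     rewrite /= in_itv /= lexx ler01.
have [a [b Aab]] := edges_pair AE.
have ab : (#|A| <= 2)%N by rewrite Aab cards2; case: (_ != _).
by symmetry; apply/eqP; rewrite eqEcard finset.subUset !finset.sub1set uA vA cards2 uv.
Qed.

Lemma inside01 (t : R) : I01 t -> [\/ t = 0, t = 1 | 0 < t < 1].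
Proof.
case/andP; rewrite le_eqVlt => /orP[/eqP<- _|t0]; first by constructor 1.
rewrite le_eqVlt => /orP[/eqP->|t1]; first by constructor 2.
by constructor 3; rewrite t0 t1.
Qed.

Lemma arc_off_vertex A w t : A \in E -> w \notin A -> I01 t -> g A t <> p w.
Proof.
have off u : u \in A -> w \notin A -> p u <> p w.
  by move=> uA wA /(drawing_vertex_inj dr) uw; rewrite uw (negPf wA) in uA.
move=> AE wA /inside01[t01|t01|t01]; last exact: (drawing_arc_vertex dr AE t01).
- by have [u uA ->] := arc_end AE (or_introl t01); apply: off.
- by have [u uA ->] := arc_end AE (or_intror t01); apply: off.
Qed.

Let arc A := g A @` `[0, 1].

Lemma arc_compact A : A \in E -> compact (arc A).
Proof.
move=> AE; apply: continuous_compact; first exact: (drawing_arc_continuous dr AE).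
exact: segment_compact.
Qed.

Lemma arcP A t : I01 t -> arc A (g A t).
Proof. by move=> t01; exists t => //=; rewrite in_itv. Qed.

Lemma hausdorff_plane : hausdorff_space (R * R)%type.
Proof.
rewrite ball_hausdorff => a b ab; pose m := Num.max `|a.1 - b.1| `|a.2 - b.2|.
have m0 : 0 < m / 2.
  rewrite divr_gt0 // lt_max !normr_gt0 !subr_eq0 -negb_and.
  by case: a b ab {m} => [a1 a2] [b1 b2]; rewrite xpair_eqE.
exists (PosNum m0, PosNum m0); apply/eqP/seteqP; split=> // x /= [].
move=> /ball_pairE[a1 a2] /ball_pairE[b1 b2].
have dist (s t u : R) : `|s - u| < m / 2 -> `|t - u| < m / 2 -> `|s - t| < m.
  move=> su tu; rewrite [m]splitr -(subrK u s) -addrA.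
  apply: le_lt_trans (ler_normD _ _) _; apply: ltrD => //.
  by rewrite distrC.
have : m < m by rewrite {1}/m gt_max (dist _ _ _ a1 b1) (dist _ _ _ a2 b2).
by rewrite ltxx.
Qed.

Lemma plane_closed1 (x : R * R) : closed [set x].
Proof. exact: accessible_closed_set1 (hausdorff_accessible hausdorff_plane) x. Qed.

Lemma vertices_separated : exists2 r : R, 0 < r &
  (forall u v, ball (p u) r (p v) -> u = v) /\
  (forall A w t, A \in E -> I01 t -> ball (g A t) r (p w) -> w \in A).
Proof.
have [r1 r10 P1] : exists2 r : R, 0 < r & forall uv : T * T,
    ball (p uv.1) r (p uv.2) -> uv.1 = uv.2.
  apply: (fin_min (P := fun (uv : T * T) r => ball (p uv.1) r (p uv.2) -> uv.1 = uv.2)).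
    by move=> uv r r' P r'0 r'r /(le_ball r'r)/P.
  move=> [u v] /=; have [->|uv] := eqVneq u v; first by exists 1.
  have [|r r0 sep] := compact_closed_separated (@compact_set1 _ (p u)) (@plane_closed1 (p v)).
    by apply/seteqP; split=> x //= [-> /(drawing_vertex_inj dr)/eqP]; rewrite (negPf uv).
  by exists r => // b; case: (sep (p u) (p v)).
have [r2 r20 P2] : exists2 r : R, 0 < r & forall Aw : {set T} * T, Aw.1 \in E ->
    forall t, I01 t -> ball (g Aw.1 t) r (p Aw.2) -> Aw.2 \in Aw.1.
  apply: (fin_min (P := fun (Aw : {set T} * T) r => Aw.1 \in E ->
    forall t, I01 t -> ball (g Aw.1 t) r (p Aw.2) -> Aw.2 \in Aw.1)).
    by move=> Aw r r' P r'0 r'r AE t t01 /(le_ball r'r)/(P AE t t01).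
  move=> [A w] /=; have [AE|nAE] := boolP (A \in E); last by exists 1.
  have [wA|wA] := boolP (w \in A); first by exists 1.
  have [|r r0 sep] := compact_closed_separated (arc_compact AE) (@plane_closed1 (p w)).
    apply/seteqP; split=> x //= [[t] /=]; rewrite in_itv /= => t01 <- .
    by move/(arc_off_vertex AE wA t01).
  by exists r => // _ t t01 b; case: (sep _ _ (arcP A t01) (erefl (p w)) b).
exists (Num.min r1 r2); first by rewrite lt_min r10.
split=> [u v b|A w t AE t01 b].
  by apply: (P1 (u, v)); apply: le_ball b; rewrite ge_min lexx.
by apply: (P2 (A, w) AE t t01); apply: le_ball b; rewrite ge_min lexx orbT.
Qed.

(** Outside the open balls about the vertices, two arcs leave disjoint compact sets, hence sets at
    positive distance. Interiors are taken in [off] to make it closed. *)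
Lemma arcs_separated (r : R) : 0 < r -> exists2 d : R, 0 < d & forall A B s t,
  A \in E -> B \in E -> A != B -> I01 s -> I01 t -> ball (g A s) d (g B t) ->
  exists v, ball (p v) r (g A s) \/ ball (p v) r (g B t).
Proof.
move=> r0; pose off := ~` \bigcup_(v in [set: T]) (ball (p v) r)°.
have off_closed : closed off.
  by rewrite /off closedC; apply: bigcup_open => v _; exact: open_interior.
have off_vertex v : ~ off (p v).
  by apply; exists v => //; exact: nbhsx_ballx.
have nball x : (forall v, ~ ball (p v) r x) -> off x.
  by move=> nb [v _ /interior_subset]; exact: nb.
have [d d0 P] : exists2 d : R, 0 < d & forall AB : {set T} * {set T},
    AB.1 \in E -> AB.2 \in E -> AB.1 != AB.2 -> forall x y,
    (arc AB.1 `&` off) x -> (arc AB.2 `&` off) y -> ~ ball x d y.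
  apply: (fin_min (P := fun (AB : {set T} * {set T}) d =>
    AB.1 \in E -> AB.2 \in E -> AB.1 != AB.2 -> forall x y,
    (arc AB.1 `&` off) x -> (arc AB.2 `&` off) y -> ~ ball x d y)).
    by move=> AB d d' P d'0 d'd A1 A2 A12 x y x1 y2 /(le_ball d'd); apply: P.
  move=> [A B] /=; have [AE|nAE] := boolP (A \in E); last by exists 1.
  have [BE|nBE] := boolP (B \in E); last by exists 1.
  have [AB|AB] := eqVneq A B; first by exists 1.
  have [|||d d0 sep] := @compact_closed_separated R _ (arc A `&` off) (arc B `&` off).
  - exact: compact_closedI (arc_compact AE) off_closed.
  - apply: closedI off_closed; apply: compact_closed (arc_compact BE).
    exact: hausdorff_plane.
  - apply/seteqP; split=> x //= [[[s /=]]]; rewrite in_itv /= => s01 <- offs [[t /=]].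
    rewrite in_itv /= => t01 E' _.
    have inner C q : C \in E -> I01 q -> off (g C q) -> 0 < q < 1.
      move=> CE /inside01[q01|q01|//] offq.
        by have [u _ gu] := arc_end CE (or_introl q01); case: (off_vertex u); rewrite -gu.
      by have [u _ gu] := arc_end CE (or_intror q01); case: (off_vertex u); rewrite -gu.
    apply: (drawing_arc_arc dr AE BE AB (inner A s AE s01 offs) (inner B t BE t01 _)).
      by rewrite E'.
    by rewrite E'.
  by exists d.
exists d => // A B s t AE BE AB s01 t01 b.
have [[v vb]|no] := pselect (exists v, ball (p v) r (g A s) \/ ball (p v) r (g B t)).
  by exists v.
have offA : off (g A s) by apply: nball => v vb; apply: no; exists v; left.
have offB : off (g B t) by apply: nball => v vb; apply: no; exists v; right.
by case: (P (A, B) AE BE AB _ _ (conj (arcP A s01) offA) (conj (arcP B t01) offB) b).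
Qed.

Lemma drawing_bounded : exists L : R, (forall v, `|(p v).1| < L /\ `|(p v).2| < L) /\
  forall A t, A \in E -> I01 t -> `|(g A t).1| < L /\ `|(g A t).2| < L.
Proof.
have ub (I : finType) (P : I -> R -> Prop) : (forall i r r', P i r -> r <= r' -> P i r') ->
    (forall i, exists r, P i r) -> exists r, forall i, P i r.
  move=> mono ex; have [f fP] := @fin_all_exists _ (fun=> R) P ex.
  have [m mf] : exists m : R, forall i, i \in enum I -> f i <= m.
    elim: (enum I) => [|i s [m ms]]; first by exists 1.
    exists (Num.max (f i) m) => j; rewrite inE le_max => /orP[/eqP->|/ms ->].
      by rewrite lexx.
    by rewrite orbT.
  by exists m => i; apply: mono (fP i) _; apply: mf; rewrite mem_enum.
have [L1 P1] : exists L : R, forall v, `|(p v).1| < L /\ `|(p v).2| < L.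
  apply: (ub _ (fun v L => `|(p v).1| < L /\ `|(p v).2| < L)).
    by move=> v r r' [h1 h2] rr; split; [exact: lt_le_trans h1 rr|exact: lt_le_trans h2 rr].
  move=> v; exists (`|(p v).1| + `|(p v).2| + 1).
  by have := normr_ge0 (p v).1; have := normr_ge0 (p v).2; split; lra.
have [L2 P2] : exists L : R, forall A, A \in E -> forall t, I01 t ->
    `|(g A t).1| < L /\ `|(g A t).2| < L.
  apply: (ub _ (fun A L => A \in E -> forall t, I01 t -> `|(g A t).1| < L /\ `|(g A t).2| < L)).
    by move=> A r r' P rr AE t t01; have [h1 h2] := P AE t t01;
       split; [exact: lt_le_trans h1 rr|exact: lt_le_trans h2 rr].
  move=> A; have [AE|nAE] := boolP (A \in E); last by exists 0.
  have [L LP] := compact_bounded_pair (arc_compact AE).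
  by exists L => _ t t01; apply: LP; exact: arcP.
exists (Num.max L1 L2); split=> [v|A t AE t01]; rewrite !lt_max.
  by have [-> ->] := P1 v.
by have [-> ->] := P2 A AE t t01; rewrite !orbT.
Qed.

End Drawing.

Lemma truncn_leD (R : realType) (a b : R) (m : nat) : 0 <= a -> 0 <= b -> a < b + m%:R ->
  (Num.truncn a <= Num.truncn b + m)%N.
Proof.
move=> a0 b0 ab; have /andP[ta _] := truncn_itv a0; have /andP[_ tb] := truncn_itv b0.
rewrite -ltnS -addSn -(ltr_nat R) natrD; apply: le_lt_trans ta _.
by apply: lt_trans ab _; rewrite ltrD2r.
Qed.

Lemma truncn_ltD (R : realType) (a b : R) (m : nat) : 0 <= a -> 0 <= b ->
  (Num.truncn a <= Num.truncn b + m)%N -> a < b + m.+1%:R.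
Proof.
move=> a0 b0; have /andP[_ ta] := truncn_itv a0; have /andP[tb _] := truncn_itv b0.
rewrite -(ler_nat R) natrD => ab; apply: lt_le_trans ta _.
rewrite -natr1 -(natr1 m); lra.
Qed.

Lemma near_trans i j x y z : near_pixel i x y -> near_pixel j y z -> near_pixel (i + j) x z.
Proof. by move=> /and4P[? ? ? ?] /and4P[? ? ? ?]; apply/and4P; split; lia. Qed.

Lemma near_pixelW i j x z : near_pixel i x z -> (i <= j)%N -> near_pixel j x z.
Proof. by move=> /and4P[h1 h2 h3 h4] ij; apply/and4P; split; lia. Qed.

(** A diagonal step is replaced by two steps around a corner. *)
Lemma step_adjacent (x y : pixel) : near_pixel 1 x y ->
  path still_or_adjacent x [:: (y.1, x.2); y].
Proof.
case: x y => [i j] [k l] /and4P[/= h1 h2 h3 h4].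
rewrite /still_or_adjacent /adjacent /= !xpair_eqE !eqxx /= andbT.
have [->|ik] := eqVneq i k; have [->|jl] := eqVneq j l; rewrite //=; lia.
Qed.

(** * Rounding points of the plane to pixels of side [1/K] *)

Section Pixelisation.
Variables (R : realType) (K L : R).
Hypothesis K0 : 0 < K.

Definition good (x : R * R) := `|x.1| < L /\ `|x.2| < L.

(** The shift keeps the scaled coordinates of a good point at least [4 * K], so that small
    neighbourhoods of its pixel stay off the axes. *)
Definition coord (a : R) := Num.truncn (K * (a + (L + 4))).

Definition pix (x : R * R) : pixel := (coord x.1, coord x.2).

Lemma coord_ge0 a : `|a| < L -> 4 * K <= K * (a + (L + 4)).
Proof. by rewrite ltr_norml mulrC ler_pM2l // => /andP[]; lra. Qed.

Lemma coord_pos a : `|a| < L -> 0 <= K * (a + (L + 4)).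
Proof. by move=> /coord_ge0; apply: le_trans; rewrite mulr_ge0 // ltW. Qed.

Lemma coord_near a b m : `|a| < L -> `|b| < L -> K * `|a - b| < m%:R ->
  (coord a <= coord b + m)%N.
Proof.
move=> /coord_pos a0 /coord_pos b0 ab; apply: truncn_leD => //.
have : K * (a - b) <= K * `|a - b| by rewrite ler_pM2l // ler_norm.
by move: ab; move: (K * `|a - b|) (m%:R : R) => u v uv; rewrite !mulrDr mulrN; lra.
Qed.

Lemma coord_far a b m : `|a| < L -> `|b| < L -> (coord a <= coord b + m)%N ->
  (coord b <= coord a + m)%N -> K * `|a - b| < m.+1%:R.
Proof.
move=> /coord_pos a0 /coord_pos b0 ab ba.
have h1 : K * (a + (L + 4)) < K * (b + (L + 4)) + m.+1%:R by apply: truncn_ltD.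
have h2 : K * (b + (L + 4)) < K * (a + (L + 4)) + m.+1%:R by apply: truncn_ltD.
rewrite -[K in K * _]gtr0_norm // -normrM ltr_norml mulrBr; move: h1 h2; rewrite !mulrDr.
by move=> h1 h2; apply/andP; split; lra.
Qed.

Lemma near_ball x y z i j : good x -> good y -> near_pixel i (pix x) z ->
  near_pixel j (pix y) z -> ball x ((i + j).+1%:R / K) y.
Proof.
move=> [x1 x2] [y1 y2] /and4P[/= xz1 zx1 xz2 zx2] /and4P[/= yz1 zy1 yz2 zy2].
apply/ball_pairE; rewrite !ltr_pdivlMr // ![_ * K]mulrC; split.
  by apply: coord_far => //; lia.
by apply: coord_far => //; lia.
Qed.

Lemma ball_near x y s m : good x -> good y -> ball x s y -> K * s <= m%:R ->
  near_pixel m (pix x) (pix y).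
Proof.
move=> [x1 x2] [y1 y2] /ball_pairE[b1 b2] Ks.
have lt a : a < s -> K * a < m%:R.
  by move=> as_; apply: lt_le_trans Ks; rewrite ltr_pM2l.
by apply/and4P; split; apply: coord_near => //; apply: lt; rewrite // distrC.
Qed.

Lemma pix_box x z m N : good x -> near_pixel m (pix x) z -> m.+1%:R <= 4 * K ->
  (Num.truncn (K * (2 * L + 4)) + m < N)%N -> [&& 0 < z.1, z.1 < N, 0 < z.2 & z.2 < N]%N.
Proof.
move=> [x1 x2] /and4P[/= xz1 zx1 xz2 zx2] mK mN.
have lo a : `|a| < L -> (m < coord a)%N.
  by move=> /coord_ge0; rewrite truncn_gt_nat; apply: le_trans.
have hi a : `|a| < L -> (coord a <= Num.truncn (K * (2 * L + 4)))%N.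
  rewrite ltr_norml => /andP[_ aL]; apply: le_truncn; rewrite ler_pM2l //; lra.
have l1 := lo _ x1; have l2 := lo _ x2; have h1 := hi _ x1; have h2 := hi _ x2.
by apply/and4P; split; lia.
Qed.

End Pixelisation.

Lemma box_arith m : (0 < m)%N ->
  ((1 + (m + 2)).+1 <= 8 * m)%N /\ ((m + 2 + (m + 2)).+1 <= 8 * m)%N.
Proof. by move=> m0; split; lia. Qed.

Lemma bounding_nat (R : realType) (c x : R) : 0 < x -> exists2 n : nat, (0 < n)%N & c < n%:R * x.
Proof.
move=> x0; exists (Num.truncn (c / x)).+1 => //.
by rewrite -ltr_pdivrMr // truncnS_gt.
Qed.

Lemma drawing_minor (R : realType) (T : finType) (e : rel T) (p : T -> R * R)
    (g : {set T} -> R -> R * R) : symmetric e -> irreflexive e -> plane_drawing e p g ->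
  exists N phi, grid_minor e N phi.
Proof.
move=> esym eirr dr.
have [r r0 [sepV sepA]] := vertices_separated dr.
(* The 8 absorbs the sums of pixel radii in [box_arith]; the 3 below bounds, in pixels, the distance
   of two points whose pixels are within 1 of a common one. *)
have [n n0 nr] := bounding_nat 8 r0.
have n0R : 0 < n%:R :> R by rewrite ltr0n.
have nV0 : 0 < n%:R^-1 :> R by rewrite invr_gt0.
have [d d0 sepB] := arcs_separated dr nV0.
have [m m0 md] := bounding_nat 3 d0.
have m1R : 1 <= m%:R :> R by rewrite ler1n.
have [L [Lp Lg]] := drawing_bounded dr.
(* The pixels have side 1/K. Vertex neighbourhoods of rho pixels have radius at
   most 3/n < 3r/8, so they are disjoint and meet only the arcs of incident edges.
   An overlap of two arc regions brings their arcs within 3/K < d/n of each other,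
   hence within 1/n = m/K of a common vertex. *)
pose K : R := (n * m)%:R; pose rho := (m + 2)%N.
have KE : K = n%:R * m%:R by rewrite /K natrM.
have n1R : 1 <= n%:R :> R by rewrite ler1n.
have mK : m%:R <= K by rewrite KE ler_peMl // ltW // ltr0n.
have K0 : 0 < K by apply: lt_le_trans mK; rewrite ltr0n.
pose c v := pix K L (p v); pose N := (Num.truncn (K * (2 * L + 4)) + rho).+1.
pose region A x := exists2 t : R, 0 <= t <= 1 & near_pixel 1 (pix K L (g A t)) x.
exists N; have Ksmall (k : nat) (s : R) : k%:R <= K * s -> k%:R / K <= s.
  by rewrite ler_pdivrMr // mulrC.
have Kr : 8 * m%:R <= K * r.
  by rewrite KE mulrAC ler_wpM2r // ltW // mulrC.
apply: (@walks_minor _ e (edges e) N rho c region eirr (mem_edges esym)).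
- move=> A AE; have [u [v [Auv gu gv]]] := arc_ends dr AE.
  have cont := drawing_arc_continuous dr AE.
  have KV0 : 0 < K^-1 by rewrite invr_gt0.
  (* With [k] equal time steps, successive points of the arc are within [1/K], hence in equal or
     neighbouring pixels, possibly diagonal ones. *)
  have [q q0 unif] := unif_continuous_segment cont KV0.
  have [k k0 kq] := bounding_nat 1 q0.
  have k0R : 0 < k%:R :> R by rewrite ltr0n.
  have t01 i : (i <= k)%N -> 0 <= (i%:R / k%:R : R) <= 1.
    by move=> ik; rewrite divr_ge0 ?ler0n // ler_pdivrMr // mul1r ler_nat.
  have walk i : (i <= k)%N -> exists s, [/\ path still_or_adjacent (c u) s,
      last (c u) s = pix K L (g A (i%:R / k%:R)) & forall x, x \in s -> region A x].
    elim: i => [|i IH] ik; first by exists [::]; split; rewrite //= mul0r gu.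
    have [s [s1 s2 s3]] := IH (ltnW ik).
    have ti := t01 _ (ltnW ik); have ti1 := t01 _ ik.
    have near1 : near_pixel 1 (pix K L (g A (i%:R / k%:R))) (pix K L (g A (i.+1%:R / k%:R))).
      apply: (ball_near K0 (Lg _ _ AE ti) (Lg _ _ AE ti1) (s := K^-1)); last first.
        by rewrite divff // gt_eqF.
      apply: unif => //; rewrite distrC -mulrBl -natrB // subSnn normrM normr1 mul1r.
      by rewrite gtr0_norm ?invr_gt0 // -[_^-1]mul1r ltr_pdivrMr // mulrC.
    exists (s ++ [:: ((pix K L (g A (i.+1%:R / k%:R))).1, (pix K L (g A (i%:R / k%:R))).2);
                     pix K L (g A (i.+1%:R / k%:R))]); split.
    + by rewrite cat_path s1 s2; apply: step_adjacent.
    + by rewrite last_cat.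
    + move=> x; rewrite mem_cat => /orP[/s3 //|]; rewrite !inE => /orP[]/eqP ->.
        exists (i%:R / k%:R) => //; move: near1 => /and4P[h1 h2 _ _].
        by apply/and4P; split; rewrite //= ?h1 ?h2 // leq_addr.
      by exists (i.+1%:R / k%:R) => //; apply/and4P; split; rewrite //= leq_addr.
  have [s [s1 s2 s3]] := walk k (leqnn k).
  exists u, v, s; split=> //.
  by rewrite s2 divff ?gt_eqF // gv.
- move=> A w x AE [t t01 At] wx.
  apply: (sepA A w t AE t01); have := near_ball K0 (Lg A t AE t01) (Lp w) At wx.
  apply: le_ball; apply: Ksmall; apply: le_trans Kr; rewrite /rho.
  by rewrite -natrM ler_nat (box_arith m0).1.
- move=> A B x AE BE AB [s s01 As] [t t01 Bt].
  have [|v vb] := sepB A B s t AE BE AB s01 t01.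
    have := near_ball K0 (Lg A s AE s01) (Lg B t BE t01) As Bt.
    apply: le_ball; apply: Ksmall; rewrite KE -mulrA.
    apply: le_trans (ltW md) _; rewrite ler_peMl // mulr_ge0 ?ler0n // ltW //.
  have near_v C q : C \in edges e -> 0 <= q <= 1 -> near_pixel 1 (pix K L (g C q)) x ->
      ball (p v) n%:R^-1 (g C q) -> near_pixel rho (c v) x.
    move=> CE q01 Cx b.
    have Kn : K * n%:R^-1 <= m%:R by rewrite KE mulrAC mulfV ?gt_eqF // mul1r.
    have vC := ball_near K0 (Lp v) (Lg C q CE q01) b Kn.
    have vx := near_trans vC Cx; rewrite /c.
    by apply: (near_pixelW vx); rewrite /rho leq_add2l.
  by exists v; case: vb; [apply: near_v As|apply: near_v Bt].
- move=> u v x ux vx; apply: sepV; have := near_ball K0 (Lp u) (Lp v) ux vx.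
  apply: le_ball; apply: Ksmall; apply: le_trans Kr; rewrite /rho.
  by rewrite -natrM ler_nat (box_arith m0).2.
- move=> A x AE [t t01 Ax]; apply: (pix_box K0 (Lg A t AE t01) Ax).
    rewrite -[2%:R]/(2 : R); have := mK; lra.
  by rewrite /N ltnS leq_add2l /rho addn2.
- move=> w x wx; apply: (pix_box K0 (Lp w) wx); last by rewrite /N.
  rewrite /rho -addnS natrD; have := mK; lra.
Qed.

End Drawing.
Import Drawing.

(** * The theorem *)

Lemma eq_buildable (T : finType) (k : T -> nat) (h h' : rel T) (S A : {set T}) :
  {in S &, h =2 h'} -> A \subset S -> buildable k h set0 A -> buildable k h' set0 A.
Proof.
move=> hh' + bA; elim: bA => [_|{}A v _ IH vA dv]; first exact: buildable_refl.
rewrite subUset sub1set => /andP[vS AS]; apply: buildable_add vA _; first exact: IH.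
apply: leq_trans dv; apply: subset_leq_card; apply/subsetP => u; rewrite !inE.
by move=> /andP[uA]; rewrite uA -hh' // (subsetP AS).
Qed.

Lemma eq_decomposable (T : finType) (e e' : rel T) (S : {set T}) :
  {in S &, e =2 e'} -> decomposable e S -> decomposable e' S.
Proof.
move=> ee' [m [M b]]; have [mK me mS] := M; exists m; split; last first.
  apply: eq_buildable (subxx S) b => u v uS vS; by rewrite /unmatched /= ee'.
split=> // v; have [vS|vS] := boolP (v \in S); last by left; apply: mS.
by rewrite -ee' ?(matching_on_stable M).
Qed.

Lemma no_has_cycle (T : finType) (e e' : rel T) k : subrel e' e -> 2 < k ->
  ~ has_cycle e k -> no_cycle e' k.
Proof.
move=> sub k2 nc s sk su; apply/negP => cs; apply: nc; split=> //.
have /eqP sz := sk; exists (Tuple sz); rewrite /ucycle /= su andbT.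
exact: sub_cycle cs.
Qed.

Section Planar.
Variables (R : realType) (T : finType) (e : rel T) (l : nat).
Hypotheses (esym : symmetric e) (eirr : irreflexive e) (hl : l \in [:: 5; 6; 7]).
Hypothesis planar_e : planar_without_cycles R e 4 l.

Lemma induced_drawing (e' : rel T) : subrel e' e -> planar R e -> planar R e'.
Proof.
move=> sub [p [g [inj cont ginj ends off meet]]]; exists p, g.
have subE A : A \in edges e' -> A \in edges e.
  by case/imsetP => -[a b]; rewrite inE /= => /sub ab ->; apply/imsetP; exists (a, b); rewrite ?inE.
split=> //.
- by move=> A /subE; apply: cont.
- by move=> A /subE; apply: ginj.
- by move=> A /subE; apply: ends.
- by move=> A v t /subE; apply: off.
- by move=> A B s t /subE AE /subE; apply: meet.
Qed.

Lemma all_decomposable S : decomposable e S.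
Proof.
have [n] := ubnP #|S|; elim: n S => // n IH S lt_n.
have [->|S0] := eqVneq S set0.
  exists id; split; last exact: buildable_refl.
  by split=> // v; left.
(* Restricting the relation rather than the type makes the vertices outside [S] isolated. *)
pose eS : rel T := [rel u v | [&& e u v, u \in S & v \in S]].
have eSsym : symmetric eS by move=> u v; rewrite /eS /= esym andbCA andbC -andbA andbC -andbA;
  case: (e v u); case: (u \in S); case: (v \in S).
have eSirr : irreflexive eS by move=> u; rewrite /eS /= eirr.
have sub : subrel eS e by move=> u v /and3P[].
have eqS (A : {set T}) : A \subset S -> {in A &, eS =2 e}.
  by move=> /subsetP AS u v /AS uS /AS vS; rewrite /eS /= uS vS !andbT.
have reduce X m : X != set0 -> X \subset S -> matching_on eS m X ->
    buildable (fun=> 2) (unmatched eS m) (S :\: X) S -> decomposable e S.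
  move=> /set0Pn[x xX] XS mX bX.
  apply: (@eq_decomposable _ eS); first exact: eqS.
  apply: (decomposable_reduce XS mX bX); apply: (@eq_decomposable _ e).
    by move=> u v uA vA; rewrite (eqS (S :\: X)) ?subsetDl.
  apply: IH; rewrite -ltnS; apply: leq_trans lt_n; rewrite ltnS; apply: proper_card.
  apply/properP; split; first exact: subsetDl.
  by exists x; rewrite ?inE ?xX // (subsetP XS).
apply: boolp.contrapT => nd.
have irred : ~ reducible eS S by case=> X [m [X0 XS mX bX]]; apply: nd; apply: reduce X0 XS mX bX.
have [pl noC4 noCl] := planar_e.
have [p [g dr]] := induced_drawing sub pl.
have [N [phi M]] := drawing_minor eSsym eSirr dr.
have memE := mem_edges eSsym.
have [F0 FS] := grid_minor_faces eSirr memE (@edges_pair _ eS) M.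
have l2 : 2 < l by move: hl; rewrite !inE => /or3P[]/eqP->.
have inS u v : eS u v -> u \in S by case/and3P.
apply: (reducible_config eSsym eSirr memE (@edges_pair _ eS) inS FS _ hl _ S0 _ irred).
- exact: no_has_cycle sub _ noC4.
- exact: no_has_cycle sub l2 noCl.
(* A vertex with at most two neighbours in [S] can be added last, unmatched. *)
move=> v vS; rewrite leqNgt; apply/negP; rewrite ltnS => dv; apply: irred.
exists [set v], id; split.
- by apply/set0Pn; exists v; rewrite inE.
- by rewrite sub1set.
- by split=> // u; left.
rewrite -[X in buildable _ _ _ X](setD1K vS); apply: buildable_add.
- exact: buildable_refl.
- by rewrite !inE eqxx.
- apply: leq_trans dv; apply: subset_leq_card; apply/subsetP => u; rewrite !inE.
  by rewrite /unmatched /= => /and3P[/andP[_ ->] + _]; rewrite -/(eS u v) eSsym.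
Qed.

End Planar.

(** * From involutions to sets of edges *)

Section Matching.
Variables (T : finType) (e : rel T) (m : T -> T).
Hypotheses (esym : symmetric e) (eirr : irreflexive e) (mP : matching_on e m setT).

Definition matching_edges := [set [set v; m v] | v : T & m v != v].

Lemma matching_edges_matching : is_matching e matching_edges.
Proof.
have [mK me _] := mP; split.
  apply/subsetP => A /imsetP[v]; rewrite inE => mv ->; apply/imsetP; exists (v, m v) => //.
  by rewrite inE /=; case: (me v) mv => [->|//]; rewrite eqxx.
apply/trivIsetP => _ _ /imsetP[v _ ->] /imsetP[w _ ->] neq.
rewrite disjoints_subset; apply/subsetP => u; rewrite !inE => uv.
apply: contra neq => uw; apply/eqP.
have E x : (u == x) || (u == m x) -> [set x; m x] = [set u; m u].
  by case/orP => /eqP ->; rewrite ?mK // setUC.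
by rewrite (E v uv) (E w uw).
Qed.

Lemma del_matching u v : del_edges e matching_edges u v = unmatched e m u v.
Proof.
have [mK me _] := mP; rewrite /del_edges /unmatched /=.
case uv: (e u v) => //=; congr negb; apply/imsetP/eqP => [[w _ /eqP]|uE].
  by rewrite set2_eq => /orP[]/andP[/eqP-> /eqP->]; rewrite ?mK.
exists v; rewrite ?inE; last by rewrite uE setUC.
by apply: contraTneq uv => vE; rewrite uE vE eirr.
Qed.

End Matching.

Theorem theorem2p1 (R : realType) (l : nat) (hl : l \in [:: 5; 6; 7])
    (T : finType) (e : rel T) (esym : symmetric e) (eirr : irreflexive e)
    (hG : planar_without_cycles R e 4 l) :
  exists M : {set {set T}}, is_matching e M /\ (AT (del_edges e M) <= 3)%N.
Proof.
have [m [mP bT]] := all_decomposable esym eirr hl hG setT.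
exists (matching_edges m); split; first exact: matching_edges_matching mP.
have del := del_matching eirr mP; apply: ATDegenerate.AT_le3.
- by move=> u v; rewrite /del_edges /= esym setUC.
- by move=> u; rewrite /del_edges /= eirr.
- by apply: eq_buildable (subxx _) bT => u v _ _; rewrite del.
Qed.
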